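(* Let $u\in\mathscr{D}'_{\mathcal{L}}(\mathbb{R},\mathscr{S}'(\mathbb{R}^d))$ and let $a\in S^\mu(\mathbb{R}^d\times\mathbb{R}^d)$ or $a\in S^{m,\mu}(\mathbb{R}^d\times\mathbb{R}^d)$, with $m,\mu\in\mathbb{R}$. Then $\operatorname{Op}(a)u\in\mathscr{D}'_{\mathcal{L}}(\mathbb{R},\mathscr{S}'(\mathbb{R}^d))$, $\lambda(\operatorname{Op}(a)u)\le\lambda(u)$, and $$\mathcal{L}[\operatorname{Op}(a)u]=\operatorname{Op}(a)(\mathcal{L}u)\quad\text{on }\mathbb{C}_{\lambda(u)}=\{s\in\mathbb{C}:\operatorname{Re}s>\lambda(u)\}.$$
   Context: Notation: $\langle y\rangle=\sqrt{1+|y|^2}$; $e_\tau(t)=\exp(-\tau t)$ for $t\in\mathbb{R}$, $\tau\in\mathbb{C}$. Symbols: $S^{m,\mu}(\mathbb{R}^d\times\mathbb{R}^d)$ (SG-symbols) is the set of $a\in C^\infty(\mathbb{R}^d\times\mathbb{R}^d)$ such that for all multi-indices $\alpha,\beta$ there is $C_{\alpha\beta}>0$ with $|\partial_x^\alpha\partial_\xi^\beta a(x,\xi)|\le C_{\alpha\beta}\langle x\rangle^{m-|\alpha|}\langle\xi\rangle^{\mu-|\beta|}$ for all $x,\xi$. $S^\mu(\mathbb{R}^d\times\mathbb{R}^d)$ is the usual (Hörmander) class, with the bounds $|\partial_x^\alpha\partial_\xi^\beta a(x,\xi)|\le C_{\alpha\beta}\langle\xi\rangle^{\mu-|\beta|}$.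 $(\operatorname{Op}(a)w)(x)=(2\pi)^{-d}\int e^{ix\cdot\xi}a(x,\xi)\hat w(\xi)\,d\xi$ for $w\in\mathscr{S}(\mathbb{R}^d)$, extended by duality to a continuous operator on $\mathscr{S}'(\mathbb{R}^d)$. On $\mathscr{S}'(\mathbb{R}^d)$-valued distributions $u$ in the variable $t$, $\operatorname{Op}(a)$ acts in the $x$-variable only, i.e. as $\mathrm{id}\otimes\operatorname{Op}(a)$: $(\operatorname{Op}(a)u)(\psi)=\operatorname{Op}(a)(u(\psi))$ for test functions $\psi$ of $t$. Likewise $(\operatorname{Op}(a)(\mathcal{L}u))(s)=\operatorname{Op}(a)((\mathcal{L}u)(s))$. Transformable distributions: $\mathscr{D}'_{\mathcal{L}}(\mathbb{R},\mathscr{S}'(\mathbb{R}^d))$ is the set of $u\in\mathscr{D}'(\mathbb{R},\mathscr{S}'(\mathbb{R}^d))$ (continuous linear maps $\mathscr{D}(\mathbb{R})\to\mathscr{S}'(\mathbb{R}^d)$) such that $\operatorname{supp}u\subseteq[0,+\infty)$ and there is $\lambda\in\mathbb{R}$ with $e_\lambda u\in\mathscr{S}'(\mathbb{R},\mathscr{S}'(\mathbb{R}^d))\simeq\mathscr{S}'(\mathbb{R}^{1+d})$. The abscissa of convergence is $\lambda(u)=\inf\{\lambda\in\mathbb{R}:e_\lambda u\in\mathscr{S}'(\mathbb{R},\mathscr{S}'(\mathbb{R}^d))\}\in[-\infty,+\infty)$. Let $\zeta\in C^\infty(\mathbb{R})$ satisfy, for some $c>0$, $\zeta(t)=0$ for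 $t\le-c$ and $\zeta(t)=1$ for $t\ge-c/2$. The Laplace transform of $u$ is the $\mathscr{S}'(\mathbb{R}^d)$-valued function $$(\mathcal{L}u)(s)=(e_\lambda u)(e_{s-\lambda}\zeta),\qquad\operatorname{Re}s>\lambda(u),\ \lambda\in(\lambda(u),\operatorname{Re}s),$$ which does not depend on the choice of $\lambda$, $\zeta$, $c$. *)

(* Defs.v *)
From HB Require Import structures.
From mathcomp Require Import all_boot all_order all_algebra.
From mathcomp Require Import all_classical all_reals all_analysis.
From mathcomp Require Import complex.

Set Implicit Arguments.
Unset Strict Implicit.
Unset Printing Implicit Defensive.

Import Order.TTheory GRing.Theory Num.Theory.
Import numFieldNormedType.Exports.
Import ComplexField.Normc.

Local Open Scope classical_set_scope.
Local Open Scope ring_scope.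
Local Open Scope complex_scope.

(** Distributions are represented by functionals on all complex-valued
    functions, of which only the values on test functions (Schwartz functions,
    or functions in D(R)) are meaningful: every hypothesis and every equality
    is restricted to those. *)

Section ComplexValued.
Context {R : realType}.
Implicit Types (z : R[i]).

Definition cexp z : R[i] :=
  (expR (complex.Re z))%:C * (cos (complex.Im z) +i* sin (complex.Im z)).

Definition cintegral (f : R -> R[i]) : R[i] :=
  (\int[@lebesgue_measure R]_(t in setT) complex.Re (f t)) +i*
  (\int[@lebesgue_measure R]_(t in setT) complex.Im (f t)).

End ComplexValued.

(** Calculus with respect to a family [b] of directions indexed by [I]: the
    coordinate directions of R, R^d or R^d x R^d below.  A multi-index alpha is
    given by a word [s] in the directions, the letter [i] occurring alpha_i
    times, so that |alpha| = size s; for smooth functions the order of the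
    letters is immaterial. *)
Section Smooth.
Context {R : realType} {V : normedModType R} {I : Type}.
Variable b : I -> V.
Implicit Types (f : V -> R[i]) (s : seq I).

Definition cpartial (i : I) f : V -> R[i] := fun x =>
  'D_(b i) (fun y => complex.Re (f y)) x +i*
  'D_(b i) (fun y => complex.Im (f y)) x.

Definition partials s f : V -> R[i] := foldr cpartial f s.

Definition ccontinuous f : Prop :=
  continuous (fun y => complex.Re (f y)) /\
  continuous (fun y => complex.Im (f y)).

Definition cderivable f (x v : V) : Prop :=
  derivable (fun y => complex.Re (f y)) x v /\
  derivable (fun y => complex.Im (f y)) x v.

Definition smooth f : Prop := forall s,
  ccontinuous (partials s f) /\
  forall x i, cderivable (partials s f) x (b i).

(** [bracket] plays the role of <x> = sqrt (1 + |x|^2). *)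
Variable bracket : V -> R.

(** sup of <x>^k |d^alpha f (x)| over x and |alpha| <= N *)
Definition seminorm (k N : nat) f : \bar R :=
  ereal_sup [set y | exists s x, (size s <= N)%N /\
                       y = (bracket x ^+ k * normc (partials s f x))%:E].

Definition schwartz : set (V -> R[i]) :=
  [set f | smooth f /\ forall N, (seminorm N N f < +oo)%E].

Definition schwartz_bounded (B : set (V -> R[i])) : Prop :=
  B `<=` schwartz /\
  forall N, exists M : R, forall f, B f -> (seminorm N N f <= M%:E)%E.

Definition support f : set V := closure [set x | f x != 0].

Definition test_function : set (V -> R[i]) :=
  [set f | smooth f /\ compact (support f)].

Definition linear_on (A : set (V -> R[i])) (T : (V -> R[i]) -> R[i]) : Prop :=
  forall (c : R[i]) f g, A f -> A g ->
    T (fun x => c * f x + g x) = c * T f + T g.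

Definition tempered (T : (V -> R[i]) -> R[i]) : Prop :=
  linear_on schwartz T /\
  exists (C : R) (N : nat), forall f, schwartz f ->
    ((normc (T f))%:E <= C%:E * seminorm N N f)%E.

End Smooth.

Section Euclidean.
Context {R : realType} {d : nat}.
Local Notation Rd := 'rV[R]_d.

Definition dirR (_ : unit) : R := 1.
Definition bracketR (t : R) : R := Num.sqrt (1 + t ^+ 2).

Definition dirRd (i : 'I_d) : Rd := delta_mx 0 i.
Definition bracketRd (x : Rd) : R := Num.sqrt (1 + \sum_(i < d) x 0 i ^+ 2).

Definition dirRdRd (k : 'I_d + 'I_d) : Rd * Rd :=
  match k with
  | inl i => (dirRd i, 0)
  | inr j => (0, dirRd j)
  end.

Definition dot (x y : Rd) : R := \sum_(i < d) x 0 i * y 0 i.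

End Euclidean.

Notation DR R := (test_function (@dirR R)).
Notation SR R := (schwartz (@dirR R) (@bracketR R)).
Notation SRd R d := (schwartz (@dirRd R d) (@bracketRd R d)).

(** Lebesgue integral over R^d, as an iterated integral; all integrands below
    are absolutely integrable. *)
Fixpoint integralRd {R : realType} (d : nat) : ('rV[R]_d -> R[i]) -> R[i] :=
  match d with
  | 0%N => fun f => f 0
  | d'.+1 => fun f => cintegral (fun t =>
      integralRd (fun x : 'rV[R]_d' => f (row_mx (const_mx t : 'rV_1) x)))
  end.

Section PseudoDifferential.
Context {R : realType} {d : nat}.
Local Notation Rd := 'rV[R]_d.
Implicit Types (a : Rd -> Rd -> R[i]) (m mu : R).

Definition partials_xxi (alpha beta : seq 'I_d) a (x xi : Rd) : R[i] :=
  partials (@dirRdRd R d) (map inl alpha ++ map inr beta)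
    (fun p => a p.1 p.2) (x, xi).

Definition symbol_smooth a : Prop :=
  smooth (@dirRdRd R d) (fun p : Rd * Rd => a p.1 p.2).

Definition SG_symbol m mu a : Prop :=
  symbol_smooth a /\
  forall alpha beta, exists C : R, 0 < C /\ forall x xi,
    normc (partials_xxi alpha beta a x xi) <=
    C * bracketRd x `^ (m - (size alpha)%:R)
      * bracketRd xi `^ (mu - (size beta)%:R).

Definition Hormander_symbol mu a : Prop :=
  symbol_smooth a /\
  forall alpha beta, exists C : R, 0 < C /\ forall x xi,
    normc (partials_xxi alpha beta a x xi) <=
    C * bracketRd xi `^ (mu - (size beta)%:R).

Definition fourier (w : Rd -> R[i]) (xi : Rd) : R[i] :=
  integralRd (fun x => cexp (- ('i * (dot x xi)%:C)) * w x).

Definition Op a (w : Rd -> R[i]) (x : Rd) : R[i] :=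
  ((2 * pi) ^- d)%:C *
  integralRd (fun xi => cexp ('i * (dot x xi)%:C) * a x xi * fourier w xi).

(** The transpose of [A] on the Schwartz space, for the bilinear pairing. *)
Definition transpose (A : (Rd -> R[i]) -> Rd -> R[i]) (v : Rd -> R[i]) :
    Rd -> R[i] :=
  xget (fun=> 0) [set g | SRd R d g /\
    forall w, SRd R d w ->
      integralRd (fun x => A w x * v x) = integralRd (fun x => w x * g x)].

Definition Op_dual a (T : (Rd -> R[i]) -> R[i]) : (Rd -> R[i]) -> R[i] :=
  fun v => T (transpose (Op a) v).

End PseudoDifferential.

Section Laplace.
Context {R : realType} {d : nat}.
Local Notation Rd := 'rV[R]_d.
Implicit Types (u U : (R -> R[i]) -> (Rd -> R[i]) -> R[i]).

(** D'(R, S'(R^d)), where S'(R^d) has the strong dual topology.  A linear map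
    on D(R) is continuous iff its restriction to each D_K(R), K compact, is. *)
Definition distribution u : Prop :=
  [/\ forall psi, DR R psi -> tempered (@dirRd R d) (@bracketRd R d) (u psi),
      forall w, SRd R d w -> linear_on (DR R) (fun psi => u psi w)
    & forall K B, compact K ->
        schwartz_bounded (@dirRd R d) (@bracketRd R d) B ->
        exists (C : R) (N : nat), forall psi w,
          DR R psi -> support psi `<=` K -> B w ->
          ((normc (u psi w))%:E <=
             C%:E * seminorm (@dirR R) (@bracketR R) 0 N psi)%E].

(** S'(R, S'(R^d)) *)
Definition tempered_distribution U : Prop :=
  [/\ forall psi, SR R psi -> tempered (@dirRd R d) (@bracketRd R d) (U psi),
      forall w, SRd R d w -> linear_on (SR R) (fun psi => U psi w)
    & forall B, schwartz_bounded (@dirRd R d) (@bracketRd R d) B ->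
        exists (C : R) (N : nat), forall psi w,
          SR R psi -> B w ->
          ((normc (U psi w))%:E <=
             C%:E * seminorm (@dirR R) (@bracketR R) N N psi)%E].

(** [U] in S'(R, S'(R^d)) restricts to [u] on D(R). *)
Definition tempered_extension u U : Prop :=
  tempered_distribution U /\
  forall psi w, DR R psi -> SRd R d w -> U psi w = u psi w.

Definition vanishes_on u (O : set R) : Prop :=
  forall psi w, DR R psi -> support psi `<=` O -> SRd R d w -> u psi w = 0.

Definition dsupport u : set R :=
  ~` [set t | exists O, [/\ open O, O t & vanishes_on u O]].

Definition efun (tau : R[i]) (t : R) : R[i] := cexp (- (tau * t%:C)).

Definition mul_efun (lambda : R) u : (R -> R[i]) -> (Rd -> R[i]) -> R[i] :=
  fun psi => u (fun t => efun lambda%:C t * psi t).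

Definition temperate_exponent u : set R :=
  [set lambda | exists U, tempered_extension (mul_efun lambda u) U].

Definition transformable u : Prop :=
  [/\ distribution u, dsupport u `<=` `[0, +oo[ &
      exists lambda, temperate_exponent u lambda].

Definition abscissa u : \bar R :=
  ereal_inf [set lambda%:E | lambda in temperate_exponent u].

Definition cutoff (c : R) (zeta : R -> R[i]) : Prop :=
  [/\ smooth (@dirR R) zeta, forall t, t <= - c -> zeta t = 0 &
      forall t, - (c / 2) <= t -> zeta t = 1].

Definition laplace u (s : R[i]) : (Rd -> R[i]) -> R[i] :=
  xget (fun=> 0) [set T | exists lambda c zeta U,
    [/\ (abscissa u < lambda%:E)%E /\ lambda < complex.Re s,
        0 < c /\ cutoff c zeta,
        tempered_extension (mul_efun lambda u) U &
        T = U (fun t => efun (s - lambda%:C) t * zeta t)]].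

(** id (x) Op(a) *)
Definition Op_dist (a : Rd -> Rd -> R[i]) u :
    (R -> R[i]) -> (Rd -> R[i]) -> R[i] :=
  fun psi => Op_dual a (u psi).

End Laplace.

(* Main.v *)
(** The transpose of [Op a] maps [v] to the Fourier transform of
    [xi |-> int e^{i x.xi} a(x, xi) v(x) dx], up to the factor (2 pi)^-d: this is
    Fubini's theorem and needs no Fourier inversion.  Differentiating under the
    integral and integrating by parts in [x] bound each Schwartz seminorm of such
    an oscillatory integral by a Schwartz seminorm of [v]; the derivatives in [xi]
    are always taken first, so that only the derivatives of [a] appearing in
    [partials_xxi] are involved.  Hence [Op a], acting by duality, preserves
    tempered distributions, uniformly on bounded sets of Schwartz functions, and
    it commutes with multiplication by exponentials, so that any tempered
    extension [U] of e_lambda u yields the tempered extension [Op_dist a U] of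
    e_lambda (Op(a) u).  The theorem then follows from the independence of
    the Laplace transform from the exponent, the cutoff and the extension:
    e_(s - lambda) zeta is the Schwartz limit of its truncations, on which the
    extension is given by [u], and [u] does not see the test functions supported
    in negative times. *)

Require Import Defs.
From mathcomp Require Import all_boot all_order all_algebra.
From mathcomp Require Import all_classical all_reals all_analysis.
From mathcomp Require Import measurable_realfun complex.
From mathcomp Require Import ring lra.

Set Implicit Arguments.
Unset Strict Implicit.
Unset Printing Implicit Defensive.

Import Order.TTheory GRing.Theory Num.Theory.
Import numFieldNormedType.Exports.
Import ComplexField.Normc.

Local Open Scope classical_set_scope.
Local Open Scope ring_scope.
Local Open Scope complex_scope.

(** * Integration of dominated functions *)

Section Integrator.
Context {R : realType}.

(** Both [transpose] and [laplace] are picked by [xget], so an explicit candidate does not determine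
    them: each needs a uniqueness statement, [pairing_inj] (the pairing separates Schwartz
    functions, tested on a complex conjugate) and [laplace_unique]. As [integralRd] is an iterated
    integral over lines, no measure on R^d appears. The analysis is confined to continuous functions
    dominated by the weight prod_i 1/(1 + x_i^2), and what is required of the integral is packaged
    in [integrator], a notion stable under products, hence passing from R to R^d by induction.
    Fubini's theorem and integration by parts follow the same induction. Several bounds are
    expressed by natural numbers, some serving at once as a constant and as a seminorm order: being
    monotone in that number, they can be maximised over the finitely many words of derivatives of
    bounded length. No bump function is constructed: reflecting, dilating and translating a given
    cutoff yields both the truncations in time and the smooth steps. *)

Lemma sequential_continuity (P : normedModType R) (f : P -> R) (p : P) :
  (forall u : nat -> P, u @ \oo --> p -> (f \o u) @ \oo --> f p) ->
  {for p, continuous f}.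
Proof.
move=> hf; apply: contrapT => /cvgrPdist_lt/existsNP[e /not_implyP[e0 he]].
have Hn (n : nat) : exists q : P, `|p - q| < n.+1%:R^-1 /\ e <= `|f p - f q|.
  apply: contrapT => /forallNP hn; apply: he.
  have n0 : 0 < n.+1%:R^-1 :> R by rewrite invr_gt0.
  near=> q.
  have pq : `|p - q| < n.+1%:R^-1.
    by near: q; exact: (@cvgr_dist_lt _ _ _ (nbhs p) _ id p (@cvg_id _ _) _ n0).
  by rewrite ltNge; apply/negP => eq; exact: (hn q).
have [u hu] := choice Hn.
have up : u @ \oo --> p.
  apply/cvgrPdist_lt => d d0; near=> n.
  apply: (lt_trans (hu n).1).
  near: n; exact: near_infty_natSinv_lt (PosNum d0).
have /cvgrPdist_lt/(_ e e0)[N _ /(_ N (leqnn N))] := hf u up.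
by rewrite ltNge (hu N).2.
Unshelve. all: by end_near. Qed.

Definition locally_dominated (P X : normedModType R) (W : X -> R)
    (F : P * X -> R) : Prop :=
  forall p : P, exists C, \forall q \near p, forall x, `|F (q, x)| <= C * W x.

(** A function [I] of functions on [X] integrating those that are [O(W)]; the
    last clause is dominated convergence with a normed space of parameters. *)
Record integrator (X : normedModType R) (W : X -> R) (I : (X -> R) -> R) :
  Prop := Integrator {
  weight_gt0 : forall x, 0 < W x;
  weight_le1 : forall x, W x <= 1;
  weight_continuous : continuous W;
  integrator_linear : forall (c : R) (f g : X -> R) C D, continuous f -> continuous g ->
    (forall x, `|f x| <= C * W x) -> (forall x, `|g x| <= D * W x) ->
    I (fun x => c * f x + g x) = c * I f + I g;
  integrator_bound : exists2 K, 0 <= K & forall (f : X -> R) C, continuous f ->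
    (forall x, `|f x| <= C * W x) -> `|I f| <= K * C;
  integrator_continuous : forall (P : normedModType R) (F : P * X -> R),
    continuous F ->
    locally_dominated W F ->
    continuous (fun p => I (fun x => F (p, x))) }.

End Integrator.

(** * The Lebesgue integral on the line as an integrator *)

Section LineIntegral.
Context {R : realType}.
Local Notation mu := (@lebesgue_measure R).

(** An integrable weight with values in ]0, 1], whose products over the coordinates are controlled
    from below by powers of the bracket. *)
Definition lineW (t : R) : R := (1 + t ^+ 2)^-1.
Definition lineI (f : R -> R) : R := \int[mu]_(t in setT) f t.

Lemma lineW_gt0 t : 0 < lineW t.
Proof. by rewrite invr_gt0 ltr_pwDl ?sqr_ge0. Qed.

Lemma lineW_le1 t : lineW t <= 1.
Proof. by rewrite invf_le1 ?lerDl ?sqr_ge0 ?ltr_pwDl ?sqr_ge0. Qed.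

Lemma lineW_continuous : continuous lineW.
Proof. exact: continuous_oneDsqrV. Qed.

Lemma lineW_integrable : mu.-integrable setT (EFin \o lineW).
Proof.
apply/integrableP; split.
  apply/measurable_EFinP; apply: continuous_measurable_fun.
  exact: lineW_continuous.
under eq_integral do rewrite /= ger0_norm ?ltW ?lineW_gt0//.
(* The weight is even, so its integral is twice the known one over the half-line. *)
rewrite ge0_symfun_integralT; last 3 first.
- by move=> x; exact/ltW/lineW_gt0.
- exact: lineW_continuous.
- by move=> x /=; rewrite /lineW sqrrN.
by rewrite -set_itvcy integral0y_oneDsqr -EFinM ltry.
Qed.

Lemma dominated_integrable (f : R -> R) C : continuous f ->
  (forall t, `|f t| <= C * lineW t) -> mu.-integrable setT (EFin \o f).
Proof.
move=> cf fC; have := integrableZl measurableT C lineW_integrable.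
apply: le_integrable => //.
  by apply/measurable_EFinP; apply: continuous_measurable_fun.
move=> t _ /=; rewrite lee_fin (le_trans (fC t))//.
by rewrite ler_norm.
Qed.

Lemma lineI_linear c (f g : R -> R) C D : continuous f -> continuous g ->
  (forall x, `|f x| <= C * lineW x) -> (forall x, `|g x| <= D * lineW x) ->
  lineI (fun x => c * f x + g x) = c * lineI f + lineI g.
Proof.
move=> cf cg fC gD; rewrite /lineI.
have intf := dominated_integrable cf fC.
rewrite -RintegralZl// -RintegralD//; last exact: dominated_integrable cg gD.
have := integrableZl measurableT c intf.
by apply: eq_integrable => // x _ /=; rewrite EFinM.
Qed.

Lemma lineI_bound (f : R -> R) C : continuous f ->
  (forall x, `|f x| <= C * lineW x) -> `|lineI f| <= lineI lineW * C.
Proof.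
move=> cf fC; rewrite /lineI.
have intf := dominated_integrable cf fC.
apply: (le_trans (le_normr_Rintegral _ intf)) => //.
rewrite mulrC -RintegralZl//; last exact: lineW_integrable.
apply: le_Rintegral => //.
  exact: integrable_norm intf.
have := integrableZl measurableT C lineW_integrable.
by apply: eq_integrable => // x _ /=; rewrite EFinM.
Qed.

Lemma lineI_continuous (P : normedModType R) (F : P * R -> R) : continuous F ->
  locally_dominated lineW F ->
  continuous (fun p => lineI (fun x => F (p, x))).
Proof.
(* Dominated convergence concerns sequences. Dropping the first N terms of the sequence keeps it in
   the neighbourhood of p where a single bound dominates. *)
move=> cF hF p; apply: sequential_continuity => u up.
have [C HC] := hF p.
have [N _ uN] := up _ HC.
rewrite -(cvg_shiftn N) /=.
have cFq q : continuous (fun x => F (q, x)).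
  move=> x; apply: continuous_comp; last exact: cF.
  by apply: (cvg_pair (cvg_cst _) cvg_id).
have FuC n x : `|F (u (n + N)%N, x)| <= C * lineW x.
  by apply: uN; exact: leq_addl.
have Fcv x : F (u (n + N)%N, x) @[n --> \oo] --> F (p, x).
  rewrite (cvg_shiftn N (fun n => F (u n, x))).
  have cFx : continuous (fun q => F (q, x)).
    move=> q; apply: continuous_comp; last exact: cF.
    by apply: (cvg_pair cvg_id (cvg_cst _)).
  exact: (cvg_comp _ _ up (cFx p)).
have mFq q : measurable_fun setT (EFin \o (fun x => F (q, x))).
  by apply/measurable_EFinP; apply: continuous_measurable_fun.
have FpC x : `|F (p, x)| <= C * lineW x.
  have := nbhs_singleton HC; exact.
have := @dominated_convergence _ _ _ mu setT measurableT
  (fun n => EFin \o (fun x => F (u (n + N)%N, x))) (EFin \o (fun x => F (p, x)))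
  (fun x => (C * lineW x)%:E).
move=> /(_ (fun n => mFq _) (mFq p)).
case.
- apply: aeW => x _; apply: cvg_EFin => //; first by apply: nearW.
  exact: Fcv.
- have := integrableZl measurableT C lineW_integrable.
  by apply: eq_integrable => // x _ /=; rewrite EFinM.
- by apply: aeW => x n _ /=; rewrite lee_fin.
move=> intF _ cvF.
rewrite /lineI /Rintegral.
apply: fine_cvg.
rewrite fineK; last exact: integrable_fin_num.
exact: cvF.
Qed.

Lemma line_integrator : integrator lineW lineI.
Proof.
split; [exact: lineW_gt0|exact: lineW_le1|exact: lineW_continuous|
  exact: lineI_linear| |exact: lineI_continuous].
exists (lineI lineW); last exact: lineI_bound.
by apply: Rintegral_ge0 => x _; exact/ltW/lineW_gt0.
Qed.

End LineIntegral.

(** * Fubini's theorem on the plane for dominated continuous functions *)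

Section LineFubini.
Context {R : realType}.
Local Notation mu := (@lebesgue_measure R).

(** An open set is the countable union of the rational open boxes that it contains, and boxes are
    measurable for the product sigma-algebra, the one in which Fubini's theorem is stated. *)
Lemma open_plane_measurable (U : set (R * R)) : open U -> measurable U.
Proof.
move=> oU.
pose box (q : (rat * rat) * (rat * rat)) : set (R * R) :=
  `]ratr q.1.1, ratr q.1.2[ `*` `]ratr q.2.1, ratr q.2.2[.
(* Integers that code no box, or a box not contained in U, contribute the empty set. *)
pose A n := if unpickle n is Some q then
  (if `[< box q `<=` U >] then box q else set0) else set0.
have -> : U = \bigcup_n A n.
  apply/seteqP; split=> [[s t] Ust|p [n _]]; last first.
    rewrite /A; case: (unpickle n) => // q; case: asboolP => // qU; exact: qU.
  have /nbhs_ballP[e /= e0 eU] : nbhs (s, t) U by exact: open_nbhs_nbhs.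
  have ex_rat (r : R) : exists a b : rat,
      [/\ r - e < ratr a, ratr a < r, r < ratr b & ratr b < r + e].
    have /rat_in_itvoo[a] : r - e < r by rewrite ltrBlDr ltrDl.
    have /rat_in_itvoo[b] : r < r + e by rewrite ltrDl.
    by rewrite !in_itv/= => /andP[? ?] /andP[? ?]; exists a, b.
  have [a [b [a1 a2 b1 b2]]] := ex_rat s.
  have [a' [b' [a1' a2' b1' b2']]] := ex_rat t.
  exists (pickle ((a, b), (a', b'))); first exact: I.
  rewrite /A pickleK; case: asboolP => [_|]; last first.
    case=> -[s' t'] [/=]; rewrite !in_itv/= => /andP[? ?] /andP[? ?].
    by apply: eU; split; rewrite /ball/= ltr_distlC; apply/andP; split; lra.
  by split; rewrite /= in_itv/= ?a2 ?a2' ?b1 ?b1'.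
apply: bigcupT_measurable => n; rewrite /A; case: (unpickle n) => [q|]//.
case: asboolP => // _; apply: measurableX => //.
Qed.

Lemma continuous_plane_measurable (F : R * R -> R) :
  continuous F -> measurable_fun setT F.
Proof.
move=> /continuousP cF; apply: (measurability _ (RGenOpens.measurableE R)).
move=> _ [_ [a [b ->] <-]]; rewrite setTI.
by apply: open_plane_measurable; exact/cF/interval_open.
Qed.

(** Integrability for the product measure comes from Tonelli's criterion: the double integral of |F|
    is at most that of C W(s) W(t), which factors into finite line integrals. *)
Lemma line_Fubini (F : R * R -> R) C : continuous F ->
  (forall s t, `|F (s, t)| <= C * (lineW s * lineW t)) ->
  lineI (fun s => lineI (fun t => F (s, t))) =
  lineI (fun t => lineI (fun s => F (s, t))).
Proof.
move=> cF FC.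
have mF : measurable_fun setT (EFin \o F).
  by apply/measurable_EFinP; exact: continuous_plane_measurable.
have cF1 s : continuous (fun t => F (s, t)).
  move=> x; apply: continuous_comp; last exact: cF.
  by apply: (cvg_pair (cvg_cst _) cvg_id).
have cF2 t : continuous (fun s => F (s, t)).
  move=> x; apply: continuous_comp; last exact: cF.
  by apply: (cvg_pair cvg_id (cvg_cst _)).
have F1 s : mu.-integrable setT (EFin \o (fun t => F (s, t))).
  by apply: (@dominated_integrable _ _ (C * lineW s)) => // t; rewrite -mulrA.
have F2 t : mu.-integrable setT (EFin \o (fun s => F (s, t))).
  apply: (@dominated_integrable _ _ (C * lineW t)) => // s.
  by rewrite -mulrA (mulrC (lineW t)).
have mA : measurable_fun setT (abse \o (EFin \o F)) by exact: measurableT_comp.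
have C0 : 0 <= C.
  have := le_trans (normr_ge0 _) (FC 0 0).
  by rewrite pmulr_lge0// mulr_gt0// lineW_gt0.
have iw := @lineW_integrable R.
have inner s : (\int[mu]_t (C * (lineW s * lineW t))%:E =
    (C * lineI (@lineW R))%:E * (EFin \o lineW) s)%E.
  under eq_integral do rewrite mulrA EFinM.
  rewrite integralZl// -(fineK (integrable_fin_num _ iw))// -!EFinM.
  by congr EFin; rewrite mulrAC.
have intF : (mu \x mu)%E.-integrable setT (EFin \o F).
  apply/integrable12ltyP => //.
  apply: (@le_lt_trans _ _
    (\int[mu]_s \int[mu]_t (C * (lineW s * lineW t))%:E)%E).
    apply: ge0_le_integral => //.
    - by move=> s _; apply: integral_ge0.
    - have := measurable_fun_fubini_tonelli_F (m2 := mu) (abse \o (EFin \o F)).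
      by apply; [exact: mA|move=> x; exact: abse_ge0].
    - under eq_fun do rewrite inner.
      by apply: emeasurable_funM => //; exact: measurable_int iw.
    - move=> s _; apply: ge0_le_integral => //.
      + by apply: measurableT_comp => //; apply/measurable_EFinP;
          apply: continuous_measurable_fun.
      + apply/measurable_EFinP; apply: continuous_measurable_fun.
        move=> t; apply: cvgM; first exact: cvg_cst.
        by apply: cvgM; [exact: cvg_cst|exact: lineW_continuous].
      + by move=> t _ /=; rewrite lee_fin FC.
  under eq_integral do rewrite inner.
  by rewrite integralZl// -(fineK (integrable_fin_num _ iw))// -EFinM ltry.
(* A real integral is the [fine] of an extended one; integrability of the slices reconciles the
   inner [fine] with Fubini's theorem for extended integrals. *)
rewrite /lineI /Rintegral; congr fine.
have := Fubini intF => /=.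
under eq_integral => s _.
  rewrite -(fineK (integrable_fin_num _ (F1 s)))//.
  over.
move=> ->; apply: eq_integral => t _.
by rewrite fineK//; exact: (integrable_fin_num _ (F2 t)).
Qed.

End LineFubini.

(** * Integrals of derivatives and of nonnegative functions on the line *)

Section LineByParts.
Context {R : realType}.
Local Notation mu := (@lebesgue_measure R).

Lemma lineW_cvg0 (s : R ^nat) : (forall n, n.+1%:R <= `|s n|) ->
  lineW (s n) @[n --> \oo] --> 0.
Proof.
move=> sn; apply/cvgrPdist_lt => e e0; near=> n.
rewrite sub0r normrN ger0_norm ?ltW ?lineW_gt0//.
have n1 : n.+1%:R^-1 < e by near: n; exact: near_infty_natSinv_lt (PosNum e0).
apply: le_lt_trans n1; rewrite lef_pV2 ?posrE//; last first.
  by rewrite ltr_pwDl ?sqr_ge0.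
have /le_trans -> // := sn n.
rewrite -(real_normK (num_real (s n))).
have : 0 <= `|s n| by [].
by move: `|s n| => y y0; nra.
Unshelve. all: by end_near. Qed.

(** Over [-(n+1), n+1] the integral is a difference of boundary values of h, which tend to 0 with
    the weight; dominated convergence identifies the limit with the whole integral. *)
Lemma lineI_derive (h k : R -> R) C D : continuous k ->
  (forall t : R, is_derive t 1 h (k t)) ->
  (forall t, `|h t| <= C * lineW t) -> (forall t, `|k t| <= D * lineW t) ->
  lineI k = 0.
Proof.
move=> ck hk hC kD.
have ch : continuous h.
  by move=> t; apply: differentiable_continuous; apply/derivable1_diffP;
    case: (hk t).
have intk := dominated_integrable ck kD.
pose A n : set R := `[- n.+1%:R, n.+1%:R]%classic.
have e n : (\int[mu]_t ((k \_ (A n)) t)%:E = (h n.+1%:R - h (- n.+1%:R))%:E)%E.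
  rewrite EFinB -(@continuous_FTC2 _ k h)//.
  - by rewrite [RHS]integral_mkcond restrict_EFin.
  - by rewrite gtrN.
  - exact: continuous_subspaceT.
  - split.
    + by move=> x _; case: (hk x).
    + by apply: cvg_at_right_filter; exact: ch.
    + by apply: cvg_at_left_filter; exact: ch.
  - by move=> x _; rewrite derive1E; have [] := hk x.
have D0 : 0 <= D.
  by rewrite -(pmulr_lge0 _ (lineW_gt0 0)) (le_trans _ (kD 0)).
have mk n : measurable_fun setT (EFin \o (k \_ (A n))).
  have mk : measurable_fun (A n) k.
    by apply: measurable_funTS; exact: continuous_measurable_fun.
  apply/measurable_EFinP; apply/(measurable_restrictT _ _).1 => //.
  exact: measurable_itv.
have cv1 t : ((k \_ (A n)) t) @[n --> \oo] --> k t.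
  apply/cvgrPdist_lt => eps e0; near=> n.
  rewrite patchE mem_set ?subrr ?normr0//= /A/= in_itv/= -ler_norml.
  have tn : `|t| <= n%:R by near: n; exact: nbhs_infty_ger.
  by rewrite (le_trans tn)// ler_nat.
have [|||_ _] := @dominated_convergence _ _ _ mu setT measurableT
  (fun n => EFin \o (k \_ (A n))) (EFin \o k)
  (fun x => (D * lineW x)%:E) mk (measurable_int _ intk).
- apply: aeW => t _; apply: cvg_EFin; [exact: nearW|exact: cv1].
- have := integrableZl measurableT D (@lineW_integrable R).
  by apply: eq_integrable => // x _ /=; rewrite EFinM.
- apply: aeW => t n _ /=; rewrite lee_fin patchE.
  by case: ifP => // _; rewrite normr0 mulr_ge0// ltW// lineW_gt0.
rewrite (_ : [sequence _]_n = fun n => (h n.+1%:R - h (- n.+1%:R))%:E); last first.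
  by apply/funext => n; exact: e.
move=> cv.
have hcv (s : R ^nat) : (forall n, n.+1%:R <= `|s n|) ->
    h (s n) @[n --> \oo] --> 0.
  move=> sn; apply/norm_cvg0P; apply: (@squeeze_cvgr _ _ _ _ (fun=> 0)
    (fun n => C * lineW (s n))); [|exact: cvg_cst|].
    by near=> n; rewrite normr_ge0 hC.
  by rewrite -(mulr0 C); apply: cvgM; [exact: cvg_cst|exact: lineW_cvg0].
have cv0 : h n.+1%:R - h (- n.+1%:R) @[n --> \oo] --> (0 : R).
  rewrite -(subr0 0); apply: cvgB.
    by apply: (hcv (fun n => n.+1%:R)) => n; rewrite ger0_norm.
  by apply: (hcv (fun n => - n.+1%:R)) => n; rewrite normrN ger0_norm.
have cv0E : (h n.+1%:R - h (- n.+1%:R))%:E @[n --> \oo] --> 0%:E.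
  by apply: cvg_EFin; [exact: nearW|exact: cv0].
by rewrite /lineI /Rintegral (cvg_unique _ cv cv0E).
Unshelve. all: by end_near. Qed.

(** If k t > 0, continuity keeps k above k t / 2 on a segment of length e centred at t, so the
    integral is at least e k t / 2 > 0. *)
Lemma lineI_eq0 (k : R -> R) C : continuous k -> (forall t, 0 <= k t) ->
  (forall t, `|k t| <= C * lineW t) -> lineI k = 0 -> forall t, k t = 0.
Proof.
move=> ck k0 kC Ik0 t; apply/eqP/negPn/negP => kt.
have kt0 : 0 < k t by rewrite lt_neqAle eq_sym kt k0.
have kt2 : 0 < k t / 2 by rewrite divr_gt0.
have /cvgrPdist_lt/(_ _ kt2) := ck t.
move=> /nbhs_ballP[e /= e0 ek].
have intk := dominated_integrable ck kC.
pose A : set R := `[t - e / 2, t + e / 2]%classic.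
have mA : measurable A by exact: measurable_itv.
have : (\int[mu]_(x in A) (k t / 2)%:E <= \int[mu]_x (k x)%:E)%E.
  apply: (@le_trans _ _ (\int[mu]_(x in A) (k x)%:E)%E).
    apply: ge0_le_integral => //.
    - by move=> x _; rewrite lee_fin ltW.
    - by apply/measurable_EFinP; apply: measurable_funTS; exact: continuous_measurable_fun.
    - move=> x; rewrite /A/= in_itv/= => /andP[x1 x2].
      have : ball t e x.
        by rewrite /ball/= ltr_distlC; apply/andP; split; lra.
      move=> /ek/=; rewrite lee_fin ltr_distl => /andP[]; lra.
  apply: ge0_subset_integral => //.
  - exact: measurable_int intk.
  - by move=> x _; rewrite lee_fin.
have muA : mu A = e%:E.
  rewrite /A lebesgue_measure_itv/= lte_fin ifT; last by lra.
  by rewrite -EFinB; congr EFin; lra.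
rewrite integral_cst// [X in (_ * X)%E]muA -EFinM.
rewrite -(fineK (integrable_fin_num _ intk))// lee_fin.
rewrite -[fine _]/(lineI k) Ik0; apply/negP; rewrite -ltNge.
exact: mulr_gt0.
Qed.

End LineByParts.

(** * Differentiation under the integral sign *)

Section IntegratorTheory.
Context {R : realType}.

Lemma is_derive_lim (V : normedModType R) (f : V -> R) (a v : V) (l : R) :
  h^-1 *: (f (h *: v + a) - f a) @[h --> 0^'] --> l -> is_derive a v f l.
Proof.
move=> fl; apply: DeriveDef; first by apply/cvg_ex; exists l.
exact: cvg_lim fl.
Qed.

Lemma is_derive_lim_inv (V : normedModType R) (f : V -> R) (a v : V) (l : R) :
  is_derive a v f l -> h^-1 *: (f (h *: v + a) - f a) @[h --> 0^'] --> l.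
Proof. by move=> [df <-]. Qed.

Lemma MVT_quotient (f df : R -> R) (t h : R) :
  (forall s : R, is_derive s 1 f (df s)) -> h != 0 ->
  exists2 th, `|th| <= `|h| & h^-1 * (f (h + t) - f t) = df (t + th).
Proof.
move=> fdf h0.
have cf : continuous f.
  by move=> s; apply: differentiable_continuous; apply/derivable1_diffP;
    case: (fdf s).
have [hpos|] := ltP 0 h.
  have tht : t < h + t by lra.
  have [c] := MVT tht (fun x _ => fdf x) (continuous_subspaceT cf).
  rewrite in_itv/= => /andP[c1 c2] e; exists (c - t).
    by rewrite !ger0_norm; lra.
  by rewrite e addrK mulrC mulfK// addrC subrK.
rewrite le_eqVlt (negPf h0)/= => hneg.
have htt : h + t < t by lra.
have [c] := MVT htt (fun x _ => fdf x) (continuous_subspaceT cf).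
rewrite in_itv/= => /andP[c1 c2] e; exists (c - t).
  by rewrite !ler0_norm; lra.
rewrite -opprB e (_ : t - (h + t) = - h); last by ring.
rewrite (mulrN (df c)) opprK mulrC mulfK//.
by rewrite addrC subrK.
Qed.

Section OneIntegrator.
Variables (X : normedModType R) (W : X -> R) (I : (X -> R) -> R).
Hypothesis hI : integrator W I.

Lemma integrator0 : I (fun=> 0) = 0.
Proof.
have H x : `|(fun=> 0 : R) x| <= 0 * W x :> R by rewrite normr0 mul0r.
have := integrator_linear hI 1 (@cst_continuous _ _ (0 : R))
  (@cst_continuous _ _ (0 : R)) H H.
rewrite (_ : (fun x => 1 * _ + _) = fun=> 0); last first.
  by apply/funext => x; rewrite mulr0 addr0.
by rewrite mul1r => /eqP; rewrite -subr_eq subrr => /eqP.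
Qed.

Lemma integratorZ c (f : X -> R) C : continuous f ->
  (forall x, `|f x| <= C * W x) -> I (fun x => c * f x) = c * I f.
Proof.
move=> cf fC; have H x : `|(fun=> 0 : R) x| <= 0 * W x :> R.
  by rewrite normr0 mul0r.
have := integrator_linear hI c cf (@cst_continuous _ _ (0 : R)) fC H.
rewrite integrator0 addr0 => <-; congr I; apply/funext => x.
by rewrite addr0.
Qed.

Lemma integratorD (f g : X -> R) C D : continuous f -> continuous g ->
  (forall x, `|f x| <= C * W x) -> (forall x, `|g x| <= D * W x) ->
  I (fun x => f x + g x) = I f + I g.
Proof.
move=> cf cg fC gD; have := integrator_linear hI 1 cf cg fC gD.
rewrite mul1r => <-; congr I; apply/funext => x.
by rewrite mul1r.
Qed.

Lemma integratorB (f g : X -> R) C D : continuous f -> continuous g ->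
  (forall x, `|f x| <= C * W x) -> (forall x, `|g x| <= D * W x) ->
  I (fun x => f x - g x) = I f - I g.
Proof.
move=> cf cg fC gD; have := integrator_linear hI (-1) cg cf gD fC.
rewrite mulN1r addrC => <-; congr I; apply/funext => x.
by rewrite mulN1r addrC.
Qed.

Lemma dominated_ge0 (f : X -> R) C (x0 : X) :
  (forall x, `|f x| <= C * W x) -> 0 <= C.
Proof.
by move=> /(_ x0) fC; rewrite -(pmulr_lge0 _ (weight_gt0 hI x0)) (le_trans _ fC).
Qed.

(** The difference quotient Q, completed by dF(t0, x) at increment 0, is jointly continuous and
    locally dominated; the derivative is then the continuity of the integral of Q at increment 0. *)
Lemma integrator_derive (F dF : R * X -> R) (t0 : R) :
  continuous F -> continuous dF ->
  locally_dominated W F -> locally_dominated W dF ->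
  (forall (t : R) x, is_derive t 1 (fun s => F (s, x)) (dF (t, x))) ->
  is_derive t0 1 (fun t => I (fun x => F (t, x))) (I (fun x => dF (t0, x))).
Proof.
move=> cF cdF lF ldF FdF.
pose Q (p : R * X) := if p.1 == 0 then dF (t0, p.2)
  else p.1^-1 * (F (p.1 + t0, p.2) - F (t0, p.2)).
have Qth h x : exists2 th, `|th| <= `|h| & Q (h, x) = dF (t0 + th, x).
  rewrite /Q/=; case: eqVneq => [->|h0]; first by exists 0; rewrite ?addr0.
  by have [th th1 e] := MVT_quotient t0 (fun s => FdF s x) h0; exists th.
have cFx t : continuous (fun x => F (t, x)).
  move=> x; apply: continuous_comp; last exact: cF.
  by apply: (cvg_pair (cvg_cst _) cvg_id).
have cQ : continuous Q.
  move=> [h x]; have [->|h0] := eqVneq h 0.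
    rewrite /continuous_at {2}/Q/= eqxx.
    apply/cvgrPdist_lt => e e0.
    have /cvgrPdist_lt/(_ e e0)/nbhs_ballP[r /= r0 rd] := cdF (t0, x).
    suff : nbhs (0 : R, x) [set p | `|dF (t0, x) - Q p| < e] by [].
    apply/nbhs_ballP; exists r => // -[k y] [/= k1 k2].
    have [th th1 ->] := Qth k y.
    apply: rd; split=> //=; move: k1.
    rewrite /ball/= opprD addNKr normrN sub0r normrN.
    exact: le_lt_trans.
  rewrite /continuous_at {2}/Q/= (negPf h0).
  have : (fun p : R * X => p.1^-1 * (F (p.1 + t0, p.2) - F (t0, p.2))) @ (h, x) -->
      h^-1 * (F (h + t0, x) - F (t0, x)).
    apply: cvgM.
      by apply: cvgV => //; exact: cvg_fst.
    apply: cvgB.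
      have c1 : (p.1 + t0, p.2) @[p --> (h, x)] --> (h + t0, x).
        apply: (@cvg_pair _ _ _ _ (nbhs (h + t0)) (nbhs x)); last exact: cvg_snd.
        by apply: cvgD; [exact: cvg_fst|exact: cvg_cst].
      exact: (cvg_comp _ _ c1 (cF _)).
    have c1 : (t0, p.2) @[p --> (h, x)] --> (t0, x).
      apply: (@cvg_pair _ _ _ _ (nbhs t0) (nbhs x)); last exact: cvg_snd.
      exact: cvg_cst.
    exact: (cvg_comp _ _ c1 (cF _)).
  apply: cvg_trans; apply: near_eq_cvg.
  have : \forall p \near (h, x), p.1 != 0.
    have : p.1 @[p --> (h, x)] --> h by exact: cvg_fst.
    move=> /cvgr_neq0; exact.
  by apply: filterS => p p0; rewrite /Q (negPf p0).
(* Near increment 0 the mean value theorem lets dF dominate; near h different from 0 the two values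
   of F do, the increment staying above |h| / 2 in absolute value. *)
have lQ : locally_dominated W Q.
  move=> h; have [->|h0] := eqVneq h 0.
    have [C /nbhs_ballP[r /= r0 rC]] := ldF t0.
    exists C; apply/nbhs_ballP; exists r => // k; rewrite /ball/= sub0r normrN => kr x.
    have [th th1 ->] := Qth k x.
    apply: rC; rewrite /ball/= opprD addNKr normrN.
    exact: le_lt_trans kr.
  have [C HC] := lF (h + t0); have [D /nbhs_singleton HD] := lF t0.
  exists ((`|h| / 2)^-1 * (C + D)).
  have H1 : \forall q \near h, `|h| / 2 < `|q|.
    have : `|q| @[q --> h] --> `|h| by apply: cvg_norm; exact: cvg_id.
    by move=> /cvgr_gt; apply; rewrite ltr_pdivrMr// ltr_pMr ?normr_gt0// ltr1n.
  have H2 : \forall q \near h, forall x, `|F (q + t0, x)| <= C * W x.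
    have : q + t0 @[q --> h] --> h + t0 by apply: cvgD; [exact: cvg_id|exact: cvg_cst].
    by move=> /(_ _ HC).
  near=> q => x.
  have q1 : `|h| / 2 < `|q| by near: q.
  have q2 : forall x, `|F (q + t0, x)| <= C * W x by near: q.
  have h2 : 0 < `|h| / 2 by rewrite divr_gt0// normr_gt0.
  have q0 : q != 0 by rewrite -normr_gt0 (lt_trans _ q1).
  rewrite /Q/= (negPf q0) normrM normfV -mulrA; apply: ler_pM => //.
    by rewrite lef_pV2 ?posrE ?normr_gt0// ltW.
  by rewrite (le_trans (ler_normB _ _))// mulrDl lerD.
apply: is_derive_lim.
have := integrator_continuous hI cQ lQ (x := 0).
rewrite /continuous_at.
rewrite [X in _ --> X -> _](_ : _ = I (fun x => dF (t0, x))); last first.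
  by congr I; apply/funext => x; rewrite /Q/= eqxx.
move=> /cvg_within_filter.
move=> /(_ (fun x => x != 0)).
apply: cvg_trans; apply: near_eq_cvg; near=> h.
have h0 : h != 0 by near: h; exact: nbhs_dnbhs_neq.
have [C /nbhs_singleton HC] := lF (h + t0).
have [D /nbhs_singleton HD] := lF t0.
rewrite scaler1 -(integratorB (cFx _) (cFx _) HC HD).
transitivity (I (fun x => h^-1 * (F (h + t0, x) - F (t0, x)))).
  by congr I; apply/funext => x; rewrite /Q/= (negPf h0).
rewrite (@integratorZ _ _ (C + D))//.
  by move=> x; apply: cvgB; exact: cFx.
by move=> x; rewrite (le_trans (ler_normB _ _))// mulrDl lerD.
Unshelve. all: by end_near. Qed.

End OneIntegrator.
End IntegratorTheory.

Lemma continuous_pair (X Y Z : topologicalType) (f : X -> Y) (g : X -> Z) :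
  continuous f -> continuous g -> continuous (fun x => (f x, g x)).
Proof.
move=> cf cg x.
exact: (@cvg_pair _ _ _ (nbhs x) (nbhs (f x)) (nbhs (g x)) _ _ _ f g
  (cf x) (cg x)).
Qed.

Lemma continuous_fun_comp (X Y Z : topologicalType) (g : Y -> Z) (f : X -> Y) :
  continuous g -> continuous f -> continuous (fun x => g (f x)).
Proof. by move=> cg cf x; apply: continuous_comp; [exact: cf|exact: cg]. Qed.

(** * Products of integrators *)

Section ProductIntegrator.
Context {R : realType}.
Variables (X Y Z : normedModType R).
Variables (V : X -> R) (J : (X -> R) -> R) (W : Y -> R) (I : (Y -> R) -> R).
Variables (j : X * Y -> Z) (U : Z -> R).
Hypothesis hJ : integrator V J.
Hypothesis hI : integrator W I.
Hypothesis cj : continuous j.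
Hypothesis cU : continuous U.
Hypothesis sj : forall z, exists p, j p = z.
Hypothesis Uj : forall x y, U (j (x, y)) = V x * W y.

Let slice_continuous (f : Z -> R) x : continuous f -> continuous (fun y => f (j (x, y))).
Proof.
move=> cf y; apply: (@continuous_comp _ _ _ (fun y => j (x, y)) f); last exact: cf.
apply: (@continuous_comp _ _ _ (fun y => (x, y)) j); last exact: cj.
by apply: (cvg_pair (cvg_cst _) cvg_id).
Qed.

Let slice_dominated (f : Z -> R) C x : (forall z, `|f z| <= C * U z) ->
  forall y, `|f (j (x, y))| <= (C * V x) * W y.
Proof. by move=> fC y; rewrite -mulrA -Uj. Qed.

Let inner_continuous (f : Z -> R) C : continuous f ->
  (forall z, `|f z| <= C * U z) -> continuous (fun x => I (fun y => f (j (x, y)))).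
Proof.
move=> cf fC; apply: (@integrator_continuous _ _ _ _ hI _ (f \o j)).
  by move=> p; apply: continuous_comp; [exact: cj|exact: cf].
move=> x; exists `|C|; apply: nearW => x' y /=.
rewrite (le_trans (slice_dominated _ fC _))// ler_wpM2r ?(ltW (weight_gt0 hI _))//.
rewrite (le_trans (ler_norm _))// normrM ler_piMr//.
by rewrite ger0_norm ?(weight_le1 hJ)// (ltW (weight_gt0 hJ _)).
Qed.

Let inner_bound K (f : Z -> R) C :
  (forall (g : Y -> R) D, continuous g ->
    (forall y, `|g y| <= D * W y) -> `|I g| <= K * D) ->
  continuous f -> (forall z, `|f z| <= C * U z) ->
  forall x, `|I (fun y => f (j (x, y)))| <= (K * C) * V x.
Proof.
move=> HK cf fC x; rewrite -mulrA; apply: HK; first exact: slice_continuous.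
exact: slice_dominated.
Qed.

(** The map j stands for the concatenation R x R^d -> R^(d+1): all that is asked of it is to be a
    continuous surjection through which the weight of the target factors. *)
Lemma product_integrator :
  integrator U (fun f => J (fun x => I (fun y => f (j (x, y))))).
Proof.
have [K K0 HK] := integrator_bound hI.
have [L L0 HL] := integrator_bound hJ.
split.
- by move=> z; have [[x y] <-] := sj z; rewrite Uj mulr_gt0// (weight_gt0 hI, weight_gt0 hJ).
- move=> z; have [[x y] <-] := sj z; rewrite Uj mulr_ile1//.
  + exact/ltW/(weight_gt0 hJ).
  + exact/ltW/(weight_gt0 hI).
  + exact: (weight_le1 hJ).
  + exact: (weight_le1 hI).
- exact: cU.
- move=> c f g C D cf cg fC gD.
  rewrite -(@integrator_linear _ _ _ _ hJ c _ _ (K * C) (K * D)).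
  + congr J; apply/funext => x.
    rewrite (@integrator_linear _ _ _ _ hI c _ _ (C * V x) (D * V x))//.
    * exact: slice_continuous.
    * exact: slice_continuous.
    * exact: slice_dominated.
    * exact: slice_dominated.
  + exact: inner_continuous cf fC.
  + exact: inner_continuous cg gD.
  + exact: inner_bound.
  + exact: inner_bound.
- exists (L * K); first exact: mulr_ge0.
  move=> f C cf fC; rewrite -mulrA; apply: HL.
    exact: inner_continuous cf fC.
  exact: inner_bound.
- move=> P F cF lF.
  (* The outer variable x first joins the parameter p of the inner integral. Since V <= 1, the
     domination by W is uniform in x, so G is jointly continuous and the outer integral can be
     treated with the parameter p. *)
  pose G (p : P * X) := I (fun y => F (p.1, j (p.2, y))).
  have cG : continuous G.
    apply: (@integrator_continuous _ _ _ _ hI _ (fun q : (P * X) * Y => F (q.1.1, j (q.1.2, q.2)))).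
      move=> [[p x] y].
      have c1 : (q.1.1, j (q.1.2, q.2)) @[q --> ((p, x), y)] --> (p, j (x, y)).
        apply: (@cvg_pair _ _ _ _ (nbhs p) (nbhs (j (x, y)))).
          apply: (cvg_comp fst fst); [exact: cvg_fst|exact: cvg_fst].
        have c2 : (q.1.2, q.2) @[q --> ((p, x), y)] --> (x, y).
          apply: (@cvg_pair _ _ _ _ (nbhs x) (nbhs y)); last exact: cvg_snd.
          by apply: (cvg_comp fst snd); [exact: cvg_fst|exact: cvg_snd].
        exact: (cvg_comp _ _ c2 (@cj (x, y))).
      exact: (cvg_comp _ _ c1 (cF _)).
    move=> [p x]; have [C HC] := lF p; exists `|C|.
    have : \forall q \near (p, x), forall z, `|F (q.1, z)| <= C * U z.
      by have : q.1 @[q --> (p, x)] --> p by [exact: cvg_fst]; move=> /(_ _ HC).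
    apply: filterS => q Hq y /=; rewrite (le_trans (Hq _))// Uj mulrA.
    rewrite ler_wpM2r ?(ltW (weight_gt0 hI _))//.
    rewrite (le_trans (ler_norm _))// normrM ler_piMr//.
    by rewrite ger0_norm ?(weight_le1 hJ)// (ltW (weight_gt0 hJ _)).
  apply: (integrator_continuous hJ cG) => p; have [C HC] := lF p.
  exists (K * C); apply: filterS HC => q Hq x.
  apply: (inner_bound (f := fun z => F (q, z))) => //.
  move=> z; apply: (@continuous_comp _ _ _ (fun z => (q, z)) F); last exact: cF.
  by apply: (cvg_pair (cvg_cst _) cvg_id).
Qed.

End ProductIntegrator.

Section DominatedFubini.
Context {R : realType}.

(** A relation between two weighted integrals, so that the dimension of each factor can be raised
    separately. *)
Definition fubini (X Y : normedModType R) (V : X -> R) (J : (X -> R) -> R)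
    (W : Y -> R) (I : (Y -> R) -> R) : Prop :=
  forall (F : X * Y -> R) C, continuous F ->
    (forall x y, `|F (x, y)| <= C * (V x * W y)) ->
    J (fun x => I (fun y => F (x, y))) = I (fun y => J (fun x => F (x, y))).

Lemma fubini_sym (X Y : normedModType R) (V : X -> R) J (W : Y -> R) I :
  fubini V J W I -> fubini W I V J.
Proof.
move=> H F C cF FC; symmetry; apply: (H (fun p => F (p.2, p.1)) C).
  move=> [x y].
  have c1 : (p.2, p.1) @[p --> (x, y)] --> (y, x).
    by apply: (@cvg_pair _ _ _ _ (nbhs y) (nbhs x)); [exact: cvg_snd|exact: cvg_fst].
  exact: (cvg_comp _ _ c1 (cF _)).
by move=> x y /=; rewrite (mulrC (V x)).
Qed.

End DominatedFubini.

(** * The iterated integral over R^d as an integrator *)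

Section SpaceIntegral.
Context {R : realType}.

Definition cons_row {d : nat} (t : R) (x : 'rV[R]_d) : 'rV[R]_d.+1 :=
  row_mx (const_mx t : 'rV_1) x.

Lemma cons_row0 d t (x : 'rV[R]_d) : cons_row t x 0 ord0 = t.
Proof.
transitivity (row_mx (const_mx t : 'rV_1) x 0 (lshift d 0)).
  by congr (row_mx _ _ _ _); exact: val_inj.
by rewrite row_mxEl mxE.
Qed.

Lemma cons_rowS d t (x : 'rV[R]_d) i : cons_row t x 0 (lift ord0 i) = x 0 i.
Proof.
rewrite -(row_mxEr (const_mx t : 'rV_1) x).
by congr (row_mx _ _ _ _); exact: val_inj.
Qed.

Lemma cons_row_surj d (z : 'rV[R]_d.+1) : exists p, cons_row p.1 p.2 = z.
Proof.
exists (z 0 ord0, \row_i z 0 (lift ord0 i)); apply/rowP => i.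
by case: (unliftP ord0 i) => [k|] ->; rewrite ?cons_rowS ?cons_row0 ?mxE.
Qed.

Lemma row_cvg d (T : Type) (F : set_system T) {FF : Filter F}
    (f : T -> 'rV[R]_d) (l : 'rV[R]_d) :
  (forall i, f t 0 i @[t --> F] --> l 0 i) -> f @ F --> l.
Proof.
move=> fl; apply/cvg_ballP => e e0.
have H : \forall t \near F, forall i, ball (l 0 i) e (f t 0 i).
  by apply: filter_forall => i; have /cvg_ballP/(_ e e0) := fl i.
by apply: filterS H => t Ht; split=> // i j; rewrite (ord1 i).
Qed.

Lemma cons_row_continuous d :
  continuous (fun p : R * 'rV[R]_d => cons_row p.1 p.2).
Proof.
move=> [t x]; apply: row_cvg => i.
case: (unliftP ord0 i) => [k|] ->.
  under eq_fun do rewrite cons_rowS. rewrite cons_rowS.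
  apply: (cvg_comp snd (fun x : 'rV[R]_d => x 0 k)); first exact: cvg_snd.
  exact: coord_continuous.
under eq_fun do rewrite cons_row0. rewrite cons_row0.
exact: cvg_fst.
Qed.

Definition spaceW {d : nat} (x : 'rV[R]_d) : R := \prod_(i < d) lineW (x 0 i).

(** Real-valued twin of [integralRd], which [integralRdE] applies to real and imaginary parts. *)
Fixpoint spaceI (d : nat) : ('rV[R]_d -> R) -> R :=
  match d with
  | 0%N => fun f => f 0
  | d'.+1 => fun f => lineI (fun t => spaceI (fun x : 'rV[R]_d' => f (cons_row t x)))
  end.

Lemma spaceW_cons d t (x : 'rV[R]_d) :
  spaceW (cons_row t x) = lineW t * spaceW x.
Proof.
rewrite /spaceW big_ord_recl cons_row0; congr (_ * _).
by apply: eq_bigr => i _; rewrite cons_rowS.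
Qed.

Lemma spaceW_continuous d : continuous (@spaceW d).
Proof.
rewrite /spaceW; elim: (index_enum _) => [|i r IH].
  rewrite (_ : (fun _ => _) = fun=> 1); first exact: cst_continuous.
  by apply/funext => x; rewrite big_nil.
rewrite (_ : (fun _ => _) =
  fun x : 'rV[R]_d => lineW (x 0 i) * \prod_(j <- r) lineW (x 0 j)).
  move=> x; apply: (@continuousM R 'rV[R]_d (fun x => lineW (x 0 i))).
    apply: continuous_comp; first exact: coord_continuous.
    exact: lineW_continuous.
  exact: IH.
by apply/funext => x; rewrite big_cons.
Qed.

Lemma space_integrator d : integrator (@spaceW d) (@spaceI d).
Proof.
elim: d => [|d IH].
  have W1 (x : 'rV[R]_0) : spaceW x = 1 by rewrite /spaceW big_ord0.
  split=> //=.
  - by move=> x; rewrite W1.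
  - by move=> x; rewrite W1.
  - exact: spaceW_continuous.
  - by exists 1 => // f C _ /(_ 0); rewrite W1 mulr1 mul1r.
  - move=> P F cF _ p.
    have c1 : (q, 0 : 'rV[R]_0) @[q --> p] --> (p, 0 : 'rV[R]_0).
      by apply: (cvg_pair cvg_id (cvg_cst _)).
    exact: (cvg_comp _ _ c1 (cF _)).
apply: (product_integrator (@line_integrator R) IH
  (j := fun p => cons_row p.1 p.2)) => /=.
- exact: cons_row_continuous.
- exact: spaceW_continuous.
- exact: cons_row_surj.
- exact: spaceW_cons.
Qed.

(** Induction on d: for a fixed first coordinate t, the factor [lineW t] is absorbed into the
    constant and the other coordinates are exchanged by induction; the hypothesis then exchanges the
    first one. *)
Lemma space_fubini d (X : normedModType R) (W : X -> R) I :
  integrator W I -> fubini lineW lineI W I -> fubini (@spaceW d) (@spaceI d) W I.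
Proof.
move=> hI HC; elim: d => [|d IH] F C cF FC //=.
have [K K0 HK] := integrator_bound (space_integrator d).
have cFx t : continuous (fun p : 'rV[R]_d * X => F (cons_row t p.1, p.2)).
  move=> [x y].
  have c1 : (cons_row t p.1, p.2) @[p --> (x, y)] --> (cons_row t x, y).
    apply: (@cvg_pair _ _ _ _ (nbhs (cons_row t x)) (nbhs y)); last exact: cvg_snd.
    have c2 : (t, p.1) @[p --> (x, y)] --> (t, x).
      by apply: (@cvg_pair _ _ _ _ (nbhs t) (nbhs x)); [exact: cvg_cst|exact: cvg_fst].
    exact: (cvg_comp _ _ c2 (@cons_row_continuous d (t, x))).
  exact: (cvg_comp _ _ c1 (cF _)).
have C0 : 0 <= C.
  have [y|noX] := pselect (exists y : X, True); last by exfalso; apply: noX; exists 0.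
  rewrite -(pmulr_lge0 (x := spaceW (0 : 'rV[R]_d.+1) * W 0)).
    exact: le_trans (FC _ _).
  by rewrite mulr_gt0 ?(weight_gt0 (space_integrator _)) ?(weight_gt0 hI).
transitivity (lineI (fun t => I (fun y => spaceI (fun x => F (cons_row t x, y))))).
  congr lineI; apply/funext => t.
  apply: (IH (fun p => F (cons_row t p.1, p.2)) (C * lineW t)) => //.
  by move=> x y /=; rewrite -!mulrA (mulrA (lineW t)) -spaceW_cons.
apply: (HC (fun p => spaceI (fun x => F (cons_row p.1 x, p.2))) (K * C)).
  apply: (@integrator_continuous _ _ _ _ (space_integrator d) _
    (fun q : (R * X) * 'rV[R]_d => F (cons_row q.1.1 q.2, q.1.2))).
    move=> [[t y] x].
    have c1 : (cons_row q.1.1 q.2, q.1.2) @[q --> ((t, y), x)] --> (cons_row t x, y).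
      apply: (@cvg_pair _ _ _ _ (nbhs (cons_row t x)) (nbhs y)); last first.
        by apply: (cvg_comp fst snd); [exact: cvg_fst|exact: cvg_snd].
      have c2 : (q.1.1, q.2) @[q --> ((t, y), x)] --> (t, x).
        apply: (@cvg_pair _ _ _ _ (nbhs t) (nbhs x)); last exact: cvg_snd.
        by apply: (cvg_comp fst fst); [exact: cvg_fst|exact: cvg_fst].
      exact: (cvg_comp _ _ c2 (@cons_row_continuous d (t, x))).
    exact: (cvg_comp _ _ c1 (cF _)).
  move=> p; exists C.
  suff H q (x : 'rV[R]_d) : `|F (cons_row q.1 x, q.2)| <= C * spaceW x.
    by near=> q => x; exact: H.
  move: q => [t y] /=.
  apply: (le_trans (FC _ _)); rewrite ler_wpM2l// spaceW_cons mulrAC.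
  rewrite ler_piMl ?(ltW (weight_gt0 (space_integrator _) _))//.
  by rewrite mulr_ile1 ?lineW_le1 ?(weight_le1 hI) ?(ltW (lineW_gt0 _)) ?(ltW (weight_gt0 hI _)).
move=> t y /=; rewrite -mulrA; apply: HK.
  apply: (continuous_fun_comp (g := F)) => //.
  apply: continuous_pair; last exact: cst_continuous.
  apply: (continuous_fun_comp (@cons_row_continuous d) (f := fun z => (t, z))).
  by apply: continuous_pair; [exact: cst_continuous|move=> z; exact: cvg_id].
move=> x; apply: (le_trans (FC _ _)); rewrite spaceW_cons.
by rewrite [leLHS](_ : _ = C * (lineW t * W y) * spaceW x)//; ring.
Unshelve. all: by end_near. Qed.

(** [space_fubini] is applied once for each factor, the two uses being separated by the symmetry of
    the relation and the second one starting from the plane. *)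
Lemma space_Fubini n m : fubini (@spaceW n) (@spaceI n) (@spaceW m) (@spaceI m).
Proof.
apply: space_fubini; first exact: space_integrator.
apply/fubini_sym/space_fubini; first exact: line_integrator.
by move=> F C cF FC; exact: line_Fubini cF FC.
Qed.

End SpaceIntegral.

(** * Derivatives and integrals in R^d *)

Section SpaceTheory.
Context {R : realType}.

(** The two difference quotients are the same function of h. This reduces a directional derivative
    to one on a line and moves derivatives between a product and its slices. *)
Lemma is_derive_shift (V V' : normedModType R) (phi : V' -> V) (f : V -> R)
    (y w : V') (v : V) (l : R) :
  (forall h, phi (h *: w + y) = h *: v + phi y) ->
  is_derive (phi y) v f l <-> is_derive y w (f \o phi) l.
Proof.
move=> hphi.
have E : (fun h => h^-1 *: (f (h *: v + phi y) - f (phi y))) =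
    (fun h => h^-1 *: ((f \o phi) (h *: w + y) - (f \o phi) y)).
  by apply/funext => h; rewrite /= hphi.
by split=> /is_derive_lim_inv H; apply: is_derive_lim; move: H; rewrite ?E// -E.
Qed.

Lemma integrator_derive_dir (P X : normedModType R) (W : X -> R) I
    (F dF : P * X -> R) (p v : P) :
  integrator W I -> continuous F -> continuous dF ->
  locally_dominated W F -> locally_dominated W dF ->
  (forall q x, is_derive q v (fun q => F (q, x)) (dF (q, x))) ->
  is_derive p v (fun q => I (fun x => F (q, x))) (I (fun x => dF (p, x))).
Proof.
move=> hI cF cdF lF ldF FdF.
pose phi (t : R) := t *: v + p.
have cphi : continuous phi.
  by move=> t; apply: cvgD; [apply: cvgZr_tmp; exact: cvg_id|exact: cvg_cst].
have hphi t h : phi (h *: 1 + t) = h *: v + phi t.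
  by rewrite /phi scaler1 scalerDl addrA.
have cline (G : P * X -> R) : continuous G -> continuous (fun q : R * X => G (phi q.1, q.2)).
  move=> cG; apply: (continuous_fun_comp (g := G)) => //.
  apply: continuous_pair; last by move=> q; exact: cvg_snd.
  by apply: (continuous_fun_comp cphi) => q; exact: cvg_fst.
have lline (G : P * X -> R) : locally_dominated W G ->
    locally_dominated W (fun q : R * X => G (phi q.1, q.2)).
  move=> lG t; have [C HC] := lG (phi t); exists C.
  by have := cphi t => /(_ _ HC).
have p0 : p = phi 0 by rewrite /phi scale0r add0r.
suff : is_derive (phi 0) v (fun q => I (fun x => F (q, x)))
    (I (fun x => dF (phi 0, x))) by rewrite -p0.
apply/(@is_derive_shift _ _ phi (fun q => I (fun x => F (q, x))) 0 1 v) => //.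
apply: (integrator_derive hI 0 (cline _ cF) (cline _ cdF) (lline _ lF) (lline _ ldF)).
move=> t x; have := FdF (phi t) x.
by move/(@is_derive_shift _ _ phi (fun q => F (q, x)) t 1 v); exact.
Qed.

Lemma dirRdE d (i j : 'I_d) : dirRd i 0 j = (j == i)%:R :> R.
Proof. by rewrite mxE eqxx. Qed.

Lemma add_dirRdE d (x : 'rV[R]_d) (h : R) i j :
  (h *: dirRd i + x) 0 j = h * (j == i)%:R + x 0 j.
Proof. by rewrite mxE [X in X + _]mxE dirRdE. Qed.

Lemma cons_row_shift0 d (x : 'rV[R]_d) (t h : R) :
  cons_row (h *: 1 + t) x = h *: dirRd ord0 + cons_row t x.
Proof.
apply/rowP => i; rewrite add_dirRdE.
case: (unliftP ord0 i) => [k|] ->.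
  by rewrite !cons_rowS eq_sym (negPf (neq_lift _ _)) mulr0 add0r.
by rewrite !cons_row0 eqxx scaler1 mulr1.
Qed.

Lemma cons_row_shiftS d (x : 'rV[R]_d) (t h : R) k :
  cons_row t (h *: dirRd k + x) = h *: dirRd (lift ord0 k) + cons_row t x.
Proof.
apply/rowP => i; rewrite add_dirRdE.
case: (unliftP ord0 i) => [j|] ->.
  by rewrite !cons_rowS add_dirRdE (inj_eq (@lift_inj _ ord0)).
by rewrite !cons_row0 (negPf (neq_lift _ _)) mulr0 add0r.
Qed.

(** When i is the first coordinate, differentiating under the inner integral exhibits the outer
    integrand as a derivative on the line; otherwise each inner integral already vanishes by
    induction. *)
Lemma spaceI_derive d (i : 'I_d) (f g : 'rV[R]_d -> R) C D :
  continuous f -> continuous g -> (forall x, is_derive x (dirRd i) f (g x)) ->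
  (forall x, `|f x| <= C * spaceW x) -> (forall x, `|g x| <= D * spaceW x) ->
  spaceI g = 0.
Proof.
elim: d => [|d IH] in i f g C D * => cf cg fg fC gD; first by case: i {fg}.
have hI := space_integrator (R := R) d.
have [K K0 HK] := integrator_bound hI.
have slice (k : 'rV[R]_d.+1 -> R) : continuous k ->
    continuous (fun p : R * 'rV[R]_d => k (cons_row p.1 p.2)).
  by move=> ck; apply: (continuous_fun_comp ck); exact: cons_row_continuous.
have slicet (k : 'rV[R]_d.+1 -> R) t : continuous k ->
    continuous (fun x : 'rV[R]_d => k (cons_row t x)).
  move=> ck; apply: (continuous_fun_comp (slice k ck) (f := fun x => (t, x))).
  by apply: continuous_pair; [exact: cst_continuous|move=> z; exact: cvg_id].
have sdom (k : 'rV[R]_d.+1 -> R) E t : (forall x, `|k x| <= E * spaceW x) ->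
    forall x : 'rV[R]_d, `|k (cons_row t x)| <= (E * lineW t) * spaceW x.
  by move=> kE x; rewrite -mulrA -spaceW_cons.
have ldom (k : 'rV[R]_d.+1 -> R) E : (forall x, `|k x| <= E * spaceW x) ->
    locally_dominated spaceW (fun p : R * 'rV[R]_d => k (cons_row p.1 p.2)).
  move=> kE t; exists E; near=> s => x /=; rewrite (le_trans (kE _))//.
  have E0 := dominated_ge0 (space_integrator _) 0 kE.
  rewrite spaceW_cons ler_wpM2l// ler_piMl ?lineW_le1//.
  exact/ltW/(weight_gt0 hI).
rewrite /=; case: (unliftP ord0 i) => [k|] ei; rewrite {}ei in fg.
  rewrite -[RHS](integrator0 (@line_integrator R)); congr lineI; apply/funext => t.
  apply: (IH k (fun x => f (cons_row t x)) (fun x => g (cons_row t x))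
    (C * lineW t) (D * lineW t)).
  - exact: slicet.
  - exact: slicet.
  - move=> x; have := fg (cons_row t x).
    move/(@is_derive_shift _ _ (@cons_row R d t) f x (dirRd k)); apply.
    by move=> h; exact: cons_row_shiftS.
  - exact: sdom.
  - exact: sdom.
apply: (@lineI_derive _ (fun t => spaceI (fun x => f (cons_row t x))) _ (K * C) (K * D)).
- by apply: (integrator_continuous hI (slice _ cg)); exact: ldom gD.
- move=> t.
  apply: (integrator_derive hI t (slice _ cf) (slice _ cg) (ldom _ _ fC) (ldom _ _ gD)).
  move=> s x; have := fg (cons_row s x).
  move/(@is_derive_shift _ _ (fun s => cons_row s x) f s 1); apply.
  by move=> h; exact: cons_row_shift0.
- by move=> t; rewrite -mulrA; apply: HK; [exact: slicet|exact: sdom].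
- by move=> t; rewrite -mulrA; apply: HK; [exact: slicet|exact: sdom].
Unshelve. all: by end_near. Qed.

Lemma spaceI_ge0 d (f : 'rV[R]_d -> R) : (forall x, 0 <= f x) -> 0 <= spaceI f.
Proof.
elim: d f => [|d IH] f f0 //=.
by apply: Rintegral_ge0 => t _; exact: IH.
Qed.

Lemma spaceI_eq0 d (f : 'rV[R]_d -> R) C : continuous f -> (forall x, 0 <= f x) ->
  (forall x, `|f x| <= C * spaceW x) -> spaceI f = 0 -> forall x, f x = 0.
Proof.
elim: d f C => [|d IH] f C cf f0 fC.
  by move=> f00 x; rewrite (_ : x = 0)//; apply/rowP => -[].
move=> /= If0 z; have [[t x] <-] := cons_row_surj z => /=.
have hI := space_integrator (R := R) d.
have [K K0 HK] := integrator_bound hI.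
have cf2 : continuous (fun p : R * 'rV[R]_d => f (cons_row p.1 p.2)).
  by apply: (continuous_fun_comp cf); exact: cons_row_continuous.
have cft s : continuous (fun x : 'rV[R]_d => f (cons_row s x)).
  apply: (continuous_fun_comp cf2 (f := fun x => (s, x))).
  by apply: continuous_pair; [exact: cst_continuous|move=> y; exact: cvg_id].
have sdom s (y : 'rV[R]_d) : `|f (cons_row s y)| <= (C * lineW s) * spaceW y.
  by rewrite -mulrA -spaceW_cons.
apply: (IH (fun x => f (cons_row t x)) (C * lineW t)) => //.
apply: (@lineI_eq0 _ (fun t => spaceI (fun x => f (cons_row t x))) (K * C)) => //.
- apply: (integrator_continuous hI cf2) => s; exists C; near=> r => y /=.
  have C0 := dominated_ge0 (space_integrator _) 0 fC.
  rewrite (le_trans (fC _))// spaceW_cons ler_wpM2l// ler_piMl ?lineW_le1//.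
  exact/ltW/(weight_gt0 hI).
- by move=> s; exact: spaceI_ge0.
- by move=> s; rewrite -mulrA; apply: HK.
Unshelve. all: by end_near. Qed.

End SpaceTheory.

(** * Complex-valued functions on R^d *)

Section ComplexCalculus.
Context {R : realType}.
Implicit Types z : R[i].

Lemma ReD z w : complex.Re (z + w) = complex.Re z + complex.Re w.
Proof. by case: z => ? ?; case: w. Qed.

Lemma ImD z w : complex.Im (z + w) = complex.Im z + complex.Im w.
Proof. by case: z => ? ?; case: w. Qed.

Lemma ReM z w : complex.Re (z * w) =
  complex.Re z * complex.Re w - complex.Im z * complex.Im w.
Proof. by case: z => ? ?; case: w. Qed.

Lemma ImM z w : complex.Im (z * w) =
  complex.Re z * complex.Im w + complex.Im z * complex.Re w.
Proof. by case: z => ? ?; case: w. Qed.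

Lemma normc_ge0 z : 0 <= normc z.
Proof. by case: z => a b; rewrite sqrtr_ge0. Qed.

Lemma Re_le_normc z : `|complex.Re z| <= normc z.
Proof.
by case: z => a b /=; rewrite -sqrtr_sqr ler_wsqrtr// lerDl sqr_ge0.
Qed.

Lemma Im_le_normc z : `|complex.Im z| <= normc z.
Proof.
by case: z => a b /=; rewrite -sqrtr_sqr ler_wsqrtr// lerDr sqr_ge0.
Qed.

Lemma normc_le_ReIm z : normc z <= `|complex.Re z| + `|complex.Im z|.
Proof.
case: z => a b /=.
rewrite -(@ler_pXn2r _ 2)// ?nnegrE ?sqrtr_ge0 ?addr_ge0//.
rewrite sqr_sqrtr ?addr_ge0 ?sqr_ge0// -(real_normK (num_real a)).
rewrite -(real_normK (num_real b)).
have : 0 <= `|a| by []. have : 0 <= `|b| by [].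
by move: `|a| `|b| => x y; nra.
Qed.

Lemma normc_real (r : R) : normc r%:C = `|r|.
Proof. by rewrite /normc/= expr0n/= addr0 sqrtr_sqr. Qed.

Lemma normc_one : normc (1 : R[i]) = 1.
Proof. exact: normc1. Qed.

Lemma normc_zero : normc (0 : R[i]) = 0.
Proof. exact: normc0. Qed.

Lemma complex_ext z w : complex.Re z = complex.Re w ->
  complex.Im z = complex.Im w -> z = w.
Proof. by case: z => ? ?; case: w => ? ? /= -> ->. Qed.

Section Rules.
Context {V : normedModType R}.
Implicit Types f g : V -> R[i].

Definition is_cderive f (x v : V) (l : R[i]) : Prop :=
  is_derive x v (fun y => complex.Re (f y)) (complex.Re l) /\
  is_derive x v (fun y => complex.Im (f y)) (complex.Im l).

Lemma ccontinuous_cst z : ccontinuous (fun _ : V => z).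
Proof. by split; exact: cst_continuous. Qed.

Lemma ccontinuousD f g : ccontinuous f -> ccontinuous g ->
  ccontinuous (fun x => f x + g x).
Proof.
move=> [f1 f2] [g1 g2]; split.
  rewrite (_ : (fun _ => _) = fun x => complex.Re (f x) + complex.Re (g x)).
    by move=> x; apply: continuousD; [exact: f1|exact: g1].
  by apply/funext => x; rewrite ReD.
rewrite (_ : (fun _ => _) = fun x => complex.Im (f x) + complex.Im (g x)).
  by move=> x; apply: continuousD; [exact: f2|exact: g2].
by apply/funext => x; rewrite ImD.
Qed.

Lemma ccontinuousM f g : ccontinuous f -> ccontinuous g ->
  ccontinuous (fun x => f x * g x).
Proof.
move=> [f1 f2] [g1 g2]; split.
  rewrite (_ : (fun _ => _) = fun x =>
    complex.Re (f x) * complex.Re (g x) - complex.Im (f x) * complex.Im (g x)).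
    move=> x; apply: cvgB; apply: cvgM;
      by [exact: f1|exact: f2|exact: g1|exact: g2].
  by apply/funext => x; rewrite ReM.
rewrite (_ : (fun _ => _) = fun x =>
  complex.Re (f x) * complex.Im (g x) + complex.Im (f x) * complex.Re (g x)).
  move=> x; apply: cvgD; apply: cvgM;
    by [exact: f1|exact: f2|exact: g1|exact: g2].
by apply/funext => x; rewrite ImM.
Qed.

Lemma ccontinuous_comp (V' : normedModType R) f (phi : V' -> V) :
  ccontinuous f -> continuous phi -> ccontinuous (fun x => f (phi x)).
Proof.
by move=> [f1 f2] cp; split;
  [exact: (continuous_fun_comp f1)|exact: (continuous_fun_comp f2)].
Qed.

Lemma is_cderive_cst z x v : is_cderive (fun=> z) x v 0.
Proof. by split; exact: is_derive_cst. Qed.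

Lemma is_cderiveD f g x v k l : is_cderive f x v k -> is_cderive g x v l ->
  is_cderive (fun y => f y + g y) x v (k + l).
Proof.
move=> [f1 f2] [g1 g2]; split.
  rewrite ReD (_ : (fun _ => _) = (fun x => complex.Re (f x)) \+ (fun x => complex.Re (g x))).
    exact: is_deriveD.
  by apply/funext => y; rewrite ReD.
rewrite ImD (_ : (fun _ => _) = (fun x => complex.Im (f x)) \+ (fun x => complex.Im (g x))).
  exact: is_deriveD.
by apply/funext => y; rewrite ImD.
Qed.

Lemma is_cderiveM f g x v k l : is_cderive f x v k -> is_cderive g x v l ->
  is_cderive (fun y => f y * g y) x v (k * g x + f x * l).
Proof.
move=> [f1 f2] [g1 g2]; split.
  rewrite (_ : (fun _ => _) =
    (fun x => complex.Re (f x)) * (fun x => complex.Re (g x)) -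
    (fun x => complex.Im (f x)) * (fun x => complex.Im (g x))); last first.
    by apply/funext => y; rewrite ReM.
  apply: (is_derive_eq (is_deriveB (is_deriveM f1 g1) (is_deriveM f2 g2))).
  by rewrite ReD !ReM /GRing.scale/=; ring.
rewrite (_ : (fun _ => _) =
  (fun x => complex.Re (f x)) * (fun x => complex.Im (g x)) +
  (fun x => complex.Im (f x)) * (fun x => complex.Re (g x))); last first.
  by apply/funext => y; rewrite ImM.
apply: (is_derive_eq (is_deriveD (is_deriveM f1 g2) (is_deriveM f2 g1))).
by rewrite ImD !ImM /GRing.scale/=; ring.
Qed.

Lemma is_cderiveP f x v l : is_cderive f x v l <-> cderivable f x v /\
  'D_v (fun y => complex.Re (f y)) x +i* 'D_v (fun y => complex.Im (f y)) x = l.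
Proof.
split=> [[[d1 e1] [d2 e2]]|[[d1 d2] <-]].
  by split=> //; apply: complex_ext.
by split; split.
Qed.

End Rules.

Lemma is_cderive_shift (V V' : normedModType R) (phi : V' -> V) (f : V -> R[i])
    (y w : V') (v : V) l : (forall h, phi (h *: w + y) = h *: v + phi y) ->
  is_cderive f (phi y) v l <-> is_cderive (fun y => f (phi y)) y w l.
Proof.
move=> hphi.
have H (g : V -> R) m := @is_derive_shift R V V' phi g y w v m hphi.
by split=> -[f1 f2]; split; [exact/H| exact/H | exact/H | exact/H].
Qed.

End ComplexCalculus.

(** * Complex integrals over R^d *)

Section ComplexIntegral.
Context {R : realType}.

Lemma integralRdE d (f : 'rV[R]_d -> R[i]) : integralRd f =
  spaceI (fun x => complex.Re (f x)) +i* spaceI (fun x => complex.Im (f x)).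
Proof.
elim: d f => [|d IH] f /=; first by case: (f 0).
rewrite /cintegral /lineI; congr (_ +i* _); congr Rintegral;
  by apply/funext => t; rewrite IH.
Qed.

Lemma Re_dominated (T : Type) (f : T -> R[i]) (W : T -> R) C :
  (forall x, normc (f x) <= C * W x) -> forall x, `|complex.Re (f x)| <= C * W x.
Proof. by move=> fC x; exact: le_trans (Re_le_normc _) (fC x). Qed.

Lemma Im_dominated (T : Type) (f : T -> R[i]) (W : T -> R) C :
  (forall x, normc (f x) <= C * W x) -> forall x, `|complex.Im (f x)| <= C * W x.
Proof. by move=> fC x; exact: le_trans (Im_le_normc _) (fC x). Qed.

Lemma integralRdD d (f g : 'rV[R]_d -> R[i]) C D : ccontinuous f -> ccontinuous g ->
  (forall x, normc (f x) <= C * spaceW x) -> (forall x, normc (g x) <= D * spaceW x) ->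
  integralRd (fun x => f x + g x) = integralRd f + integralRd g.
Proof.
move=> [f1 f2] [g1 g2] fC gD; rewrite !integralRdE; apply: complex_ext.
  rewrite ReD/= -(integratorD (space_integrator d) f1 g1 (Re_dominated fC) (Re_dominated gD)).
  by congr spaceI; apply/funext => x; rewrite ReD.
rewrite ImD/= -(integratorD (space_integrator d) f2 g2 (Im_dominated fC) (Im_dominated gD)).
by congr spaceI; apply/funext => x; rewrite ImD.
Qed.

Lemma integralRdZ d c (f : 'rV[R]_d -> R[i]) C : ccontinuous f ->
  (forall x, normc (f x) <= C * spaceW x) ->
  integralRd (fun x => c * f x) = c * integralRd f.
Proof.
move=> [f1 f2] fC; rewrite !integralRdE; have hI := space_integrator (R := R) d.
have fR := Re_dominated fC; have fI := Im_dominated fC.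
have Zd (r : R) (g : 'rV[R]_d -> R) : (forall x, `|g x| <= C * spaceW x) ->
    forall x, `|r * g x| <= (`|r| * C) * spaceW x.
  by move=> gC x; rewrite normrM -mulrA ler_wpM2l.
have Zc (r : R) (g : 'rV[R]_d -> R) : continuous g -> continuous (fun x => r * g x).
  by move=> cg x; apply: continuousM; [exact: cst_continuous|exact: cg].
apply: complex_ext.
  rewrite ReM/= -(integratorZ hI _ f1 fR) -(integratorZ hI _ f2 fI).
  rewrite -(integratorB hI (Zc _ _ f1) (Zc _ _ f2) (Zd _ _ fR) (Zd _ _ fI)).
  by congr spaceI; apply/funext => x; rewrite ReM.
rewrite ImM/= -(integratorZ hI _ f2 fI) -(integratorZ hI _ f1 fR).
rewrite -(integratorD hI (Zc _ _ f2) (Zc _ _ f1) (Zd _ _ fI) (Zd _ _ fR)).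
by congr spaceI; apply/funext => x; rewrite ImM.
Qed.

Lemma integralRd_bound d : exists2 K : R, 0 <= K &
  forall (f : 'rV[R]_d -> R[i]) C, ccontinuous f ->
    (forall x, normc (f x) <= C * spaceW x) -> normc (integralRd f) <= K * C.
Proof.
have [K K0 HK] := integrator_bound (space_integrator (R := R) d).
exists (K + K); first exact: addr_ge0.
move=> f C [f1 f2] fC; rewrite integralRdE (le_trans (normc_le_ReIm _))//= mulrDl.
by apply: lerD; apply: HK => // x; [exact: Re_dominated fC _|exact: Im_dominated fC _].
Qed.

Definition clocally_dominated (P X : normedModType R) (W : X -> R)
    (F : P * X -> R[i]) : Prop :=
  forall p : P, exists C, \forall q \near p, forall x, normc (F (q, x)) <= C * W x.

Lemma clocally_dominatedE (P X : normedModType R) (W : X -> R) (F : P * X -> R[i]) :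
  clocally_dominated W F -> locally_dominated W (fun p => complex.Re (F p)) /\
    locally_dominated W (fun p => complex.Im (F p)).
Proof.
move=> lF; split=> p; have [C HC] := lF p; exists C; apply: filterS HC => q Hq x.
  exact: Re_dominated Hq x.
exact: Im_dominated Hq x.
Qed.

Lemma integralRd_continuous d (P : normedModType R) (F : P * 'rV[R]_d -> R[i]) :
  ccontinuous F -> clocally_dominated spaceW F ->
  ccontinuous (fun p => integralRd (fun x => F (p, x))).
Proof.
move=> [F1 F2] /clocally_dominatedE[l1 l2].
have hI := space_integrator (R := R) d.
split.
  rewrite (_ : (fun _ => _) = fun p => spaceI (fun x => complex.Re (F (p, x)))).
    exact: (integrator_continuous hI F1 l1).
  by apply/funext => p; rewrite integralRdE.
rewrite (_ : (fun _ => _) = fun p => spaceI (fun x => complex.Im (F (p, x)))).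
  exact: (integrator_continuous hI F2 l2).
by apply/funext => p; rewrite integralRdE.
Qed.

Lemma integralRd_derive d (P : normedModType R) (F dF : P * 'rV[R]_d -> R[i]) (p v : P) :
  ccontinuous F -> ccontinuous dF ->
  clocally_dominated spaceW F -> clocally_dominated spaceW dF ->
  (forall q x, is_cderive (fun q => F (q, x)) q v (dF (q, x))) ->
  is_cderive (fun q => integralRd (fun x => F (q, x))) p v
    (integralRd (fun x => dF (p, x))).
Proof.
move=> [F1 F2] [dF1 dF2] /clocally_dominatedE[l1 l2] /clocally_dominatedE[dl1 dl2] FdF.
have hI := space_integrator (R := R) d.
rewrite integralRdE; split=> /=.
  rewrite (_ : (fun _ => _) = fun p => spaceI (fun x => complex.Re (F (p, x)))).
    by apply: (integrator_derive_dir p hI F1 dF1 l1 dl1) => q x; have [] := FdF q x.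
  by apply/funext => q; rewrite integralRdE.
rewrite (_ : (fun _ => _) = fun p => spaceI (fun x => complex.Im (F (p, x)))).
  by apply: (integrator_derive_dir p hI F2 dF2 l2 dl2) => q x; have [] := FdF q x.
by apply/funext => q; rewrite integralRdE.
Qed.

Lemma integralRd_derive0 d (i : 'I_d) (f g : 'rV[R]_d -> R[i]) C D :
  ccontinuous f -> ccontinuous g -> (forall x, is_cderive f x (dirRd i) (g x)) ->
  (forall x, normc (f x) <= C * spaceW x) -> (forall x, normc (g x) <= D * spaceW x) ->
  integralRd g = 0.
Proof.
move=> [f1 f2] [g1 g2] fg fC gD; rewrite integralRdE; apply: complex_ext => /=.
  exact: (spaceI_derive f1 g1 (fun x => (fg x).1) (Re_dominated fC) (Re_dominated gD)).
exact: (spaceI_derive f2 g2 (fun x => (fg x).2) (Im_dominated fC) (Im_dominated gD)).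
Qed.

Lemma integralRd_Fubini n m (F : 'rV[R]_n * 'rV[R]_m -> R[i]) C : ccontinuous F ->
  (forall x y, normc (F (x, y)) <= C * (spaceW x * spaceW y)) ->
  integralRd (fun x => integralRd (fun y => F (x, y))) =
  integralRd (fun y => integralRd (fun x => F (x, y))).
Proof.
move=> [F1 F2] FC; rewrite !integralRdE; congr (_ +i* _).
  under [in LHS]eq_fun do rewrite integralRdE/=.
  under [in RHS]eq_fun do rewrite integralRdE/=.
  apply: (space_Fubini F1) => x y; exact: le_trans (Re_le_normc _) (FC x y).
under [in LHS]eq_fun do rewrite integralRdE/=.
under [in RHS]eq_fun do rewrite integralRdE/=.
by apply: (space_Fubini F2) => x y; exact: le_trans (Im_le_normc _) (FC x y).
Qed.

(** The integrand is |h|^2, continuous and nonnegative. As W <= 1, the square of C W is at most C^2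
    W; the factor 2 in the bound counts the real and the imaginary part. *)
Lemma integralRd_conj_eq0 d (h : 'rV[R]_d -> R[i]) C : ccontinuous h ->
  (forall x, normc (h x) <= C * spaceW x) ->
  integralRd (fun x => (h x)^* * h x) = 0 -> forall x, h x = 0.
Proof.
move=> [h1 h2] hC; rewrite integralRdE => /(congr1 (@complex.Re R)) /= H x.
have E : (fun x => complex.Re ((h x)^* * h x)) =
    fun x => complex.Re (h x) ^+ 2 + complex.Im (h x) ^+ 2.
  by apply/funext => y; case: (h y) => a b /=; ring.
rewrite E in H.
have C0 : 0 <= C.
  rewrite -(pmulr_lge0 C (weight_gt0 (space_integrator (R := R) d) 0)).
  exact: le_trans (normc_ge0 _) (hC 0).
have H0 := @spaceI_eq0 R d _ (C ^+ 2 *+ 2) _ _ _ H x.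
have : complex.Re (h x) ^+ 2 + complex.Im (h x) ^+ 2 = 0.
  apply: H0.
  - have sq (r : 'rV[R]_d -> R) : continuous r -> continuous (fun y => r y ^+ 2).
      by move=> cr; apply: (continuous_fun_comp (g := fun t : R => t ^+ 2)) => //;
        exact: exprn_continuous.
    by move=> y; exact: (continuousD (sq _ h1 y) (sq _ h2 y)).
  - by move=> y; rewrite addr_ge0 ?sqr_ge0.
  - move=> y; rewrite ger0_norm ?addr_ge0 ?sqr_ge0//.
    have W1 := weight_le1 (space_integrator (R := R) d) y.
    have W0 := weight_gt0 (space_integrator (R := R) d) y.
    have hs (r : R) : `|r| <= normc (h y) -> r ^+ 2 <= C ^+ 2 * spaceW y.
      move=> rh; rewrite -(real_normK (num_real r)).
      apply: (@le_trans _ _ ((C * spaceW y) ^+ 2)).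
        rewrite ler_pXn2r ?nnegrE// ?mulr_ge0 ?(ltW W0)//.
        exact: le_trans rh (hC y).
      by rewrite exprMn ler_wpM2l ?sqr_ge0// expr2 ler_piMl// ltW.
    by rewrite mulr2n mulrDl lerD// hs// ?Re_le_normc// Im_le_normc.
move/eqP; rewrite paddr_eq0 ?sqr_ge0// !sqrf_eq0 => /andP[/eqP r0 /eqP i0].
exact: complex_ext.
Qed.

End ComplexIntegral.

(** * Smooth functions and Schwartz seminorms *)

Section SmoothTheory.
Context {R : realType} {V : normedModType R} {I : Type}.
Variable b : I -> V.
Implicit Types (f g : V -> R[i]) (s : seq I) (n : nat).

Lemma cpartial_cderive i f df : (forall x, is_cderive f x (b i) (df x)) ->
  cpartial b i f = df.
Proof. by move=> fdf; apply/funext => x; have /is_cderiveP[] := fdf x. Qed.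

Lemma cderivable_is_cderive f x i : cderivable f x (b i) ->
  is_cderive f x (b i) (cpartial b i f x).
Proof. by move=> df; apply/is_cderiveP. Qed.

(** Smoothness graded by order. The last letter of a word is the derivative taken first, and this is
    the one peeled off here, so that closure under products is an induction on n; the inductions on
    words by [last_ind] have the same origin. *)
Fixpoint Ck n f : Prop :=
  ccontinuous f /\
  if n is m.+1 then (forall x i, cderivable f x (b i)) /\
    forall i, Ck m (cpartial b i f)
  else True.

Lemma partials_rcons s i f : partials b (rcons s i) f = partials b s (cpartial b i f).
Proof. by rewrite /partials foldr_rcons. Qed.

Lemma smooth_cpartial i f : smooth b f -> smooth b (cpartial b i f).
Proof. by move=> sf s; rewrite -partials_rcons; exact: sf. Qed.

Lemma smooth_partials s f : smooth b f -> smooth b (partials b s f).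
Proof.
elim/last_ind: s f => [|s i IH] f sf; first exact: sf.
by rewrite (partials_rcons s i); apply: IH; exact: smooth_cpartial.
Qed.

Lemma smooth_continuous f : smooth b f -> ccontinuous f.
Proof. by move=> /(_ [::])[]. Qed.

Lemma smooth_derivable f x i : smooth b f -> is_cderive f x (b i) (cpartial b i f x).
Proof. by move=> /(_ [::])[_ df]; exact/cderivable_is_cderive. Qed.

Lemma smooth_Ck f : smooth b f <-> forall n, Ck n f.
Proof.
split=> [sf n|]; first elim: n f sf => [|n IH] f sf.
- by split=> //; exact: smooth_continuous.
- split; first exact: smooth_continuous.
  by split=> [x i|i]; [case: (sf [::])|exact/IH/smooth_cpartial].
move=> Cf s; have := Cf (size s).+1; elim/last_ind: s f {Cf} => [|s i IH] f.
  by case=> cf [df _].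
by rewrite size_rcons partials_rcons => -[_ [_ Cf]]; apply: IH; exact: Cf.
Qed.

Lemma CkW n m f : (m <= n)%N -> Ck n f -> Ck m f.
Proof.
elim: n m f => [|n IH] [|m] f //= mn [cf Hf]; first by [].
by case: Hf => df Cf; split=> //; split=> // i; apply: IH => //; exact: Cf.
Qed.

Lemma CkD n f g : Ck n f -> Ck n g -> Ck n (fun x => f x + g x).
Proof.
elim: n f g => [|n IH] f g [cf Hf] [cg Hg]; split=> //; try exact: ccontinuousD.
have [[df Cf] [dg Cg]] := (Hf, Hg).
have H x i := is_cderiveD (cderivable_is_cderive (df x i)) (cderivable_is_cderive (dg x i)).
split=> [x i|i]; first by have /is_cderiveP[] := H x i.
by rewrite (cpartial_cderive (H ^~ i)); apply: IH; [exact: Cf|exact: Cg].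
Qed.

Lemma CkM n f g : Ck n f -> Ck n g -> Ck n (fun x => f x * g x).
Proof.
elim: n f g => [|n IH] f g Cf1 Cg1.
  by case: Cf1 Cg1 => cf _ [cg _]; split=> //; exact: ccontinuousM.
have [cf [df Cf]] := Cf1; have [cg [dg Cg]] := Cg1.
split; first exact: ccontinuousM.
have H x i := is_cderiveM (cderivable_is_cderive (df x i)) (cderivable_is_cderive (dg x i)).
split=> [x i|i]; first by have /is_cderiveP[] := H x i.
rewrite (cpartial_cderive (H ^~ i)); apply: CkD; apply: IH.
- exact: Cf.
- exact: CkW (leqnSn n) Cg1.
- exact: CkW (leqnSn n) Cf1.
- exact: Cg.
Qed.

Lemma Ck_cst n c : Ck n (fun=> c).
Proof.
elim: n c => [|n IH] c; split=> //; try exact: ccontinuous_cst.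
have H x i := is_cderive_cst c x (b i).
split=> [x i|i]; first by have /is_cderiveP[] := H x i.
by rewrite (cpartial_cderive (H ^~ i)).
Qed.

Lemma smoothD f g : smooth b f -> smooth b g -> smooth b (fun x => f x + g x).
Proof. by move=> /smooth_Ck Cf /smooth_Ck Cg; apply/smooth_Ck => n; exact: CkD. Qed.

Lemma smoothM f g : smooth b f -> smooth b g -> smooth b (fun x => f x * g x).
Proof. by move=> /smooth_Ck Cf /smooth_Ck Cg; apply/smooth_Ck => n; exact: CkM. Qed.

Lemma smooth_cst c : smooth b (fun=> c).
Proof. by apply/smooth_Ck => n; exact: Ck_cst. Qed.

Lemma smoothZ c f : smooth b f -> smooth b (fun x => c * f x).
Proof. by apply: smoothM; exact: smooth_cst. Qed.

Lemma cpartialD i f g : smooth b f -> smooth b g ->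
  cpartial b i (fun x => f x + g x) = fun x => cpartial b i f x + cpartial b i g x.
Proof.
by move=> sf sg; apply: cpartial_cderive => x; apply: is_cderiveD; exact: smooth_derivable.
Qed.

Lemma cpartialM i f g : smooth b f -> smooth b g ->
  cpartial b i (fun x => f x * g x) =
  fun x => cpartial b i f x * g x + f x * cpartial b i g x.
Proof.
by move=> sf sg; apply: cpartial_cderive => x; apply: is_cderiveM; exact: smooth_derivable.
Qed.

Lemma cpartial_cst i c : cpartial b i (fun=> c) = fun=> 0.
Proof. by apply: cpartial_cderive => x; exact: is_cderive_cst. Qed.

Lemma partialsD s f g : smooth b f -> smooth b g ->
  partials b s (fun x => f x + g x) = fun x => partials b s f x + partials b s g x.
Proof.
elim/last_ind: s f g => [|s i IH] f g sf sg; first by [].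
rewrite !(partials_rcons s i) (cpartialD i sf sg).
exact: IH (smooth_cpartial i sf) (smooth_cpartial i sg).
Qed.

Lemma partialsZ s c f : smooth b f ->
  partials b s (fun x => c * f x) = fun x => c * partials b s f x.
Proof.
elim/last_ind: s f => [|s i IH] f sf; first by [].
rewrite !(partials_rcons s i) (cpartialM i (smooth_cst c) sf) cpartial_cst.
rewrite -(IH _ (smooth_cpartial i sf)).
by congr partials; apply/funext => x; rewrite mul0r add0r.
Qed.

Lemma partials_cst s (c : R[i]) x : normc (partials b s (fun=> c) x) <= normc c.
Proof.
elim/last_ind: s c => [|s i IH] c; first exact: lexx.
by rewrite partials_rcons cpartial_cst (le_trans (IH 0))// normc_zero normc_ge0.
Qed.

(** Each derivative doubles the number of products, whence 2^n. The estimate is made at a single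
    point x, so that F and G may depend on it. *)
Lemma Leibniz_bound n s f g x (F G : R) : (size s <= n)%N ->
  smooth b f -> smooth b g ->
  (forall s, (size s <= n)%N -> normc (partials b s f x) <= F) ->
  (forall s, (size s <= n)%N -> normc (partials b s g x) <= G) ->
  normc (partials b s (fun x => f x * g x) x) <= 2 ^+ n * (F * G).
Proof.
move=> sn sf sg fF gG.
have F0 : 0 <= F by exact: le_trans (normc_ge0 _) (fF [::] isT).
have G0 : 0 <= G by exact: le_trans (normc_ge0 _) (gG [::] isT).
elim: n s f g sn sf sg fF gG => [|n IH] s f g.
  rewrite leqn0 => /nilP -> sf sg fF gG; rewrite expr0 mul1r normcM.
  apply: ler_pM; [exact: normc_ge0|exact: normc_ge0|exact: (fF [::])|exact: (gG [::])].
case/lastP: s => [|s i].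
  move=> _ sf sg fF gG; rewrite normcM (@le_trans _ _ (F * G))//.
    apply: ler_pM; [exact: normc_ge0|exact: normc_ge0|exact: (fF [::])|exact: (gG [::])].
  by rewrite ler_peMl ?mulr_ge0// exprn_ege1// ler1n.
rewrite size_rcons ltnS => sn sf sg fF gG.
have fF' t : (size t <= n)%N -> normc (partials b t f x) <= F.
  by move=> tn; apply: fF; exact: leqW.
have gG' t : (size t <= n)%N -> normc (partials b t g x) <= G.
  by move=> tn; apply: gG; exact: leqW.
have sfi := smooth_cpartial i sf; have sgi := smooth_cpartial i sg.
rewrite partials_rcons cpartialM// partialsD; [|exact: smoothM|exact: smoothM].
rewrite (le_trans (le_normcD _ _))// exprS -mulrA mulr_natl mulr2n lerD//; apply: IH => //.
  by move=> t tn; rewrite -partials_rcons; apply: fF; rewrite size_rcons.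
by move=> t tn; rewrite -partials_rcons; apply: gG; rewrite size_rcons.
Qed.

End SmoothTheory.

(** * Seminorm estimates as real inequalities *)

Section Seminorms.
Context {R : realType} {V : normedModType R} {I : Type}.
Variables (b : I -> V) (bracket : V -> R).
Hypothesis bracket_ge1 : forall x, 1 <= bracket x.
Implicit Types (f g : V -> R[i]) (s : seq I) (k N : nat) (M : R).

(** A bound on the supremum [seminorm] read pointwise, which keeps estimates in R rather than in the
    extended reals. *)
Definition seminorm_le k N M f : Prop := forall s x, (size s <= N)%N ->
  bracket x ^+ k * normc (partials b s f x) <= M.

Lemma bracketX_gt0 x k : 0 < bracket x ^+ k.
Proof. by rewrite exprn_gt0// (lt_le_trans _ (bracket_ge1 x)). Qed.

Lemma seminormP k N M f : (seminorm b bracket k N f <= M%:E)%E <-> seminorm_le k N M f.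
Proof.
split=> [fM s x sN|fM].
  rewrite -lee_fin; apply: le_trans fM; apply: ereal_sup_ubound.
  by exists s, x.
by apply: ge_ereal_sup => _ [s [x [sN ->]]]; rewrite lee_fin; exact: fM.
Qed.

Lemma seminorm_leW k k' N N' M M' f : (k <= k')%N -> (N <= N')%N -> M' <= M ->
  seminorm_le k' N' M' f -> seminorm_le k N M f.
Proof.
move=> kk NN MM fM s x sN; apply: le_trans MM; apply: le_trans (fM s x (leq_trans sN NN)).
by rewrite ler_wpM2r ?normc_ge0// ler_weXn2l.
Qed.

Lemma seminorm_le_ge0 k N M f : seminorm_le k N M f -> 0 <= M.
Proof.
move=> /(_ [::] 0 isT); apply: le_trans.
by rewrite mulr_ge0 ?normc_ge0// ltW ?bracketX_gt0.
Qed.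

Lemma seminorm_fin k N f : (seminorm b bracket k N f < +oo)%E ->
  exists2 M, seminorm_le k N M f & seminorm b bracket k N f = M%:E.
Proof.
move=> fin.
have s0 : (0 <= seminorm b bracket k N f)%E.
  apply: (@le_trans _ _ (bracket 0 ^+ k * normc (partials b [::] f 0))%:E).
    by rewrite lee_fin mulr_ge0 ?normc_ge0// ltW ?bracketX_gt0.
  by apply: ereal_sup_ubound; exists [::], 0.
have e : (fine (seminorm b bracket k N f))%:E = seminorm b bracket k N f.
  by rewrite fineK// ge0_fin_numE.
by exists (fine (seminorm b bracket k N f)) => //; apply/seminormP; rewrite e.
Qed.

Lemma schwartzP f : schwartz b bracket f <->
  smooth b f /\ forall N, exists M, seminorm_le N N M f.
Proof.
split=> [[sf fN]|[sf fN]]; split=> // N.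
  by have [M HM _] := seminorm_fin (fN N); exists M.
by have [M /seminormP HM] := fN N; rewrite (le_lt_trans HM)// ltry.
Qed.

Lemma seminorm_leD k N M M' f g : smooth b f -> smooth b g ->
  seminorm_le k N M f -> seminorm_le k N M' g ->
  seminorm_le k N (M + M') (fun x => f x + g x).
Proof.
move=> sf sg fM gM s x sN; rewrite (partialsD s sf sg).
apply: (@le_trans _ _ (bracket x ^+ k * (normc (partials b s f x) + normc (partials b s g x)))).
  by rewrite ler_wpM2l ?le_normcD// ltW ?bracketX_gt0.
by rewrite mulrDr lerD ?fM ?gM.
Qed.

Lemma seminorm_leZ k N M c f : smooth b f -> seminorm_le k N M f ->
  seminorm_le k N (normc c * M) (fun x => c * f x).
Proof.
move=> sf fM s x sN; rewrite (partialsZ s c sf) normcM mulrCA.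
by rewrite ler_wpM2l ?normc_ge0 ?fM.
Qed.

Lemma schwartz_smooth f : schwartz b bracket f -> smooth b f.
Proof. by case. Qed.

Lemma schwartzD f g : schwartz b bracket f -> schwartz b bracket g ->
  schwartz b bracket (fun x => f x + g x).
Proof.
move=> /schwartzP[sf fN] /schwartzP[sg gN]; apply/schwartzP; split; first exact: smoothD.
by move=> N; have [M HM] := fN N; have [M' HM'] := gN N; exists (M + M'); exact: seminorm_leD.
Qed.

Lemma schwartzZ c f : schwartz b bracket f -> schwartz b bracket (fun x => c * f x).
Proof.
move=> /schwartzP[sf fN]; apply/schwartzP; split; first exact: smoothZ.
by move=> N; have [M HM] := fN N; exists (normc c * M); exact: seminorm_leZ.
Qed.

(** Growth of order k of the factor f is paid for by k additional powers of the bracket in the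
    seminorm of g. *)
Lemma partialsM_bound j k N F M f g s x : smooth b f -> smooth b g -> 
  (forall s, (size s <= N)%N -> normc (partials b s f x) <= F * bracket x ^+ k) ->
  seminorm_le (j + k) N M g -> (size s <= N)%N ->
  bracket x ^+ j * normc (partials b s (fun y => f y * g y) x) <= 2 ^+ N * (F * M).
Proof.
move=> sf sg fF gM sN.
have gM' t : (size t <= N)%N -> normc (partials b t g x) <= M / bracket x ^+ (j + k).
  by move=> tN; rewrite ler_pdivlMr ?bracketX_gt0// mulrC gM.
have := Leibniz_bound sN sf sg fF gM'.
rewrite -(ler_pM2l (bracketX_gt0 x j)) => /le_trans; apply.
rewrite le_eqVlt; apply/orP; left; apply/eqP; rewrite exprD.
by field; rewrite !gt_eqF ?bracketX_gt0.
Qed.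

Lemma seminorm_leM j k N F M f g : smooth b f -> smooth b g ->
  (forall s x, (size s <= N)%N -> normc (partials b s f x) <= F * bracket x ^+ k) ->
  seminorm_le (j + k) N M g ->
  seminorm_le j N (2 ^+ N * (F * M)) (fun x => f x * g x).
Proof.
move=> sf sg fF gM s x sN.
by apply: (@partialsM_bound j k) => // t tN; exact: fF.
Qed.

Lemma temperedP (T : (V -> R[i]) -> R[i]) : tempered b bracket T <->
  linear_on (schwartz b bracket) T /\
  exists (C : R) N, 0 <= C /\ forall f M, schwartz b bracket f ->
    seminorm_le N N M f -> normc (T f) <= C * M.
Proof.
split=> -[linT]; last first.
  move=> [C [N [C0 HC]]]; split=> //; exists C, N => f Sf.
  by have [M HM ->] := seminorm_fin (Sf.2 N); rewrite -EFinM lee_fin; exact: HC.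
move=> [C [N HC]]; split=> //; exists `|C|, N; split=> // f M Sf fM.
have [M' HM' e] := seminorm_fin (Sf.2 N).
have := HC f Sf; rewrite e -EFinM lee_fin => /le_trans; apply.
have MM : M' <= M by rewrite -lee_fin -e; exact/seminormP.
apply: (@le_trans _ _ (`|C| * M')); last by rewrite ler_wpM2l.
by rewrite ler_wpM2r ?ler_norm// (seminorm_le_ge0 HM').
Qed.

Lemma schwartz_boundedP (B : set (V -> R[i])) : schwartz_bounded b bracket B <->
  B `<=` schwartz b bracket /\ forall N, exists M, forall f, B f -> seminorm_le N N M f.
Proof.
by split=> -[BS BN]; split=> // N; have [M HM] := BN N; exists M => f Bf;
  apply/seminormP; exact: HM.
Qed.

End Seminorms.

(** Over a finite alphabet only finitely many words have length at most N, and monotonicity allows a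
    maximum of their bounds. The induction strips the first letter. *)
Lemma bounded_words (I : finType) (P : seq I -> nat -> Prop) :
  (forall s n m, (n <= m)%N -> P s n -> P s m) -> (forall s, exists n, P s n) ->
  forall N, exists n, forall s, (size s <= N)%N -> P s n.
Proof.
move=> mono ex N; elim: N P mono ex => [|N IH] P mono ex.
  by have [n Hn] := ex [::]; exists n => s; rewrite leqn0 => /nilP ->.
have [n1 H1] := ex [::].
have [|s|n2 H2] := IH (fun s n => forall i, P (i :: s) n).
- by move=> s n m nm H i; exact: mono nm (H i).
- have [n Hn] := choice (fun i => ex (i :: s)).
  exists (\max_i n i)%N => i; apply: mono (Hn i); exact: leq_bigmax.
exists (maxn n1 n2) => -[_|i s sN].
  by apply: mono H1; exact: leq_maxl.
by apply: mono (H2 s _ i) => //; exact: leq_maxr.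
Qed.

(** * Oscillatory integrals *)

Section Bracket.
Context {R : realType} {d : nat}.
Local Notation Rd := 'rV[R]_d.
Implicit Types (x xi : Rd).

Lemma bracketRd_sqr x : bracketRd x ^+ 2 = 1 + \sum_(i < d) x 0 i ^+ 2.
Proof.
by rewrite sqr_sqrtr// addr_ge0// sumr_ge0// => i _; rewrite sqr_ge0.
Qed.

Lemma bracketRd_ge1 x : 1 <= bracketRd x.
Proof.
rewrite -[leLHS]sqrtr1 ler_wsqrtr// lerDl sumr_ge0// => i _; exact: sqr_ge0.
Qed.

Lemma coord_sqr_le x i : 1 + x 0 i ^+ 2 <= bracketRd x ^+ 2.
Proof.
rewrite bracketRd_sqr lerD2l (bigD1 i)//= lerDl sumr_ge0// => j _; exact: sqr_ge0.
Qed.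

Lemma coord_le_bracketRd x i : `|x 0 i| <= bracketRd x.
Proof.
have B0 : 0 <= bracketRd x by exact: le_trans (bracketRd_ge1 x).
rewrite -(@ler_pXn2r _ 2)// ?nnegrE// real_normK ?num_real//.
by apply: le_trans (coord_sqr_le x i); rewrite lerDr.
Qed.

Lemma bracketRd_continuous : continuous (@bracketRd R d).
Proof.
apply: (continuous_fun_comp (g := @Num.sqrt R) (f := fun x : Rd => 1 + \sum_(i < d) x 0 i ^+ 2)).
  by move=> t; exact: sqrt_continuous.
elim: (index_enum _) => [|i r IH].
  rewrite (_ : (fun _ => _) = fun=> 1); first exact: cst_continuous.
  by apply/funext => x; rewrite big_nil addr0.
rewrite (_ : (fun _ => _) = (fun x : Rd => x 0 i ^+ 2 + (1 + \sum_(j <- r) x 0 j ^+ 2))).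
  move=> x; apply: (@continuousD R R Rd (fun x : Rd => x 0 i ^+ 2)); last exact: IH.
  apply: (continuous_fun_comp (g := fun t : R => t ^+ 2) (f := fun x : Rd => x 0 i)).
    exact: exprn_continuous.
  exact: coord_continuous.
by apply/funext => x; rewrite big_cons addrCA.
Qed.

Lemma bracketRd_locally_bounded k x : exists C, \forall y \near x, bracketRd y ^+ k <= C.
Proof.
exists (bracketRd x ^+ k + 1).
have cB : continuous (fun y : Rd => bracketRd y ^+ k).
  apply: (continuous_fun_comp (g := fun t : R => t ^+ k)); first exact: exprn_continuous.
  exact: bracketRd_continuous.
have /cvgrPdist_lt/(_ _ ltr01) := cB x.
by apply: filterS => y; rewrite ltr_distlC => /andP[_ /ltW].
Qed.

(** The power 2d splits into d factors, the i-th of which is at least 1 + x_i^2. Hence the order 2d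
    of decay asked for in the later seminorms: it ensures domination by the weight. *)
Lemma bracketRd_spaceW x : 1 <= bracketRd x ^+ (2 * d) * spaceW x.
Proof.
rewrite (_ : bracketRd x ^+ (2 * d) = \prod_(i < d) bracketRd x ^+ 2); last first.
  by rewrite prodr_const card_ord exprM.
rewrite -big_split/=.
apply: (big_ind (fun y : R => 1 <= y)) => // [|i _]; first by move=> a c; exact: mulr_ege1.
by rewrite ler_pdivlMr ?mul1r ?coord_sqr_le// ltr_pwDl ?sqr_ge0.
Qed.

Lemma bracketRd_dominated (y M : R) x : 0 <= y ->
  bracketRd x ^+ (2 * d) * y <= M -> y <= M * spaceW x.
Proof.
move=> y0 yM; apply: (@le_trans _ _ (bracketRd x ^+ (2 * d) * spaceW x * y)).
  by rewrite ler_peMl// bracketRd_spaceW.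
by rewrite mulrAC ler_wpM2r// ltW// (weight_gt0 (space_integrator d)).
Qed.

(** The bracket is at most (d+1) max(1, |x|) and the sup norm is attained at a coordinate. Decay can
    thus be tested coordinate by coordinate, the form in which integration by parts supplies it. *)
Lemma bracketRd_le_coords k x (y B : R) : 0 <= y -> y <= B ->
  (forall i, `|x 0 i| ^+ k * y <= B) -> bracketRd x ^+ k * y <= d.+1%:R ^+ k * B.
Proof.
move=> y0 yB xB; pose m := Num.max 1 `|x|.
have m1 : 1 <= m by rewrite le_max lexx.
have m0 : 0 <= m by exact: le_trans m1.
have xm i : `|x 0 i| <= m.
  rewrite le_max; apply/orP; right.
  rewrite [leRHS]/Num.Def.normr/= mx_normrE.
  exact: (le_bigmax _ (fun ij : 'I_1 * 'I_d => `|x ij.1 ij.2|) (0, i)).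
have bm : bracketRd x <= d.+1%:R * m.
  rewrite -(@ler_pXn2r _ 2)// ?nnegrE ?mulr_ge0 ?(le_trans _ (bracketRd_ge1 x))//.
  rewrite bracketRd_sqr exprMn.
  apply: (@le_trans _ _ (d.+1%:R * m ^+ 2)); last first.
    by rewrite ler_wpM2r ?exprn_ge0// expr2 ler_peMl// ler1n.
  rewrite (_ : d.+1%:R * m ^+ 2 = m ^+ 2 + \sum_(i < d) m ^+ 2); last first.
    by rewrite sumr_const card_ord mulr_natl mulrS.
  rewrite lerD ?exprn_ege1// ler_sum// => i _.
  by rewrite -(real_normK (num_real _)) ler_pXn2r ?nnegrE.
apply: (@le_trans _ _ (d.+1%:R ^+ k * (m ^+ k * y))).
  rewrite mulrA -exprMn ler_wpM2r// lerXn2r ?nnegrE ?mulr_ge0//.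
  exact: le_trans (bracketRd_ge1 x).
rewrite ler_wpM2l ?exprn_ge0// /m.
have [x1|x1] := leP `|x| 1; first by rewrite expr1n mul1r.
have x0 : mx_norm x != 0 by rewrite gt_eqF// (lt_trans _ x1).
have [[i j] /= e] := mx_norm_neq0 x0; rewrite (ord1 i) in e.
by rewrite [`|x|]e; exact: xB.
Qed.

End Bracket.

(** * Plane waves *)

Section Wave.
Context {R : realType} {d : nat}.
Local Notation Rd := 'rV[R]_d.
Implicit Types (x xi : Rd).

Definition wave (sigma : R) (p : Rd * Rd) : R[i] :=
  cexp ('i * (sigma * dot p.1 p.2)%:C).

Lemma cexp_iE (r : R) : cexp ('i * r%:C) = cos r +i* sin r.
Proof.
rewrite /cexp.
have -> : complex.Re ('i * r%:C) = 0 by rewrite /=; ring.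
have -> : complex.Im ('i * r%:C) = r by rewrite /=; ring.
by rewrite expR0 mul1r.
Qed.

Lemma normc_cexp_i (r : R) : normc (cexp ('i * r%:C)) = 1.
Proof. by rewrite cexp_iE /= cos2Dsin2 sqrtr1. Qed.

Lemma normc_wave sigma p : normc (wave sigma p) = 1.
Proof. exact: normc_cexp_i. Qed.

Lemma dotC x xi : dot x xi = dot xi x.
Proof. by apply: eq_bigr => i _; rewrite mulrC. Qed.

Lemma dot_shift x xi h i : dot x (h *: dirRd i + xi) = h * x 0 i + dot x xi.
Proof.
rewrite /dot (eq_bigr (fun j => h * (x 0 j * (j == i)%:R) + x 0 j * xi 0 j)).
  rewrite big_split/= -mulr_sumr (bigD1 i)//= eqxx mulr1 big1 ?addr0// => j /negPf ->.
  by rewrite mulr0.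
by move=> j _; rewrite add_dirRdE mulrDr mulrCA.
Qed.

Lemma wave_swap sigma x xi : wave sigma (x, xi) = wave sigma (xi, x).
Proof. by rewrite /wave/= dotC. Qed.

Lemma dot_continuous : continuous (fun p : Rd * Rd => dot p.1 p.2).
Proof.
rewrite /dot; elim: (index_enum _) => [|i r IH].
  rewrite (_ : (fun _ => _) = fun=> 0); first exact: cst_continuous.
  by apply/funext => x; rewrite big_nil.
rewrite (_ : (fun _ => _) = (fun p : Rd * Rd => p.1 0 i * p.2 0 i +
    \sum_(j <- r) p.1 0 j * p.2 0 j)).
  move=> p; apply: (@continuousD R R (Rd * Rd)%type (fun p => p.1 0 i * p.2 0 i));
    last exact: IH.
  apply: (@continuousM R (Rd * Rd)%type (fun p => p.1 0 i) (fun p => p.2 0 i)).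
    apply: (continuous_fun_comp (g := fun x : Rd => x 0 i) (f := fst)).
      exact: coord_continuous.
    by move=> q; exact: cvg_fst.
  apply: (continuous_fun_comp (g := fun x : Rd => x 0 i) (f := snd)).
    exact: coord_continuous.
  by move=> q; exact: cvg_snd.
by apply/funext => x; rewrite big_cons.
Qed.

Lemma wave_continuous sigma : ccontinuous (wave sigma).
Proof.
have cl : continuous (fun p : Rd * Rd => sigma * dot p.1 p.2).
  move=> p; apply: (@continuousM R (Rd * Rd)%type (fun=> sigma)).
    exact: cst_continuous.
  exact: dot_continuous.
split.
  rewrite (_ : (fun _ => _) = fun p => cos (sigma * dot p.1 p.2)).
    by apply: (continuous_fun_comp (g := @cos R)) => //; exact: continuous_cos.
  by apply/funext => p; rewrite /wave cexp_iE.
rewrite (_ : (fun _ => _) = fun p => sin (sigma * dot p.1 p.2)).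
  by apply: (continuous_fun_comp (g := @sin R)) => //; exact: continuous_sin.
by apply/funext => p; rewrite /wave cexp_iE.
Qed.

Lemma is_derive_affine (V : normedModType R) (L : V -> R) (y v : V) (c : R) :
  (forall h y, L (h *: v + y) = h * c + L y) -> is_derive y v L c.
Proof.
move=> hL; apply: is_derive_lim.
rewrite (_ : (fun _ => _) = fun h => h^-1 * (h * c)); last first.
  by apply/funext => h; rewrite hL addrK.
apply: (cvg_trans (G := (fun=> c) @ (0 : R)^')); last exact: cvg_cst.
apply: near_eq_cvg; near=> h.
have h0 : h != 0 by near: h; exact: nbhs_dnbhs_neq.
by rewrite mulrA mulVf// mul1r.
Unshelve. all: by end_near. Qed.

Lemma cexp_i_cderive (V : normedModType R) (L : V -> R) (y v : V) (c : R) :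
  (forall h y, L (h *: v + y) = h * c + L y) ->
  is_cderive (fun y => cexp ('i * (L y)%:C)) y v ('i * c%:C * cexp ('i * (L y)%:C)).
Proof.
move=> hL.
have hphi (t h : R) : (h *: 1 + t) *: v + y = h *: v + (t *: v + y).
  by rewrite scaler1 scalerDl addrA.
suff : is_cderive (fun y => cexp ('i * (L y)%:C)) (0 *: v + y) v
    ('i * c%:C * cexp ('i * (L (0 *: v + y))%:C)).
  by rewrite scale0r add0r.
apply/(@is_cderive_shift _ _ _ (fun t : R => t *: v + y)
  (fun y => cexp ('i * (L y)%:C)) 0 1 v); first by move=> h; exact: hphi.
have dl : is_derive (0 : R) 1 (fun t : R => t * c + L y) c.
  by apply: is_derive_affine => h t; rewrite scaler1 mulrDl addrA.
have e : (fun t : R => t * c + L y) 0 = L y by rewrite mul0r add0r.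
rewrite cexp_iE scale0r add0r; split.
  rewrite (_ : (fun _ => _) = cos \o (fun t => t * c + L y)).
    have := is_derive1_comp (is_derive_cos ((fun t : R => t * c + L y) 0)) dl.
    by rewrite e => H; apply: (is_derive_eq H); rewrite /GRing.scale/=; ring.
  by apply/funext => t; rewrite cexp_iE /= hL.
rewrite (_ : (fun _ => _) = sin \o (fun t => t * c + L y)).
  have := is_derive1_comp (is_derive_sin ((fun t : R => t * c + L y) 0)) dl.
  by rewrite e => H; apply: (is_derive_eq H); rewrite /GRing.scale/=; ring.
by apply/funext => t; rewrite cexp_iE /= hL.
Qed.

Lemma wave_cderive2 sigma x xi j :
  is_cderive (fun xi => wave sigma (x, xi)) xi (dirRd j)
    ('i * (sigma * x 0 j)%:C * wave sigma (x, xi)).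
Proof.
apply: (@cexp_i_cderive _ (fun xi => sigma * dot x xi)) => h y.
by rewrite dot_shift; ring.
Qed.

Lemma wave_cderive1 sigma x xi j :
  is_cderive (fun x => wave sigma (x, xi)) x (dirRd j)
    ('i * (sigma * xi 0 j)%:C * wave sigma (x, xi)).
Proof.
rewrite wave_swap (_ : (fun x => _) = fun x => wave sigma (xi, x)).
  exact: wave_cderive2.
by apply/funext => y; rewrite wave_swap.
Qed.

End Wave.

(** * Amplitudes of polynomial growth and integration by parts *)

Section Amplitudes.
Context {R : realType} {d : nat}.
Local Notation Rd := 'rV[R]_d.
Local Notation bR := (@dirRd R d).
Local Notation bRR := (@dirRdRd R d).
Local Notation snorm := (seminorm_le bR (@bracketRd R d)).
Implicit Types (x xi : Rd) (A : Rd -> Rd -> R[i]) (v h : Rd -> R[i]) (M : nat).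

(** Covers both symbol classes, at the price of a polynomial growth that does
    not improve under differentiation. *)
Definition amplitude M A : Prop := symbol_smooth A /\
  forall alpha beta, exists n : nat, forall x xi,
    normc (partials_xxi alpha beta A x xi) <=
    n%:R * bracketRd x ^+ M * bracketRd xi ^+ M.

Definition dxi (j : 'I_d) A : Rd -> Rd -> R[i] := fun x xi =>
  cpartial bRR (inr j) (fun p => A p.1 p.2) (x, xi).

Lemma uncurry_dxi j A : (fun p : Rd * Rd => dxi j A p.1 p.2) =
  cpartial bRR (inr j) (fun p => A p.1 p.2).
Proof. by apply/funext => -[]. Qed.

(** The new letter lands at the right end of [beta], so the derivatives of [dxi j A] to be bounded
    are again of the form controlled by [partials_xxi]. *)
Lemma amplitude_dxi M j A : amplitude M A -> amplitude M (dxi j A).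
Proof.
move=> [sA hA]; split; first by rewrite /symbol_smooth uncurry_dxi; exact: smooth_cpartial.
move=> alpha beta; have [n Hn] := hA alpha (rcons beta j); exists n => x xi.
have := Hn x xi; rewrite /partials_xxi uncurry_dxi map_rcons -rcons_cat.
by rewrite (partials_rcons bRR).
Qed.

(** The constant amplitude makes the Fourier transform a case of the general oscillatory
    integral. *)
Lemma amplitude_cst1 : amplitude 0 (fun _ _ => 1).
Proof.
split; first exact: smooth_cst.
move=> alpha beta; exists 1%N => x xi; rewrite !expr0 !mulr1 /partials_xxi.
elim/last_ind: (map _ alpha ++ _) => [|s i IH]; first by rewrite normc_one.
rewrite (partials_rcons bRR) cpartial_cst.
have -> : (fun _ : Rd * Rd => 0 : R[i]) = fun p => 0 * (fun=> 1 : R[i]) p.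
  by apply/funext => p; rewrite mul0r.
by rewrite (partialsZ _ _ (smooth_cst _ _)) mul0r normc_zero.
Qed.

(** Brackets are at least 1, so a power of exponent t - k with |t| <= M is at most the M-th power. M
    is an integer above |m| and |mu|; a bound without a factor in x is weakened by inserting one. *)
Lemma amplitude_symbol m mu A : Hormander_symbol mu A \/ SG_symbol m mu A ->
  exists M, amplitude M A.
Proof.
have powle (b t : R) (M k : nat) : 1 <= b -> `|t| <= M%:R -> b `^ (t - k%:R) <= b ^+ M.
  move=> b1 tM; rewrite -powR_mulrn ?(le_trans _ b1)//; apply: ler_powR => //.
  by rewrite (le_trans _ tM)// lerBlDr (le_trans (ler_norm t))// lerDl.
have arch (t : R) : exists n : nat, `|t| <= n%:R.
  by exists (Num.Def.archi_bound `|t|); apply/ltW/archi_boundP.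
have [M1 H1] := arch mu; have [M2 H2] := arch m.
pose M := maxn M1 M2.
have muM : `|mu| <= M%:R by rewrite (le_trans H1)// ler_nat leq_maxl.
have mM : `|m| <= M%:R by rewrite (le_trans H2)// ler_nat leq_maxr.
case=> -[sA hA]; exists M; split=> // alpha beta;
    have [C [C0 HC]] := hA alpha beta; have [n Hn] := arch C; exists n => x xi;
    rewrite (le_trans (HC x xi))//.
  have Cn : C <= n%:R by rewrite (le_trans (ler_norm _)).
  apply: ler_pM; [exact: ltW|exact: powR_ge0| |exact: powle (bracketRd_ge1 _) _].
  by rewrite (le_trans Cn)// ler_peMr// exprn_ege1// bracketRd_ge1.
have Cn : C <= n%:R by rewrite (le_trans (ler_norm _)).
apply: ler_pM; [by rewrite mulr_ge0 ?powR_ge0// ltW|exact: powR_ge0| |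
  exact: powle (bracketRd_ge1 _) _].
by apply: ler_pM; [exact: ltW|exact: powR_ge0|exact: Cn|exact: powle (bracketRd_ge1 _) _].
Qed.

Lemma slice_cderive (B : Rd * Rd -> R[i]) x xi i : smooth bRR B ->
  is_cderive (fun x => B (x, xi)) x (bR i) (cpartial bRR (inl i) B (x, xi)).
Proof.
move=> /(@smooth_derivable _ _ _ bRR) => /(_ (x, xi) (inl i)).
move/(@is_cderive_shift _ _ _ (fun x : Rd => (x, xi)) B x (bR i)); apply.
by move=> h; congr pair; rewrite /= scaler0 add0r.
Qed.

Lemma slice_Ck n (B : Rd * Rd -> R[i]) xi : smooth bRR B -> Ck bR n (fun x => B (x, xi)).
Proof.
elim: n B => [|n IH] B sB; have cB : ccontinuous (fun x => B (x, xi)).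
- apply: (ccontinuous_comp (phi := fun x => (x, xi)) (smooth_continuous sB)).
  by apply: continuous_pair; [move=> x; exact: cvg_id|exact: cst_continuous].
- by [].
- apply: (ccontinuous_comp (phi := fun x => (x, xi)) (smooth_continuous sB)).
  by apply: continuous_pair; [move=> x; exact: cvg_id|exact: cst_continuous].
split=> //; split=> [x i|i].
  by have /is_cderiveP[] := slice_cderive x xi i sB.
rewrite (cpartial_cderive (fun x => slice_cderive x xi i sB)).
by apply: IH; exact: smooth_cpartial.
Qed.

Lemma slice_smooth (B : Rd * Rd -> R[i]) xi : smooth bRR B -> smooth bR (fun x => B (x, xi)).
Proof. by move=> sB; apply/smooth_Ck => n; exact: slice_Ck. Qed.

Lemma slice_partials (B : Rd * Rd -> R[i]) xi s : smooth bRR B ->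
  partials bR s (fun x => B (x, xi)) = fun x => partials bRR (map inl s) B (x, xi).
Proof.
elim/last_ind: s B => [|s i IH] B sB; first by [].
rewrite (partials_rcons bR) (cpartial_cderive (fun x => slice_cderive x xi i sB)).
by rewrite (IH _ (smooth_cpartial (inl i) sB)) map_rcons (partials_rcons bRR _ (inl i)).
Qed.

Lemma amplitude_slice_bound M A N : amplitude M A -> exists n : nat, forall xi s x,
  (size s <= N)%N -> normc (partials bR s (fun x => A x xi) x) <=
  (n%:R * bracketRd xi ^+ M) * bracketRd x ^+ M.
Proof.
move=> [sA hA].
have [|s|n Hn] := @bounded_words _ (fun s n => forall x xi,
    normc (partials_xxi s [::] A x xi) <= n%:R * bracketRd x ^+ M * bracketRd xi ^+ M) _ _ N.
- move=> s n m nm H x xi; apply: (le_trans (H x xi)).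
  by rewrite !ler_wpM2r ?exprn_ge0 ?(le_trans _ (bracketRd_ge1 _))// ler_nat.
- exact: hA.
exists n => xi s x sN; have := Hn s sN x xi.
by rewrite /partials_xxi/= cats0 (slice_partials xi s sA) mulrAC.
Qed.

Lemma amplitude_smooth M A xi : amplitude M A -> smooth bR (fun x => A x xi).
Proof. by move=> [sA _]; exact: (slice_smooth xi sA). Qed.

(** What integration by parts in the integrated variable consumes, to any order: the property passes
    to derivatives. *)
Definition tame h : Prop := smooth bR h /\
  forall s, exists C, forall x, normc (partials bR s h x) <= C * spaceW x.

Lemma tame_partials s h : tame h -> tame (partials bR s h).
Proof.
move=> [sh hh]; split; first exact: smooth_partials.
by move=> t; have [C HC] := hh (t ++ s); exists C; move: HC; rewrite /partials foldr_cat.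
Qed.

Lemma snorm_dominated N (C : R) s h x : snorm (2 * d) N C h -> (size s <= N)%N ->
  normc (partials bR s h x) <= C * spaceW x.
Proof. by move=> hC sN; apply: bracketRd_dominated; [exact: normc_ge0|exact: hC]. Qed.

(** The growth of A in x is absorbed by M further powers of the bracket on v, while its growth in xi
    is kept as an explicit factor. *)
Lemma amplitude_mul_bound M A N : amplitude M A -> exists n : nat,
  forall xi v C, smooth bR v -> snorm (2 * d + M) N C v ->
  snorm (2 * d) N (n%:R * bracketRd xi ^+ M * C) (fun x => A x xi * v x).
Proof.
move=> hA; have [n Hn] := amplitude_slice_bound N hA.
exists (2 ^ N * n)%N => xi v C sv vC.
have := seminorm_leM (@bracketRd_ge1 R d) (amplitude_smooth xi hA) sv (Hn xi) vC.
by rewrite !mulrA -natrX -natrM.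
Qed.

Lemma schwartz_snorm v N : SRd R d v -> exists C, snorm N N C v.
Proof. by move=> /(schwartzP _ (@bracketRd_ge1 R d))[_]; exact. Qed.

Lemma schwartz_snorm2 v k N : SRd R d v -> exists C, snorm k N C v.
Proof.
move=> /(schwartz_snorm (maxn k N))[C HC]; exists C.
by apply: seminorm_leW HC; rewrite ?leq_maxl ?leq_maxr//; exact: bracketRd_ge1.
Qed.

Lemma amplitude_tame M A v xi : amplitude M A -> SRd R d v ->
  tame (fun x => A x xi * v x).
Proof.
move=> hA Sv; have sv := schwartz_smooth Sv.
split; first exact: (smoothM (amplitude_smooth xi hA) sv).
move=> s; have [n Hn] := amplitude_mul_bound (size s) hA.
have [C HC] := schwartz_snorm2 (2 * d + M) (size s) Sv.
exists (n%:R * bracketRd xi ^+ M * C) => x.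
by apply: (@snorm_dominated (size s)) => //; exact: Hn.
Qed.

Lemma schwartz_tame v : SRd R d v -> tame v.
Proof.
move=> Sv; split; first exact: schwartz_smooth Sv.
move=> s; have [C HC] := schwartz_snorm2 (2 * d) (size s) Sv.
by exists C => x; exact: (snorm_dominated x HC).
Qed.

Definition waveI (sigma : R) h xi := integralRd (fun x => wave sigma (x, xi) * h x).

Lemma wave_slice_continuous sigma xi : ccontinuous (fun x => wave sigma (x, xi)).
Proof.
apply: (ccontinuous_comp (phi := fun x => (x, xi)) (wave_continuous sigma)).
by apply: continuous_pair; [move=> x; exact: cvg_id|exact: cst_continuous].
Qed.

Lemma normc_waveM sigma (p : Rd * Rd) z : normc (wave sigma p * z) = normc z.
Proof. by rewrite normcM normc_wave mul1r. Qed.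

Lemma waveI_bound (sigma : R) : exists2 K : R, 0 <= K & forall h C xi,
  ccontinuous h -> (forall x, normc (h x) <= C * spaceW x) ->
  normc (waveI sigma h xi) <= K * C.
Proof.
have [K K0 HK] := integralRd_bound (R := R) d; exists K => // h C xi ch hC.
apply: HK; first by apply: ccontinuousM => //; exact: wave_slice_continuous.
by move=> x; rewrite normc_waveM.
Qed.

(** With c = i sigma xi_j, of modulus |xi_j|, the sum of c times the first integral and of the
    second one is the integral of the j-th derivative of the wave times h, hence 0. *)
Lemma waveI_by_parts (sigma : R) h xi j : `|sigma| = 1 -> tame h ->
  `|xi 0 j| * normc (waveI sigma h xi) = normc (waveI sigma (cpartial bR j h) xi).
Proof.
move=> s1 [sh hh]; have [C HC] := hh [::]; have [D HD] := hh [:: j].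
have cw := wave_slice_continuous sigma xi.
have ch := smooth_continuous sh; have cdh := smooth_continuous (smooth_cpartial j sh).
pose c := 'i * (sigma * xi 0 j)%:C.
have nc : normc c = `|xi 0 j|.
  by rewrite normcM normc_real normrM s1 mul1r /= expr0n expr1n add0r sqrtr1 mul1r.
have c1 : ccontinuous (fun x => c * (wave sigma (x, xi) * h x)).
  exact: (ccontinuousM (ccontinuous_cst c) (ccontinuousM cw ch)).
have b1 x : normc (c * (wave sigma (x, xi) * h x)) <= normc c * C * spaceW x.
  by rewrite normcM normc_waveM -mulrA ler_wpM2l ?normc_ge0//; exact: HC.
have c2 : ccontinuous (fun x => wave sigma (x, xi) * cpartial bR j h x).
  exact: (ccontinuousM cw cdh).
have b2 x : normc (wave sigma (x, xi) * cpartial bR j h x) <= D * spaceW x.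
  by rewrite normc_waveM; exact: HD.
have /eqP : c * waveI sigma h xi + waveI sigma (cpartial bR j h) xi = 0.
  rewrite -(@integralRdZ _ _ c _ C); last 2 first.
  - exact: (ccontinuousM cw ch).
  - by move=> x; rewrite normc_waveM; exact: HC.
  rewrite -(integralRdD c1 c2 b1 b2).
  apply: (@integralRd_derive0 _ _ j (fun x => wave sigma (x, xi) * h x) _
    C (normc c * C + D)).
  - exact: (ccontinuousM cw ch).
  - exact: (ccontinuousD c1 c2).
  - move=> x; rewrite mulrA; apply: is_cderiveM; first exact: wave_cderive1.
    exact: smooth_derivable.
  - by move=> x; rewrite normc_waveM; exact: HC.
  - by move=> x; rewrite (le_trans (le_normcD _ _))// mulrDl lerD.
by rewrite addr_eq0 => /eqP e; rewrite -nc -normcM e normcN.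
Qed.

Lemma waveI_by_partsX (sigma : R) h xi j k : `|sigma| = 1 -> tame h ->
  `|xi 0 j| ^+ k * normc (waveI sigma h xi) =
  normc (waveI sigma (partials bR (nseq k j) h) xi).
Proof.
move=> s1 th; elim: k => [|k IH]; first by rewrite expr0 mul1r.
by rewrite exprS -mulrA IH (waveI_by_parts _ _ s1)//; exact: tame_partials.
Qed.

End Amplitudes.

(** * Oscillatory transforms of Schwartz functions *)

Section Transform.
Context {R : realType} {d : nat}.
Local Notation Rd := 'rV[R]_d.
Local Notation bR := (@dirRd R d).
Local Notation bRR := (@dirRdRd R d).
Local Notation snorm := (seminorm_le bR (@bracketRd R d)).
Implicit Types (x xi : Rd) (A : Rd -> Rd -> R[i]) (v h : Rd -> R[i]) (M : nat).
Variable sigma : R.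
Hypothesis sigma1 : `|sigma| = 1.

(** With [sigma] = -1 and A = 1 this is the Fourier transform; with [sigma] = 1 and A the symbol it
    is the inner integral of the transpose. One analysis serves both. *)
Definition transform A v xi := integralRd (fun x => wave sigma (x, xi) * A x xi * v x).

Lemma transformE A v xi : transform A v xi = waveI sigma (fun x => A x xi * v x) xi.
Proof. by congr integralRd; apply/funext => x; rewrite mulrA. Qed.

Lemma transform_decay M A k : amplitude M A -> exists n : nat, forall v C,
  SRd R d v -> snorm n n C v -> forall xi,
  bracketRd xi ^+ k * normc (transform A v xi) <= n%:R * C.
Proof.
move=> hA; have [K K0 HK] := waveI_bound (R := R) (d := d) sigma.
(* Of the N integrations by parts, k produce the required decay and M compensate the growth of A in
   xi. *)
pose N := (k + M)%N.
have [n Hn] := amplitude_mul_bound N hA.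
pose L := d.+1%:R ^+ N * (K * n%:R) : R.
(* The single number m has to exceed the power 2d + M of the bracket, the number N of derivatives
   and the constant L. *)
pose m := maxn (2 * d + M) (maxn N (Num.Def.archi_bound `|L|)).
exists m => v C Sv vC xi; have sv := schwartz_smooth Sv.
have C0 : 0 <= C by exact: (seminorm_le_ge0 (@bracketRd_ge1 R d) vC).
have vC' : snorm (2 * d + M) N C v.
  apply: seminorm_leW vC => //; first exact: bracketRd_ge1.
    exact: leq_maxl.
  by rewrite /m !leq_max leqnn orbT.
have bM : 0 < bracketRd xi ^+ M := bracketX_gt0 (@bracketRd_ge1 R d) xi M.
pose h x := A x xi * v x.
have th : tame h by exact: amplitude_tame hA Sv.
have hB s : (size s <= N)%N ->
    normc (waveI sigma (partials bR s h) xi) <= K * (n%:R * bracketRd xi ^+ M * C).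
  move=> sN; apply: HK.
    exact: (smooth_continuous (tame_partials s th).1).
  by move=> x; apply: (@snorm_dominated _ _ N) => //; exact: Hn.
have H := @bracketRd_le_coords R d N xi (normc (transform A v xi))
  (K * (n%:R * bracketRd xi ^+ M * C)) (normc_ge0 _).
have {}H : bracketRd xi ^+ N * normc (transform A v xi) <=
    d.+1%:R ^+ N * (K * (n%:R * bracketRd xi ^+ M * C)).
  apply: H; first by rewrite transformE; exact: (hB [::]).
  by move=> i; rewrite transformE waveI_by_partsX//; apply: hB; rewrite size_nseq.
apply: (@le_trans _ _ (L * C)); last first.
  rewrite ler_wpM2r// (le_trans (ler_norm _))//.
  rewrite (le_trans (ltW (archi_boundP (normr_ge0 L))))// ler_nat.
  by rewrite /m !leq_max leqnn !orbT.
rewrite -(ler_pM2l bM) mulrA -exprD addnC (le_trans H)// /L.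
by rewrite le_eqVlt; apply/orP; left; apply/eqP; ring.
Qed.

(** The factor brought down by differentiating the wave in xi_j. Attached to v rather than to A, it
    leaves the order M of the amplitude unchanged. *)
Definition mul_coord (j : 'I_d) v x := 'i * (sigma * x 0 j)%:C * v x.

Lemma coord_cderive j i x : is_cderive (fun x : Rd => 'i * (sigma * x 0 j)%:C) x (bR i)
  ('i * (sigma * (j == i)%:R)%:C).
Proof.
split.
  rewrite (_ : (fun _ => _) = fun=> 0); last by apply/funext => y /=; ring.
  by rewrite (_ : complex.Re _ = 0); [exact: is_derive_cst|rewrite /=; ring].
rewrite (_ : (fun _ => _) = fun y : Rd => sigma * y 0 j); last by apply/funext => y /=; ring.
rewrite (_ : complex.Im _ = sigma * (j == i)%:R); last by rewrite /=; ring.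
by apply: is_derive_affine => h y; rewrite add_dirRdE; ring.
Qed.

Lemma coord_smooth j : smooth bR (fun x => 'i * (sigma * x 0 j)%:C).
Proof.
have cc : ccontinuous (fun x : Rd => 'i * (sigma * x 0 j)%:C).
  split.
    rewrite (_ : (fun _ => _) = fun=> 0); last by apply/funext => y /=; ring.
    exact: cst_continuous.
  rewrite (_ : (fun _ => _) = fun y : Rd => sigma * y 0 j); last first.
    by apply/funext => y /=; ring.
  move=> x; apply: (@continuousM R Rd (fun=> sigma) (fun y : Rd => y 0 j)).
    exact: cst_continuous.
  exact: coord_continuous.
apply/smooth_Ck => -[|n]; first by split.
split=> //; split=> [x i|i]; first by have /is_cderiveP[] := coord_cderive j i x.
by rewrite (cpartial_cderive (coord_cderive j i)); exact: Ck_cst.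
Qed.

Lemma normc_i_mul (r : R) : normc ('i * r%:C) = `|r|.
Proof. by rewrite normcM normc_real /= expr0n expr1n add0r sqrtr1 mul1r. Qed.

Lemma coord_partials_le j s x :
  normc (partials bR s (fun x => 'i * (sigma * x 0 j)%:C) x) <= 1 * bracketRd x ^+ 1.
Proof.
rewrite mul1r expr1; case/lastP: s => [|s i].
  by rewrite -[partials _ _ _ _]/('i * (sigma * x 0 j)%:C) normc_i_mul normrM sigma1 mul1r coord_le_bracketRd.
rewrite (partials_rcons bR) (cpartial_cderive (coord_cderive j i)).
rewrite (le_trans (partials_cst _ _ _ _))// normc_i_mul normrM sigma1 mul1r.
by rewrite (le_trans _ (bracketRd_ge1 x))//; case: (j == i); rewrite ?normr1 ?normr0.
Qed.

Lemma mul_coord_bound j k N v C : smooth bR v -> snorm (k + 1) N C v ->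
  snorm k N (2 ^+ N * (1 * C)) (mul_coord j v).
Proof.
move=> sv vC; apply: (seminorm_leM (@bracketRd_ge1 R d) (coord_smooth j) sv _ vC).
by move=> s x _; exact: coord_partials_le.
Qed.

Lemma mul_coord_schwartz j v : SRd R d v -> SRd R d (mul_coord j v).
Proof.
move=> Sv; have sv := schwartz_smooth Sv.
apply/(schwartzP _ (@bracketRd_ge1 R d)); split; first exact: (smoothM (coord_smooth j) sv).
move=> N; have [C HC] := schwartz_snorm2 (N + 1) N Sv.
by exists (2 ^+ N * (1 * C)); exact: mul_coord_bound.
Qed.

Lemma kernel_continuous M A v : amplitude M A -> SRd R d v ->
  ccontinuous (fun p : Rd * Rd => wave sigma (p.2, p.1) * A p.2 p.1 * v p.2).
Proof.
move=> [sA _] Sv.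
have cs : continuous (fun p : Rd * Rd => (p.2, p.1)).
  by apply: continuous_pair => p; [exact: cvg_snd|exact: cvg_fst].
apply: ccontinuousM; first apply: ccontinuousM.
- exact: (ccontinuous_comp (phi := fun p : Rd * Rd => (p.2, p.1)) (wave_continuous sigma) cs).
- exact: (ccontinuous_comp (phi := fun p : Rd * Rd => (p.2, p.1)) (smooth_continuous sA) cs).
apply: (ccontinuous_comp (phi := snd) (smooth_continuous (schwartz_smooth Sv))).
by move=> p; exact: cvg_snd.
Qed.

Lemma kernel_dominated M A v : amplitude M A -> SRd R d v -> exists n : nat, exists C,
  forall xi x, normc (wave sigma (x, xi) * A x xi * v x) <=
    (n%:R * bracketRd xi ^+ M * C) * spaceW x.
Proof.
move=> hA Sv; have [n Hn] := amplitude_mul_bound 0 hA.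
have [C HC] := schwartz_snorm2 (2 * d + M) 0 Sv; exists n, C => xi x.
rewrite -mulrA normc_waveM.
exact: (@snorm_dominated _ _ 0 _ [::] _ x (Hn xi v C (schwartz_smooth Sv) HC)).
Qed.

Lemma kernel_locally_dominated M A v : amplitude M A -> SRd R d v ->
  clocally_dominated spaceW
    (fun p : Rd * Rd => wave sigma (p.2, p.1) * A p.2 p.1 * v p.2).
Proof.
move=> hA Sv xi; have [n [C HC]] := kernel_dominated hA Sv.
have [D HD] := bracketRd_locally_bounded M xi.
exists (n%:R * D * `|C|); apply: filterS HD => eta HD x /=.
rewrite (le_trans (HC eta x))// ler_wpM2r ?(ltW (weight_gt0 (space_integrator d) x))//.
apply: (@le_trans _ _ (n%:R * bracketRd eta ^+ M * `|C|)).
  by rewrite ler_wpM2l ?ler_norm// mulr_ge0// ltW// bracketX_gt0//; exact: bracketRd_ge1.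
by rewrite ler_wpM2r// ler_wpM2l.
Qed.

Lemma slice_kernel_continuous M A v xi : amplitude M A -> SRd R d v ->
  ccontinuous (fun x => wave sigma (x, xi) * A x xi * v x).
Proof.
move=> hA Sv; apply: (ccontinuous_comp (phi := fun x => (xi, x)) (kernel_continuous hA Sv)).
by apply: continuous_pair; [exact: cst_continuous|move=> x; exact: cvg_id].
Qed.

Lemma transform_continuous M A v : amplitude M A -> SRd R d v ->
  ccontinuous (transform A v).
Proof.
move=> hA Sv; exact: (integralRd_continuous (kernel_continuous hA Sv)
  (kernel_locally_dominated hA Sv)).
Qed.

Lemma clocally_dominatedD (F G : Rd * Rd -> R[i]) :
  clocally_dominated spaceW F -> clocally_dominated spaceW G ->
  clocally_dominated spaceW (fun p => F p + G p).
Proof.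
move=> lF lG p; have [C HC] := lF p; have [D HD] := lG p; exists (C + D).
apply: filterS2 HC HD => q HC HD x.
by rewrite (le_trans (le_normcD _ _))// mulrDl lerD.
Qed.

(** The derivative is a sum of two transforms of the same kind and order, which is what makes
    smoothness and decay provable by induction. *)
Lemma transform_cderive M A v xi j : amplitude M A -> SRd R d v ->
  is_cderive (transform A v) xi (bR j)
    (transform (dxi j A) v xi + transform A (mul_coord j v) xi).
Proof.
move=> hA Sv.
have hdA := amplitude_dxi j hA; have Sjv := mul_coord_schwartz j Sv.
have [n [C HC]] := kernel_dominated hdA Sv.
have [n' [C' HC']] := kernel_dominated hA Sjv.
rewrite -(integralRdD (slice_kernel_continuous xi hdA Sv)
  (slice_kernel_continuous xi hA Sjv) (HC xi) (HC' xi)).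
apply: (@integralRd_derive _ _ _
  (fun p : Rd * Rd => wave sigma (p.2, p.1) * A p.2 p.1 * v p.2)
  (fun p : Rd * Rd => wave sigma (p.2, p.1) * dxi j A p.2 p.1 * v p.2 +
     wave sigma (p.2, p.1) * A p.2 p.1 * mul_coord j v p.2)).
- exact: kernel_continuous hA Sv.
- exact: ccontinuousD (kernel_continuous hdA Sv) (kernel_continuous hA Sjv).
- exact: kernel_locally_dominated hA Sv.
- exact: clocally_dominatedD (kernel_locally_dominated hdA Sv)
    (kernel_locally_dominated hA Sjv).
move=> eta x /=.
have dA : is_cderive (fun eta => A x eta) eta (bR j) (dxi j A x eta).
  have [sA _] := hA; have := @smooth_derivable _ _ _ bRR _ (x, eta) (inr j) sA.
  move/(@is_cderive_shift _ _ _ (fun eta : Rd => (x, eta)) _ eta (bR j)); apply.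
  by move=> h; congr pair; rewrite /= scaler0 add0r.
have := is_cderiveM (is_cderiveM (wave_cderive2 sigma x eta j) dA)
  (is_cderive_cst (v x) eta (bR j)).
rewrite mulr0 addr0 => H.
by rewrite (_ : _ + _ = ('i * (sigma * x 0 j)%:C * wave sigma (x, eta) * A x eta +
  wave sigma (x, eta) * dxi j A x eta) * v x)// /mul_coord; ring.
Qed.

Lemma transform_smooth M A v : amplitude M A -> SRd R d v -> smooth bR (transform A v).
Proof.
move=> hA Sv; apply/smooth_Ck => n.
elim: n A v hA Sv => [|n IH] A v hA Sv.
  by split=> //; exact: transform_continuous hA Sv.
split; first exact: transform_continuous hA Sv.
have H xi j := transform_cderive xi j hA Sv.
split=> [xi j|j]; first by have /is_cderiveP[] := H xi j.
rewrite (cpartial_cderive (H ^~ j)); apply: CkD; apply: IH => //.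
  exact: amplitude_dxi.
exact: mul_coord_schwartz.
Qed.

Lemma transform_partials_decay M A s k : amplitude M A -> exists n : nat, forall v C,
  SRd R d v -> snorm n n C v -> forall xi,
  bracketRd xi ^+ k * normc (partials bR s (transform A v) xi) <= n%:R * C.
Proof.
elim/last_ind: s A => [|s j IH] A hA; first exact: (transform_decay k hA).
have hdA := amplitude_dxi j hA.
have [n1 H1] := IH _ hdA; have [n2 H2] := IH _ hA.
(* The number n1 serves the first term. For the second, multiplication by a coordinate costs one
   power of the bracket, n2 + 1 instead of n2, and a Leibniz factor 2^n2; the product covers
   both. *)
exists (n1 + n2.+1 * 2 ^ n2)%N => v C Sv vC xi.
have Sjv := mul_coord_schwartz j Sv.
have C0 : 0 <= C by exact: (seminorm_le_ge0 (@bracketRd_ge1 R d) vC).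
rewrite (partials_rcons bR) (cpartial_cderive (fun xi => transform_cderive xi j hA Sv)).
rewrite (partialsD _ (transform_smooth hdA Sv) (transform_smooth hA Sjv)).
have b0 : 0 <= bracketRd xi ^+ k by rewrite ltW// bracketX_gt0//; exact: bracketRd_ge1.
apply: (le_trans (ler_wpM2l b0 (le_normcD _ _))).
have n2l : (n2.+1 <= n2.+1 * 2 ^ n2)%N by rewrite leq_pmulr// expn_gt0.
rewrite mulrDr natrD mulrDl; apply: lerD.
  apply: H1 => //; apply: seminorm_leW vC => //; first exact: bracketRd_ge1.
    exact: leq_addr.
  exact: leq_addr.
have vC' : snorm (n2 + 1) n2 C v.
  apply: seminorm_leW vC => //; first exact: bracketRd_ge1.
    by rewrite addn1 (leq_trans n2l)// leq_addl.
  by rewrite (leq_trans (leqnSn n2))// (leq_trans n2l)// leq_addl.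
apply: (le_trans (H2 _ _ Sjv (mul_coord_bound j (schwartz_smooth Sv) vC') xi)).
rewrite mul1r mulrA -natrX -natrM ler_wpM2r// ler_nat.
by rewrite leq_mul2r leqnSn orbT.
Qed.

Lemma transform_bound M A N : amplitude M A -> exists n : nat, forall v C,
  SRd R d v -> snorm n n C v -> snorm N N (n%:R * C) (transform A v).
Proof.
move=> hA.
have [||n Hn] := @bounded_words _ (fun s n => forall v C, SRd R d v -> snorm n n C v ->
  forall xi, bracketRd xi ^+ N * normc (partials bR s (transform A v) xi) <= n%:R * C) _ _ N.
- move=> s n m nm H v C Sv vC xi.
  have C0 : 0 <= C by exact: (seminorm_le_ge0 (@bracketRd_ge1 R d) vC).
  apply: (@le_trans _ _ (n%:R * C)); last by rewrite ler_wpM2r// ler_nat.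
  by apply: H => //; apply: seminorm_leW vC => //; exact: bracketRd_ge1.
- by move=> s; exact: transform_partials_decay hA.
by exists n => v C Sv vC s xi sN; exact: (Hn s sN v C Sv vC xi).
Qed.

Lemma transform_schwartz M A v : amplitude M A -> SRd R d v -> SRd R d (transform A v).
Proof.
move=> hA Sv; apply/(schwartzP _ (@bracketRd_ge1 R d)); split.
  exact: transform_smooth hA Sv.
move=> N; have [n Hn] := transform_bound N hA.
by have [C HC] := schwartz_snorm n Sv; exists (n%:R * C); exact: Hn.
Qed.

End Transform.

(** * The transpose of a pseudo-differential operator *)

Section Transpose.
Context {R : realType} {d : nat}.
Local Notation Rd := 'rV[R]_d.
Local Notation bR := (@dirRd R d).
Local Notation bRR := (@dirRdRd R d).
Local Notation snorm := (seminorm_le bR (@bracketRd R d)).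
Implicit Types (x xi : Rd) (A : Rd -> Rd -> R[i]) (v w f g h : Rd -> R[i]) (M : nat).

Lemma schwartz_weight_bound v M : SRd R d v -> exists2 C, 0 <= C &
  forall x, bracketRd x ^+ M * normc (v x) <= C * spaceW x.
Proof.
move=> Sv; have [C HC] := schwartz_snorm2 (2 * d + M) 0 Sv; exists C.
  exact: (seminorm_le_ge0 (@bracketRd_ge1 R d) HC).
move=> x; apply: bracketRd_dominated.
  by rewrite mulr_ge0 ?normc_ge0// ltW// bracketX_gt0//; exact: bracketRd_ge1.
by rewrite mulrA -exprD; exact: (HC [::]).
Qed.

(** The polynomial growth of K in either variable is absorbed by the decay of f and g, so the double
    integrand is dominated by the product weight. *)
Lemma pairing_Fubini (K : Rd * Rd -> R[i]) M (n : nat) f g :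
  ccontinuous K ->
  (forall x xi, normc (K (x, xi)) <= n%:R * bracketRd x ^+ M * bracketRd xi ^+ M) ->
  SRd R d f -> SRd R d g ->
  integralRd (fun x => integralRd (fun xi => K (x, xi) * f xi) * g x) =
  integralRd (fun xi => f xi * integralRd (fun x => K (x, xi) * g x)).
Proof.
move=> cK Kn Sf Sg.
have [C C0 HC] := schwartz_weight_bound M Sf.
have [D D0 HD] := schwartz_weight_bound M Sg.
have cf := smooth_continuous (schwartz_smooth Sf).
have cg := smooth_continuous (schwartz_smooth Sg).
have b0 x : 0 <= bracketRd x ^+ M.
  by rewrite ltW// bracketX_gt0//; exact: bracketRd_ge1.
have cK1 x : ccontinuous (fun xi => K (x, xi) * f xi).
  apply: ccontinuousM cf; apply: (ccontinuous_comp (phi := fun xi => (x, xi)) cK).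
  by apply: continuous_pair; [exact: cst_continuous|move=> y; exact: cvg_id].
have cK2 xi : ccontinuous (fun x => K (x, xi) * g x).
  apply: ccontinuousM cg; apply: (ccontinuous_comp (phi := fun x => (x, xi)) cK).
  by apply: continuous_pair; [move=> y; exact: cvg_id|exact: cst_continuous].
have d1 x xi : normc (K (x, xi) * f xi) <= (n%:R * bracketRd x ^+ M * C) * spaceW xi.
  rewrite normcM; apply: (le_trans (ler_wpM2r (normc_ge0 _) (Kn x xi))).
  by rewrite -!mulrA ler_wpM2l// ler_wpM2l.
have d2 xi x : normc (K (x, xi) * g x) <= (n%:R * bracketRd xi ^+ M * D) * spaceW x.
  rewrite normcM; apply: (le_trans (ler_wpM2r (normc_ge0 _) (Kn x xi))).
  rewrite (mulrAC n%:R) -!mulrA ler_wpM2l// ler_wpM2l//.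
transitivity (integralRd (fun x => integralRd (fun xi => g x * (K (x, xi) * f xi)))).
  by congr integralRd; apply/funext => x; rewrite mulrC (integralRdZ _ (cK1 x) (d1 x)).
rewrite (integralRd_Fubini (F := fun p => g p.1 * (K p * f p.2)) (C := n%:R * D * C)).
- congr integralRd; apply/funext => xi.
  rewrite -(integralRdZ _ (cK2 xi) (d2 xi)); congr integralRd.
  by apply/funext => x /=; ring.
- apply: ccontinuousM; last apply: ccontinuousM => //.
    by apply: (ccontinuous_comp (phi := fst) cg) => p; exact: cvg_fst.
  by apply: (ccontinuous_comp (phi := snd) cf) => p; exact: cvg_snd.
move=> x xi /=; rewrite !normcM.
apply: (@le_trans _ _ (n%:R * ((bracketRd x ^+ M * normc (g x)) *
    (bracketRd xi ^+ M * normc (f xi))))).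
  have := ler_wpM2r (normc_ge0 (f xi)) (ler_wpM2l (normc_ge0 (g x)) (Kn x xi)).
  rewrite mulrA => /le_trans; apply.
  by rewrite le_eqVlt; apply/orP; left; apply/eqP; ring.
rewrite -!mulrA ler_wpM2l// !mulrA.
rewrite [leRHS](_ : _ = (D * spaceW x) * (C * spaceW xi)); last by ring.
by rewrite -mulrA; apply: ler_pM => //; rewrite mulr_ge0 ?normc_ge0.
Qed.

Lemma pairing_dominated (K : Rd * Rd -> R[i]) M (n : nat) f g :
  ccontinuous K ->
  (forall x xi, normc (K (x, xi)) <= n%:R * bracketRd x ^+ M * bracketRd xi ^+ M) ->
  SRd R d f -> SRd R d g ->
  let F x := integralRd (fun xi => K (x, xi) * f xi) * g x in
  ccontinuous F /\ exists C, forall x, normc (F x) <= C * spaceW x.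
Proof.
move=> cK Kn Sf Sg.
have [C C0 HC] := schwartz_weight_bound M Sf.
have [D D0 HD] := schwartz_weight_bound M Sg.
have [B B0 HB] := integralRd_bound (R := R) d.
have cf := smooth_continuous (schwartz_smooth Sf).
have cg := smooth_continuous (schwartz_smooth Sg).
have cKf : ccontinuous (fun p : Rd * Rd => K p * f p.2).
  apply: ccontinuousM => //.
  by apply: (ccontinuous_comp (phi := snd) cf) => p; exact: cvg_snd.
have d1 x xi : normc (K (x, xi) * f xi) <= (n%:R * bracketRd x ^+ M * C) * spaceW xi.
  rewrite normcM; apply: (le_trans (ler_wpM2r (normc_ge0 _) (Kn x xi))).
  rewrite -!mulrA ler_wpM2l// ler_wpM2l// ltW// bracketX_gt0//; exact: bracketRd_ge1.
split.
  apply: ccontinuousM => //.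
  apply: (integralRd_continuous (F := fun p : Rd * Rd => K p * f p.2) cKf) => x.
  have [E HE] := bracketRd_locally_bounded M x; exists (n%:R * E * C).
  apply: filterS HE => y HE xi /=; apply: (le_trans (d1 y xi)).
  rewrite ler_wpM2r ?(ltW (weight_gt0 (space_integrator d) xi))//.
  by rewrite ler_wpM2r// ler_wpM2l.
exists (B * n%:R * C * D) => x; rewrite normcM.
have cKx : ccontinuous (fun xi => K (x, xi) * f xi).
  apply: (ccontinuous_comp (phi := fun xi => (x, xi)) cKf).
  by apply: continuous_pair; [exact: cst_continuous|move=> y; exact: cvg_id].
apply: (le_trans (ler_wpM2r (normc_ge0 _) (HB _ _ cKx (d1 x)))).
rewrite [leLHS](_ : _ = B * n%:R * C * (bracketRd x ^+ M * normc (g x))); last by ring.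
by rewrite -(mulrA _ D) ler_wpM2l// !mulr_ge0.
Qed.

Definition transposeOp A v x : R[i] := ((2 * pi) ^- d)%:C *
  transform (-1) (fun _ _ => 1) (transform 1 A v) x.

Lemma normN1 : `|-1 : R| = 1. Proof. by rewrite normrN normr1. Qed.

Lemma fourierE w : fourier w = transform (-1) (fun _ _ => 1) w.
Proof.
apply/funext => xi; congr integralRd; apply/funext => x.
rewrite mulr1 /wave/=; congr (cexp _ * _).
by rewrite mulN1r; apply: complex_ext => /=; ring.
Qed.

Lemma amplitude_kernel sigma M A : amplitude M A -> exists n : nat,
  ccontinuous (fun p : Rd * Rd => wave sigma p * A p.1 p.2) /\
  forall x xi, normc (wave sigma (x, xi) * A x xi) <=
    n%:R * bracketRd x ^+ M * bracketRd xi ^+ M.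
Proof.
move=> [sA hA]; have [n Hn] := hA [::] [::]; exists n; split.
  exact: (ccontinuousM (wave_continuous sigma) (smooth_continuous sA)).
by move=> x xi; rewrite normc_waveM; exact: Hn.
Qed.

Lemma schwartz_dominated v : SRd R d v -> exists C, forall x, normc (v x) <= C * spaceW x.
Proof. by move=> /schwartz_tame[_ /(_ [::])]. Qed.

Lemma schwartzM_dominated f g : SRd R d f -> SRd R d g ->
  ccontinuous (fun x => f x * g x) /\
  exists C, forall x, normc (f x * g x) <= C * spaceW x.
Proof.
move=> Sf Sg; split.
  exact: (ccontinuousM (smooth_continuous (schwartz_smooth Sf))
    (smooth_continuous (schwartz_smooth Sg))).
have [C HC] := schwartz_dominated Sf; have [D HD] := schwartz_dominated Sg.
have W x := weight_gt0 (space_integrator (R := R) d) x.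
have D0 : 0 <= D.
  by rewrite -(pmulr_lge0 _ (W 0)) (le_trans (normc_ge0 _) (HD 0)).
exists (C * D) => x; rewrite normcM.
apply: (@le_trans _ _ (normc (f x) * D)).
  rewrite ler_wpM2l ?normc_ge0// (le_trans (HD x))// ler_piMr//.
  exact: (weight_le1 (space_integrator d)).
by rewrite mulrAC ler_wpM2r.
Qed.

Lemma transpose_pairing M A v w : amplitude M A -> SRd R d v -> SRd R d w ->
  integralRd (fun x => Op A w x * v x) = integralRd (fun x => w x * transposeOp A v x).
Proof.
move=> hA Sv Sw; have s1 : `|1 : R| = 1 by rewrite normr1.
pose c : R[i] := ((2 * pi) ^- d)%:C.
pose F := transform (-1) (fun _ _ => 1 : R[i]) : (Rd -> R[i]) -> Rd -> R[i].
have SF h : SRd R d h -> SRd R d (F h).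
  by move=> Sh; exact: (transform_schwartz normN1 (amplitude_cst1 (d := d)) Sh).
have Sb : SRd R d (transform 1 A v) by exact: (transform_schwartz s1 hA Sv).
have SFw := SF _ Sw.
have [n [cK Kn]] := amplitude_kernel 1 hA.
have [n' [cK' Kn']] := amplitude_kernel (-1) (@amplitude_cst1 R d).
have e1 x : Op A w x = c * integralRd (fun xi => wave 1 (x, xi) * A x xi * F w xi).
  rewrite /Op fourierE; congr (_ * integralRd _); apply/funext => xi.
  by rewrite /wave mul1r.
have [cK1 [C1 HC1]] : ccontinuous
    (fun x => integralRd (fun xi => wave 1 (x, xi) * A x xi * F w xi) * v x) /\
    exists C, forall x, normc (integralRd (fun xi => wave 1 (x, xi) * A x xi * F w xi) * v x)
      <= C * spaceW x by exact: (pairing_dominated cK Kn SFw Sv).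
(* Both sides meet at the pairing of the Fourier transform of w with the inner transform of v: one
   exchange with the kernel of the operator, one with the Fourier kernel. *)
transitivity (c * integralRd (fun xi => F w xi * transform 1 A v xi)).
  rewrite -(pairing_Fubini cK Kn SFw Sv) -(integralRdZ _ cK1 HC1).
  by congr integralRd; apply/funext => x; rewrite e1 mulrA.
have [cw [C HC]] := schwartzM_dominated Sw (SF _ Sb).
rewrite (_ : (fun x => w x * transposeOp A v x) =
  fun x => c * (w x * F (transform 1 A v) x)); last first.
  by apply/funext => x; rewrite /transposeOp mulrCA.
rewrite (integralRdZ _ cw HC); congr (_ * _).
have := pairing_Fubini cK' Kn' Sw Sb; rewrite /= => e.
rewrite (_ : (fun xi => F w xi * transform 1 A v xi) = fun x =>
  integralRd (fun xi => wave (-1) (x, xi) * 1 * w xi) * transform 1 A v x).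
  by rewrite e.
apply/funext => xi; congr (integralRd _ * _); apply/funext => x.
by rewrite wave_swap.
Qed.

Lemma ccontinuous_conj (V : normedModType R) (f : V -> R[i]) : ccontinuous f ->
  ccontinuous (fun z => (f z)^*).
Proof.
move=> [f1 f2]; split.
  by rewrite (_ : (fun _ => _) = fun z => complex.Re (f z))//; apply/funext => z; case: (f z).
rewrite (_ : (fun _ => _) = fun z => - complex.Im (f z)).
  by move=> z; apply: cvgN; exact: f2.
by apply/funext => z; case: (f z).
Qed.

Lemma is_cderive_conj (V : normedModType R) (f : V -> R[i]) (y v : V) l :
  is_cderive f y v l -> is_cderive (fun z => (f z)^*) y v l^*.
Proof.
move=> [f1 f2]; split.
  rewrite (_ : (fun _ => _) = fun z => complex.Re (f z)); last first.
    by apply/funext => z; case: (f z).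
  by rewrite (_ : complex.Re _ = complex.Re l)//; case: (l).
rewrite (_ : (fun _ => _) = - (fun z => complex.Im (f z))); last first.
  by apply/funext => z /=; rewrite /GRing.opp/=; case: (f z).
by rewrite (_ : complex.Im _ = - complex.Im l); [exact: is_deriveN|case: (l)].
Qed.

Lemma conj_Ck (V : normedModType R) (I : Type) (b : I -> V) (f : V -> R[i]) n :
  Ck b n f -> Ck b n (fun z => (f z)^*).
Proof.
elim: n f => [|n IH] f [cf Hf]; split=> //; try exact: ccontinuous_conj.
have [df Cf] := Hf.
have H z i := is_cderive_conj (cderivable_is_cderive (df z i)).
split=> [z i|i]; first by have /is_cderiveP[] := H z i.
by rewrite (cpartial_cderive (H ^~ i)); apply: IH; exact: Cf.
Qed.

Lemma normc_conj (z : R[i]) : normc z^* = normc z.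
Proof. by case: z => a c; rewrite /= sqrrN. Qed.

Lemma conj_partials h s : smooth bR h ->
  partials bR s (fun x => (h x)^*) = fun x => (partials bR s h x)^*.
Proof.
elim/last_ind: s h => [|s i IH] h sh; first by [].
rewrite (partials_rcons bR s i) (partials_rcons bR s i).
rewrite (cpartial_cderive (fun x => is_cderive_conj (smooth_derivable x i sh))).
exact: (IH _ (smooth_cpartial i sh)).
Qed.

Lemma schwartz_conj h : SRd R d h -> SRd R d (fun x => (h x)^*).
Proof.
move=> Sh; have sh := schwartz_smooth Sh.
apply/(schwartzP _ (@bracketRd_ge1 R d)); split.
  by apply/smooth_Ck => n; apply: conj_Ck; move/smooth_Ck: sh; exact.
move=> N; have [C HC] := schwartz_snorm N Sh; exists C => s x sN.
by rewrite (conj_partials s sh) normc_conj; exact: HC.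
Qed.

(** Testing against the conjugate of h = f - g, itself a Schwartz function, gives a vanishing
    integral of |h|^2. This identifies the function chosen by [transpose] with the explicit formula
    [transposeOp]. *)
Lemma pairing_inj f g : SRd R d f -> SRd R d g ->
  (forall w, SRd R d w -> integralRd (fun x => w x * f x) = integralRd (fun x => w x * g x)) ->
  f = g.
Proof.
move=> Sf Sg fg; pose h x := f x + -1 * g x.
have br1 := @bracketRd_ge1 R d.
have Sg' := schwartzZ br1 (-1) Sg.
have Sh : SRd R d h by exact: (schwartzD br1 Sf Sg').
have Sc := schwartz_conj Sh.
have [C HC] := schwartz_dominated Sh.
suff h0 x : h x = 0.
  by apply/funext => x; apply/eqP; rewrite -subr_eq0 -(h0 x) /h mulN1r.
apply: (integralRd_conj_eq0 (smooth_continuous (schwartz_smooth Sh)) HC).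
have [c1 [C1 H1]] := schwartzM_dominated Sc Sf.
have [c2 [C2 H2]] := schwartzM_dominated Sc Sg.
have [c3 [C3 H3]] := schwartzM_dominated Sc Sg'.
rewrite (_ : (fun x => _) = fun x => (h x)^* * f x + (h x)^* * (-1 * g x)); last first.
  by apply/funext => y; rewrite -mulrDr.
rewrite (integralRdD c1 c3 H1 H3).
rewrite (_ : (fun x => (h x)^* * (-1 * g x)) = fun x => -1 * ((h x)^* * g x)); last first.
  by apply/funext => y; rewrite mulrCA.
by rewrite (integralRdZ _ c2 H2) (fg _ Sc) mulN1r subrr.
Qed.

Lemma transposeOp_schwartz M A v : amplitude M A -> SRd R d v -> SRd R d (transposeOp A v).
Proof.
move=> hA Sv; have s1 : `|1 : R| = 1 by rewrite normr1.
apply: schwartzZ; first exact: bracketRd_ge1.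
apply: (transform_schwartz normN1 (@amplitude_cst1 R d)).
exact: (transform_schwartz s1 hA Sv).
Qed.

Lemma transposeE M A v : amplitude M A -> SRd R d v -> transpose (Op A) v = transposeOp A v.
Proof.
move=> hA Sv; rewrite /transpose.
set P := [set g | _].
have P1 : P (transposeOp A v).
  split; first exact: transposeOp_schwartz hA Sv.
  by move=> w Sw; exact: transpose_pairing hA Sv Sw.
have [S2 H2] := xgetPex (fun=> 0) (ex_intro _ _ P1).
apply: pairing_inj => //; first by case: P1.
by move=> w Sw; rewrite -H2// (transpose_pairing hA).
Qed.

Lemma transform_linear sigma M A c f g : `|sigma| = 1 -> amplitude M A ->
  SRd R d f -> SRd R d g ->
  transform sigma A (fun x => c * f x + g x) =
  fun xi => c * transform sigma A f xi + transform sigma A g xi.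
Proof.
move=> s1 hA Sf Sg; apply/funext => xi.
have [n [C HC]] := kernel_dominated sigma hA Sf.
have [n' [D HD]] := kernel_dominated sigma hA Sg.
have Sf' := schwartzZ (@bracketRd_ge1 R d) c Sf.
have [n3 [E HE]] := kernel_dominated sigma hA Sf'.
rewrite /transform -(integralRdZ _ (slice_kernel_continuous sigma xi hA Sf) (HC xi)).
rewrite (_ : (fun x => c * _) = fun x => wave sigma (x, xi) * A x xi * (c * f x)); last first.
  by apply/funext => x; rewrite mulrCA.
rewrite -(integralRdD (slice_kernel_continuous sigma xi hA Sf')
  (slice_kernel_continuous sigma xi hA Sg) (HE xi) (HD xi)).
by congr integralRd; apply/funext => x; rewrite mulrDr.
Qed.

Lemma transpose_schwartz M A v : amplitude M A -> SRd R d v -> SRd R d (transpose (Op A) v).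
Proof. by move=> hA Sv; rewrite (transposeE hA Sv); exact: transposeOp_schwartz hA Sv. Qed.

Lemma transpose_linear M A c f g : amplitude M A -> SRd R d f -> SRd R d g ->
  transpose (Op A) (fun x => c * f x + g x) =
  fun x => c * transpose (Op A) f x + transpose (Op A) g x.
Proof.
move=> hA Sf Sg; have s1 : `|1 : R| = 1 by rewrite normr1.
have br1 := @bracketRd_ge1 R d.
rewrite (transposeE hA Sf) (transposeE hA Sg).
rewrite (transposeE hA (schwartzD br1 (schwartzZ br1 c Sf) Sg)).
apply/funext => x; rewrite /transposeOp (transform_linear _ s1 hA Sf Sg).
rewrite (transform_linear _ normN1 (@amplitude_cst1 R d)
  (transform_schwartz s1 hA Sf) (transform_schwartz s1 hA Sg)).
by rewrite mulrDr mulrCA.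
Qed.

Lemma transpose_bound M A N : amplitude M A -> exists (K : R) (n : nat), 0 <= K /\
  forall v C, SRd R d v -> snorm n n C v -> snorm N N (K * C) (transpose (Op A) v).
Proof.
move=> hA; have s1 : `|1 : R| = 1 by rewrite normr1.
have [n1 H1] := transform_bound normN1 N (@amplitude_cst1 R d).
have [n2 H2] := transform_bound s1 n1 hA.
pose c : R[i] := ((2 * pi) ^- d)%:C.
exists (normc c * n1%:R * n2%:R), n2; split; first by rewrite !mulr_ge0 ?normc_ge0.
move=> v C Sv vC; rewrite (transposeE hA Sv) -!mulrA.
have Sb := transform_schwartz s1 hA Sv.
apply: seminorm_leZ; last exact: (H1 _ _ Sb (H2 _ _ Sv vC)).
exact: (schwartz_smooth (transform_schwartz normN1 (@amplitude_cst1 R d) Sb)).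
Qed.

End Transpose.

(** * Laplace transforms *)

Section Locality.
Context {R : realType} {V : normedModType R} {I : Type}.
Variable b : I -> V.
Implicit Types (f g : V -> R[i]) (s : seq I).

Lemma partials_local (O : set V) f g s : open O -> (forall x, O x -> f x = g x) ->
  forall x, O x -> partials b s f x = partials b s g x.
Proof.
move=> oO fg; elim: s => [|i s IH] x Ox; first exact: fg.
have nx : \forall y \near x, O y by exact: open_nbhs_nbhs.
rewrite /= /cpartial; congr (_ +i* _); apply: near_eq_derive;
  by apply: filterS nx => y Oy; rewrite IH.
Qed.

End Locality.

(** * Exponentials, cutoffs and truncations on the line *)

Section Line.
Context {R : realType}.
Local Notation b1 := (@dirR R).
Local Notation snR := (seminorm_le b1 (@bracketR R)).
Implicit Types (f g psi theta zeta : R -> R[i]) (tau : R[i]) (s : seq unit) (t : R).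

Lemma bracketR_ge1 t : 1 <= bracketR t.
Proof. by rewrite -[leLHS]sqrtr1 ler_wsqrtr// lerDl sqr_ge0. Qed.

Lemma abs_le_bracketR t : `|t| <= bracketR t.
Proof.
by rewrite -sqrtr_sqr ler_wsqrtr// lerDr.
Qed.

Lemma bracketR_le t : bracketR t <= 1 + `|t|.
Proof.
rewrite -(@ler_pXn2r _ 2)// ?nnegrE ?sqrtr_ge0 ?addr_ge0//.
rewrite sqr_sqrtr ?addr_ge0 ?sqr_ge0// -(real_normK (num_real t)).
have : 0 <= `|t| by []; by move: `|t| => x; nra.
Qed.

(** With a negative slope it turns a cutoff into a truncation on the right, with a positive one into
    a step at a prescribed place. *)
Lemma smooth_affine al be zeta : smooth b1 zeta -> smooth b1 (fun t => zeta (al * t + be)) /\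
  forall s t, partials b1 s (fun t => zeta (al * t + be)) t =
    (al%:C) ^+ size s * partials b1 s zeta (al * t + be).
Proof.
move=> sz.
have ca : continuous (fun t : R => al * t + be).
  move=> t; apply: cvgD; last exact: cvg_cst.
  by apply: cvgM; [exact: cvg_cst|exact: cvg_id].
have D f i t : smooth b1 f ->
    is_cderive (fun t => f (al * t + be)) t (b1 i) (al%:C * cpartial b1 i f (al * t + be)).
  move=> sf; have [d1 d2] := smooth_derivable (al * t + be) i sf.
  have da : is_derive t (1 : R) (fun t => al * t + be) al.
    by apply: is_derive_affine => h y; rewrite /GRing.scale/=; ring.
  split.
    have := @is_derive1_comp _ (fun y => complex.Re (f y)) (fun t => al * t + be) t _ _ d1 da.
    by move/is_derive_eq; apply; rewrite ReM/=; ring.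
  have := @is_derive1_comp _ (fun y => complex.Im (f y)) (fun t => al * t + be) t _ _ d2 da.
  by move/is_derive_eq; apply; rewrite ImM/=; ring.
have sm : smooth b1 (fun t => zeta (al * t + be)).
  apply/smooth_Ck => n; elim: n zeta sz => [|n IH] f sf.
    by split=> //; exact: (ccontinuous_comp (smooth_continuous sf) ca).
  split; first exact: (ccontinuous_comp (smooth_continuous sf) ca).
  split=> [t i|i]; first by have /is_cderiveP[] := D f i t sf.
  rewrite (cpartial_cderive (fun t => D f i t sf)).
  by apply: CkM; [exact: Ck_cst|apply: IH; exact: smooth_cpartial].
split=> // s t; elim: s t => [|i s IH] t; first by rewrite expr0 mul1r.
rewrite /= (_ : partials b1 s (fun t => zeta (al * t + be)) =
  fun t => (al%:C) ^+ size s * partials b1 s zeta (al * t + be)); last exact/funext.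
have H u := is_cderiveM (is_cderive_cst (al%:C ^+ size s) u (b1 i))
  (D _ i u (smooth_partials s sz)).
by rewrite (cpartial_cderive H) mul0r add0r exprS; ring.
Qed.

Lemma efunE tau t : efun tau t =
  (expR (- (complex.Re tau * t)))%:C * (cos (- (complex.Im tau * t)) +i* sin (- (complex.Im tau * t))).
Proof.
rewrite /efun /cexp.
have -> : complex.Re (- (tau * t%:C)) = - (complex.Re tau * t) by case: tau => a c /=; ring.
by have -> : complex.Im (- (tau * t%:C)) = - (complex.Im tau * t) by case: tau => a c /=; ring.
Qed.

Lemma normc_efun tau t : normc (efun tau t) = expR (- (complex.Re tau * t)).
Proof.
rewrite efunE normcM normc_real ger0_norm ?expR_ge0//.
by rewrite [normc (_ +i* _)]/= cos2Dsin2 sqrtr1 mulr1.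
Qed.

Lemma efunD tau tau' t : efun (tau + tau') t = efun tau t * efun tau' t.
Proof.
rewrite !efunE ReD ImD !mulrDl !opprD expRD cosD sinD.
by apply: complex_ext; rewrite /=; ring.
Qed.

Lemma efun_cderive tau t i : is_cderive (efun tau) t (b1 i) (- tau * efun tau t).
Proof.
pose a := complex.Re tau; pose c := complex.Im tau.
have rN : complex.Re (- tau) = - a by rewrite /a; case: (tau).
have iN : complex.Im (- tau) = - c by rewrite /c; case: (tau).
have da (k : R) : is_derive t (1 : R) (fun t => - (k * t)) (- k).
  by apply: is_derive_affine => h y; rewrite /GRing.scale/=; ring.
have de := @is_derive1_comp _ expR (fun t => - (a * t)) t _ _ (is_derive_expR (- (a * t))) (da a).
have dc := @is_derive1_comp _ cos (fun t => - (c * t)) t _ _ (is_derive_cos (- (c * t))) (da c).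
have ds := @is_derive1_comp _ sin (fun t => - (c * t)) t _ _ (is_derive_sin (- (c * t))) (da c).
split.
  rewrite (_ : (fun _ => _) = fun u => expR (- (a * u)) * cos (- (c * u))).
    apply: (is_derive_eq (is_deriveM de dc)).
    by rewrite efunE ReM rN iN /GRing.scale/= -/a -/c; ring.
  by apply/funext => u; rewrite efunE /=; ring.
rewrite (_ : (fun _ => _) = fun u => expR (- (a * u)) * sin (- (c * u))).
  apply: (is_derive_eq (is_deriveM de ds)).
  by rewrite efunE ImM rN iN /GRing.scale/= -/a -/c; ring.
by apply/funext => u; rewrite efunE /=; ring.
Qed.

Lemma efun_smooth tau : smooth b1 (efun tau).
Proof.
have ce : ccontinuous (efun tau).
  have D t := efun_cderive tau t tt.
  split=> t; apply: differentiable_continuous; apply/derivable1_diffP.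
    by case: (D t).1.
  by case: (D t).2.
apply/smooth_Ck => n.
have -> : efun tau = fun t => 1 * efun tau t by apply/funext => t; rewrite mul1r.
elim: n (1 : R[i]) => [|n IH] c.
  by split=> //; exact: (ccontinuousM (ccontinuous_cst c) ce).
have H i t := is_cderiveM (is_cderive_cst c t (b1 i)) (efun_cderive tau t i).
split; first exact: (ccontinuousM (ccontinuous_cst c) ce).
split=> [t i|i]; first by have /is_cderiveP[] := H i t.
rewrite (cpartial_cderive (H i)) (_ : (fun _ => _) = fun t => (c * - tau) * efun tau t)//.
by apply/funext => t; rewrite mul0r add0r mulrA.
Qed.

Lemma efun_partials tau s t : partials b1 s (efun tau) t = (- tau) ^+ size s * efun tau t.
Proof.
elim: s t => [|i s IH] t; first by rewrite expr0 mul1r.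
rewrite /= (_ : partials b1 s (efun tau) = fun t => (- tau) ^+ size s * efun tau t); last exact/funext.
have H u := is_cderiveM (is_cderive_cst ((- tau) ^+ size s) u (b1 i)) (efun_cderive tau u i).
by rewrite (cpartial_cderive H) mul0r add0r exprS; ring.
Qed.

Lemma normcX (z : R[i]) n : normc (z ^+ n) = normc z ^+ n.
Proof.
elim: n => [|n IH]; first by rewrite !expr0 normc_one.
by rewrite !exprS normcM IH.
Qed.

Lemma partials_lt f g a s t : (forall u, u < a -> f u = g u) -> t < a ->
  partials b1 s f t = partials b1 s g t.
Proof.
have oa : open [set u : R | u < a] by exact: open_lt.
by move=> fg; exact: (partials_local b1 s oa fg).
Qed.

Lemma partials_gt f g a s t : (forall u, a < u -> f u = g u) -> a < t ->
  partials b1 s f t = partials b1 s g t.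
Proof.
have oa : open [set u : R | a < u] by exact: open_gt.
by move=> fg; exact: (partials_local b1 s oa fg).
Qed.

Lemma partials0 s t : partials b1 s (fun=> 0 : R[i]) t = 0.
Proof.
apply: eq0_normc; apply/eqP; rewrite eq_le normc_ge0 andbT.
by rewrite (le_trans (partials_cst _ _ _ _))// normc_zero.
Qed.

(** On [-c, 0] a continuous function attains its maximum F m; to the left zeta is 0 and to the right
    it is 1, a case covered by the added 1. *)
Lemma cutoff_partials_le c zeta s : 0 < c -> cutoff c zeta ->
  exists C : R, forall t, normc (partials b1 s zeta t) <= C.
Proof.
move=> c0 [sz z0 z1].
have [f1 f2] := smooth_continuous (smooth_partials s sz).
pose F t := `|complex.Re (partials b1 s zeta t)| + `|complex.Im (partials b1 s zeta t)|.
have cF : continuous F by move=> t; apply: cvgD; apply: cvg_norm; [exact: f1|exact: f2].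
have cc : - c <= 0 by rewrite oppr_le0 ltW.
have [m mI mF] := EVT_max cc (continuous_subspaceT cF).
exists (F m + 1) => t.
have Fm0 : 0 <= F m by rewrite addr_ge0.
have [tc|tc] := ltP t (- c).
  rewrite (@partials_lt _ (fun=> 0) (- c))//; last by move=> u /ltW; exact: z0.
  by rewrite partials0 normc_zero; lra.
have [t0|t0] := ltP 0 t.
  rewrite (@partials_gt _ (fun=> 1) 0)//.
    by rewrite (le_trans (partials_cst _ _ _ _))// normc_one; lra.
  by move=> u u0; apply: z1; rewrite (le_trans _ (ltW u0))// oppr_le0 divr_ge0// ltW.
rewrite (le_trans (normc_le_ReIm _))// -/(F t).
by rewrite (@le_trans _ _ (F m))// ?lerDl// mF// in_itv/= tc.
Qed.

Lemma cutoff_bound c zeta N : 0 < c -> cutoff c zeta ->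
  exists n : nat, forall s t, (size s <= N)%N -> normc (partials b1 s zeta t) <= n%:R.
Proof.
move=> c0 cz.
have [||n Hn] := @bounded_words _ (fun s n => forall t, normc (partials b1 s zeta t) <= n%:R) _ _ N.
- by move=> s n m nm H t; apply: (le_trans (H t)); rewrite ler_nat.
- move=> s; have [C HC] := cutoff_partials_le s c0 cz.
  exists (Num.Def.archi_bound `|C|) => t; rewrite (le_trans (HC t))// (le_trans (ler_norm _))//.
  exact/ltW/archi_boundP.
by exists n => s t sN; exact: Hn.
Qed.

Lemma bracketR_expR_bounded (rho c : R) N : 0 < rho -> 0 < c ->
  exists K : R, forall t, - c <= t -> bracketR t ^+ N * expR (- (rho * t)) <= K.
Proof.
(* For t >= -c, y = 1 + 2c + t is at least 1 and at least the bracket of t. The exponential series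
   at rho y gives the factorial over the power of rho; the exponential factor undoes the shift from
   t to y. *)
move=> r0 c0; exists ((1 + N.+1`!%:R / rho ^+ N.+1) * expR (rho * (1 + 2 * c))) => t tc.
pose y := 1 + 2 * c + t.
have y1 : 1 <= y by rewrite /y; lra.
have by_ : bracketR t <= y.
  rewrite (le_trans (bracketR_le t))// /y -addrA lerD2l ler_norml; apply/andP; split; lra.
have b0 : 0 <= bracketR t by exact: le_trans (bracketR_ge1 t).
have -> : - (rho * t) = - (rho * y) + rho * (1 + 2 * c) by rewrite /y; ring.
rewrite expRD mulrA ler_wpM2r ?expR_ge0//.
have e0 : 0 < expR (rho * y) := expR_gt0 _.
have := expR_ge1Dxn N (mulr_ge0 (ltW r0) (le_trans ler01 y1)).
rewrite exprMn => H.
rewrite expRN ler_pdivrMr//.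
apply: (@le_trans _ _ (y ^+ N.+1)).
  apply: (@le_trans _ _ (y ^+ N)); first by rewrite lerXn2r// nnegrE (le_trans b0).
  by rewrite ler_weXn2l.
have rN : 0 < rho ^+ N.+1 by rewrite exprn_gt0.
have fN : 0 < N.+1`!%:R :> R by rewrite ltr0n fact_gt0.
have -> : y ^+ N.+1 = N.+1`!%:R / rho ^+ N.+1 * (rho ^+ N.+1 * y ^+ N.+1 / N.+1`!%:R).
  by field; rewrite !gt_eqF.
rewrite mulrDl mul1r.
have H' : rho ^+ N.+1 * y ^+ N.+1 / N.+1`!%:R <= expR (rho * y).
  by apply: le_trans H; rewrite lerDr.
have P0 : 0 <= N.+1`!%:R / rho ^+ N.+1 by rewrite divr_ge0// ltW.
by have := ler_wpM2l P0 H'; lra.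
Qed.

Lemma efun_cutoff_bound tau c zeta j N : 0 < complex.Re tau -> 0 < c -> cutoff c zeta ->
  exists C, snR j N C (fun t => efun tau t * zeta t).
Proof.
move=> t0 c0 cz; have [sz z0 z1] := cz.
have [n Hn] := cutoff_bound N c0 cz.
have [K HK] := bracketR_expR_bounded j t0 c0.
pose T := (1 + normc tau) ^+ N.
have K0 : 0 <= K.
  apply: le_trans (HK 0 _); last by rewrite oppr_le0 ltW.
  by rewrite mulr_ge0 ?expR_ge0// ltW// bracketX_gt0//; exact: bracketR_ge1.
have T0 : 0 <= T by rewrite exprn_ge0// addr_ge0// normc_ge0.
exists (2 ^+ N * T * n%:R * K) => s t sN.
have [tc|tc] := ltP t (- c).
  rewrite (@partials_lt _ (fun=> 0) (- c))//; last by move=> u /ltW /z0 ->; rewrite mulr0.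
  by rewrite partials0 normc_zero mulr0 !mulr_ge0// exprn_ge0.
have eT s' : (size s' <= N)%N ->
    normc (partials b1 s' (efun tau) t) <= T * expR (- (complex.Re tau * t)).
  move=> sN'; rewrite efun_partials normcM normc_efun ler_wpM2r ?expR_ge0//.
  rewrite normcX normcN /T (@le_trans _ _ ((1 + normc tau) ^+ size s'))//.
    by rewrite lerXn2r ?nnegrE ?addr_ge0 ?normc_ge0// lerDr.
  by rewrite ler_weXn2l// lerDl normc_ge0.
have H := Leibniz_bound sN (efun_smooth tau) sz eT (fun s' => Hn s' t).
have bj : 0 <= bracketR t ^+ j by rewrite ltW// bracketX_gt0//; exact: bracketR_ge1.
apply: (le_trans (ler_wpM2l bj H)).
rewrite [leLHS](_ : _ = 2 ^+ N * T * n%:R * (bracketR t ^+ j * expR (- (complex.Re tau * t)))).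
  by rewrite ler_wpM2l ?HK// !mulr_ge0// exprn_ge0.
by ring.
Qed.

Lemma efun_cutoff_schwartz tau c zeta : 0 < complex.Re tau -> 0 < c -> cutoff c zeta ->
  SR R (fun t => efun tau t * zeta t).
Proof.
move=> t0 c0 cz; apply/(schwartzP _ bracketR_ge1); split.
  by apply: (smoothM (efun_smooth tau)); case: cz.
by move=> N; exact: efun_cutoff_bound t0 c0 cz.
Qed.

(** A cutoff reflected and dilated so that its transition takes place between n + 1 and 2 (n + 1).
    The [+ 0] keeps the shape of [smooth_affine]. *)
Definition cut (c : R) zeta (n : nat) t := zeta (- (c / (2 * n.+1%:R)) * t + 0).

Lemma cut_smooth c zeta n : smooth b1 zeta -> smooth b1 (cut c zeta n).
Proof. by move=> sz; case: (smooth_affine (- (c / (2 * n.+1%:R))) 0 sz). Qed.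

Lemma cut1 c zeta n t : 0 < c -> cutoff c zeta -> t <= n.+1%:R -> cut c zeta n t = 1.
Proof.
move=> c0 [_ _ z1] tn; apply: z1; rewrite addr0 mulNr lerN2.
rewrite mulrAC ler_pdivrMr ?mulr_gt0//.
rewrite (_ : c / 2 * (2 * n.+1%:R) = c * n.+1%:R); last by field.
by rewrite ler_wpM2l// ltW.
Qed.

Lemma cut0 c zeta n t : 0 < c -> cutoff c zeta -> 2 * n.+1%:R <= t -> cut c zeta n t = 0.
Proof.
move=> c0 [_ z0 _] tn; apply: z0; rewrite addr0 mulNr lerN2.
by rewrite mulrAC ler_pdivlMr ?mulr_gt0// ler_wpM2l// ltW.
Qed.

(** The difference lives on t >= n + 1, where one additional power of the bracket is worth a factor
    n + 1; the derivatives of the truncations are bounded uniformly in n. *)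
Lemma cut_approx c zeta psi N : 0 < c -> cutoff c zeta -> SR R psi ->
  exists C, forall n, snR N N (C / n.+1%:R) (fun t => (1 + -1 * cut c zeta n t) * psi t).
Proof.
move=> c0 cz Sp; have [sz z0 z1] := cz; have sp := schwartz_smooth Sp.
have br1 := bracketR_ge1.
have [g Hg] := cutoff_bound N c0 cz.
have /(schwartzP _ br1)[_ /(_ N.+1)[M HM]] := Sp.
have M0 : 0 <= M by exact: (seminorm_le_ge0 br1 HM).
pose F := 1 + (1 + c) ^+ N * g%:R.
exists (2 ^+ N * (F * M)) => n s t sN.
have F0 : 0 <= F by rewrite addr_ge0// mulr_ge0// exprn_ge0// addr_ge0// ltW.
have C0 : 0 <= 2 ^+ N * (F * M) by rewrite !mulr_ge0// exprn_ge0.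
have scut := cut_smooth c n sz.
have s1cut : smooth b1 (fun t => 1 + -1 * cut c zeta n t).
  by apply: smoothD; [exact: smooth_cst|exact: smoothZ].
have [tn|tn] := ltP t n.+1%:R.
  rewrite (@partials_lt _ (fun=> 0) n.+1%:R)//.
    by rewrite partials0 normc_zero mulr0 divr_ge0.
  by move=> u /ltW un; rewrite (cut1 c0 cz un) mulr1 subrr mul0r.
have Fb s' : (size s' <= N)%N ->
    normc (partials b1 s' (fun t => 1 + -1 * cut c zeta n t) t) <= F * bracketR t ^+ 0.
  move=> sN'; rewrite expr0 mulr1 (partialsD _ (smooth_cst _ _) (smoothZ _ scut)).
  rewrite (le_trans (le_normcD _ _))// /F lerD//.
    by rewrite (le_trans (partials_cst _ _ _ _))// normc_one.
  rewrite (partialsZ _ _ scut) normcM normcN normc_one mul1r.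
  have [_ ->] := smooth_affine (- (c / (2 * n.+1%:R))) 0 sz.
  rewrite normcM normcX normc_real normrN; apply: ler_pM => //.
  - exact: normc_ge0.
  - have c1 : `|c / (2 * n.+1%:R)| <= 1 + c.
      rewrite ger0_norm; last by rewrite divr_ge0// ltW.
      rewrite ler_pdivrMr ?mulr_gt0//.
      have n1 : 1 <= n.+1%:R :> R by rewrite ler1n.
      have cc := ltW c0.
      by nra.
    apply: (@le_trans _ _ ((1 + c) ^+ size s')).
      by rewrite lerXn2r ?nnegrE// addr_ge0// ltW.
    by rewrite ler_weXn2l// lerDl ltW.
  - exact: Hg.
have HM' : snR (N.+1 + 0) N M psi.
  by apply: seminorm_leW HM => //; rewrite ?addn0.
have H := partialsM_bound br1 s1cut sp Fb HM' sN.
rewrite ler_pdivlMr//; apply: le_trans H.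
rewrite exprS -mulrA [leLHS]mulrC ler_wpM2r//.
  by rewrite mulr_ge0 ?normc_ge0// ltW// bracketX_gt0.
by rewrite (le_trans tn)// (le_trans (ler_norm t))// abs_le_bracketR.
Qed.

Lemma test_functionP theta : DR R theta <-> smooth b1 theta /\
  exists M, forall t, M < `|t| -> theta t = 0.
Proof.
split=> -[st].
  move=> /compact_bounded[M0 [_ HM]]; split=> //; exists (M0 + 1) => t Mt.
  apply/eqP/negPn/negP => tt0; move: Mt; apply/negP; rewrite -leNgt.
  have M1 : M0 < M0 + 1 by lra.
  by apply: (HM _ M1) => /=; apply: subset_closure.
move=> [M HM]; split=> //.
apply: (subclosed_compact _ (@segment_compact R (- M) M)); first exact: closed_closure.
have e : (`[- M, M]%classic : set R) = closure `[- M, M]%classic.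
  by apply/closure_id; exact: itv_closed.
rewrite [X in _ `<=` X]e.
apply: closure_subset => t /= tt0; rewrite in_itv/= -ler_norml leNgt.
by apply/negP => /HM t00; rewrite t00 eqxx in tt0.
Qed.

Lemma test_functionM f theta : smooth b1 f -> DR R theta -> DR R (fun t => f t * theta t).
Proof.
move=> sf /test_functionP[st [M HM]]; apply/test_functionP; split; first exact: smoothM.
by exists M => t /HM ->; rewrite mulr0.
Qed.

Lemma cut_test_function c c' zeta psi n : 0 < c -> cutoff c zeta -> smooth b1 psi ->
  (forall t, t <= - c' -> psi t = 0) -> DR R (fun t => cut c zeta n t * psi t).
Proof.
move=> c0 cz sp p0; apply/test_functionP; split.
  by case: cz => sz _ _; exact: (smoothM (cut_smooth c n sz) sp).
exists (`|c'| + 2 * n.+1%:R) => t tn.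
have [t0|t0] := ltP t 0.
  rewrite p0 ?mulr0//; rewrite (ltr0_norm t0) in tn.
  have h1 := ler_norm c'; have h2 : 0 <= n.+1%:R :> R by [].
  by lra.
rewrite (cut0 c0 cz) ?mul0r//; rewrite (ger0_norm t0) in tn.
have h1 : 0 <= `|c'| by [].
by lra.
Qed.

End Line.

Section LinearOn.
Context {R : realType} {V : normedModType R}.
Variables (S : set (V -> R[i])) (T : (V -> R[i]) -> R[i]).
Hypothesis linT : linear_on S T.

Lemma linear_on0 : S (fun=> 0) -> T (fun=> 0) = 0.
Proof.
move=> S0; have := linT 1 S0 S0.
rewrite (_ : (fun x => _) = fun=> 0); last by apply/funext => x; rewrite mulr0 addr0.
by rewrite mul1r => /eqP; rewrite -subr_eq subrr => /eqP.
Qed.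

Lemma linear_onD f g : S f -> S g -> T (fun x => f x + g x) = T f + T g.
Proof.
move=> Sf Sg; have := linT 1 Sf Sg; rewrite mul1r => <-; congr T.
by apply/funext => x; rewrite mul1r.
Qed.

End LinearOn.

Section TestFunctions.
Context {R : realType}.
Local Notation b1 := (@dirR R).
Implicit Types (theta : R -> R[i]) (t : R).

Lemma test_function_linear c f g : DR R f -> DR R g -> DR R (fun t => c * f t + g t).
Proof.
move=> /test_functionP[sf [M HM]] /test_functionP[sg [M' HM']].
apply/test_functionP; split; first exact: (smoothD (smoothZ c sf) sg).
exists (Num.max M M') => t; rewrite gt_max => /andP[h1 h2].
by rewrite HM// HM'// mulr0 addr0.
Qed.

Lemma test_function0 : DR R (fun=> 0).
Proof. by apply/test_functionP; split; [exact: smooth_cst|exists 0]. Qed.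

Lemma smooth_step (c : R) zeta T eps : 0 < c -> cutoff c zeta -> 0 < eps ->
  exists2 sigma, smooth b1 sigma & (forall t, t <= T - eps -> sigma t = 0) /\
    (forall t, T - eps / 2 <= t -> sigma t = 1).
Proof.
move=> c0 [sz z0 z1] e0.
exists (fun t => zeta (c / eps * t + (- (c / eps * T)))).
  by case: (smooth_affine (c / eps) (- (c / eps * T)) sz).
have ce : 0 < c / eps by exact: divr_gt0.
split=> t tT.
  apply: z0; have := ler_wpM2l (ltW ce) tT.
  by rewrite mulrBr (_ : c / eps * eps = c); [lra|field; rewrite gt_eqF].
apply: z1; have := ler_wpM2l (ltW ce) tT.
by rewrite mulrBr (_ : c / eps * (eps / 2) = c / 2); [lra|field; rewrite gt_eqF].
Qed.

End TestFunctions.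

(** * Insensitivity to negative times *)

Section Vanishing.
Context {R : realType} {d : nat}.
Local Notation Rd := 'rV[R]_d.
Local Notation b1 := (@dirR R).
Variable u : (R -> R[i]) -> (Rd -> R[i]) -> R[i].
Hypothesis du : Defs.distribution u.
Hypothesis su : dsupport u `<=` `[0, +oo[.
Variables (c : R) (zeta : R -> R[i]).
Hypothesis c0 : 0 < c.
Hypothesis cz : cutoff c zeta.
Variable w : Rd -> R[i].
Hypothesis Sw : SRd R d w.

Let linu : linear_on (DR R) (fun psi => u psi w).
Proof. by case: du => _ + _; apply. Qed.

(** The vanishing of [u] is pushed rightwards up to any negative time: at the
    supremum of the times reached, a cutoff splits a test function into a part
    supported near that time and a part vanishing after an earlier one. *)
Lemma distribution_vanish theta delta : DR R theta -> 0 < delta ->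
  (forall t, - delta <= t -> theta t = 0) -> u theta w = 0.
Proof.
move=> Dth d0 th0; have [_ [M HM]] := (test_functionP theta).1 Dth.
(* The left end -|M| is fixed once for all, so that the set S of times reached is nonempty: below it
   only the zero function is tested. *)
pose P T := forall th, DR R th -> (forall t, t < - `|M| -> th t = 0) ->
  (forall t, T <= t -> th t = 0) -> u th w = 0.
pose S : set R := [set T | T < 0 /\ P T].
have S1 : S (- `|M| - 1).
  split; first by have : 0 <= `|M| by []; move: `|M| => m; lra.
  move=> th Dt tl tr; have -> : th = fun=> 0.
    apply/funext => t; have [tM|tM] := ltP t (- `|M|); first exact: tl.
    by apply: tr; lra.
  exact: (linear_on0 linu (@test_function0 R)).
have hS : has_sup S by split; [exists (- `|M| - 1)|exists 0 => T [/ltW]].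
have s0 : sup S <= 0 by apply: ge_sup; [exists (- `|M| - 1)|move=> T [/ltW]].
suff sS : sup S = 0.
  have [T [T0 PT]] := sup_adherent d0 hS; rewrite sS sub0r => dT.
  apply: PT => // t; last by move=> Tt; apply: th0; rewrite (le_trans (ltW dT)).
  move=> tM; apply: HM; rewrite (le_lt_trans (ler_norm M))//.
  have tn0 : t < 0 by rewrite (lt_le_trans tM)// oppr_le0.
  by rewrite (ltr0_norm tn0) ltrNr.
apply/eqP; rewrite eq_le s0/= leNgt; apply/negP => sneg.
have : ~ dsupport u (sup S).
  by move=> /su /=; rewrite in_itv/= andbT leNgt sneg.
rewrite /dsupport => /contrapT [Q [oQ Qs vQ]].
have /nbhs_ballP[r /= r0 rQ] : nbhs (sup S) Q by exact: open_nbhs_nbhs.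
(* The first bound keeps the segment of radius e around the supremum inside Q, the second keeps sup
   S + e negative. *)
pose e := Num.min (r / 2) (- sup S / 2).
have e0 : 0 < e by rewrite lt_min !divr_gt0// oppr_gt0.
have er : e < r by rewrite gt_min; apply/orP; left; lra.
have es : e <= - sup S / 2 by rewrite ge_min lexx orbT.
have [sigma ssm [sg0 sg1]] := smooth_step (sup S) c0 cz e0.
suff : S (sup S + e) by move=> /(sup_upper_bound hS); lra.
split; first by lra.
move=> th Dt tl tr.
have D1 := test_functionM ssm Dt.
have D2 : DR R (fun t => -1 * (sigma t * th t) + th t).
  exact: test_function_linear.
have -> : th = fun t => (sigma t * th t) + (-1 * (sigma t * th t) + th t).
  by apply/funext => t; rewrite mulN1r addNKr.
rewrite (linear_onD linu D1 D2).
have -> : u (fun t => sigma t * th t) w = 0.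
  apply: vQ => //.
  apply: (@subset_trans _ (closure `[sup S - e, sup S + e]%classic)).
    apply: closure_subset => t /=; rewrite in_itv/= => tt0.
    apply/andP; split; rewrite leNgt; apply/negP => h; case/eqP: tt0.
      by rewrite sg0 ?mul0r// ltW.
    by rewrite tr ?mulr0// ltW.
  have <- : (`[sup S - e, sup S + e]%classic : set R) = closure `[sup S - e, sup S + e]%classic.
    by apply/closure_id; exact: itv_closed.
  move=> t /=; rewrite in_itv/= => /andP[h1 h2]; apply: rQ.
  by rewrite /ball/= ltr_distlC; apply/andP; split; lra.
have e2 : 0 < e / 2 by rewrite divr_gt0.
(* The step equals 1 from sup S - e/2 on, and T lies beyond that point: the remaining part of th
   vanishes from T on, so P T applies. *)
have [T [T0 PT] sT] := sup_adherent e2 hS.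
rewrite (PT _ D2) ?addr0// => t ht; first by rewrite tl// !mulr0 addr0.
by rewrite sg1 ?mul1r ?mulN1r ?addNr// (le_trans (ltW sT)).
Qed.

Lemma distribution_eq th1 th2 delta : DR R th1 -> DR R th2 -> 0 < delta ->
  (forall t, - delta <= t -> th1 t = th2 t) -> u th1 w = u th2 w.
Proof.
move=> D1 D2 d0 e.
have D3 : DR R (fun t => -1 * th2 t + th1 t) by exact: test_function_linear.
have := distribution_vanish D3 d0 _.
rewrite (linu (-1) D2 D1) mulN1r addrC => H.
by apply/eqP; rewrite -subr_eq0; apply/eqP/H => t /e ->; rewrite mulN1r addNr.
Qed.

End Vanishing.

(** * Independence of the Laplace transform from its data *)

Section LaplaceTheory.
Context {R : realType} {d : nat}.
Local Notation Rd := 'rV[R]_d.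
Local Notation b1 := (@dirR R).
Local Notation bR := (@dirRd R d).
Local Notation snR := (seminorm_le b1 (@bracketR R)).
Implicit Types (u U : (R -> R[i]) -> (Rd -> R[i]) -> R[i]) (w : Rd -> R[i]).

Lemma tempered_distribution_bound U B : tempered_distribution U ->
  schwartz_bounded bR (@bracketRd R d) B ->
  exists (C : R) N, 0 <= C /\ forall psi w M, SR R psi -> B w -> snR N N M psi ->
    normc (U psi w) <= C * M.
Proof.
move=> [_ _ hU] /hU[C [N HC]]; exists `|C|, N; split=> // psi w M Spsi Bw psiM.
have [M' HM' e] := seminorm_fin (@bracketR_ge1 R) (Spsi.2 N).
have := HC psi w Spsi Bw; rewrite e -EFinM lee_fin => /le_trans; apply.
have MM : M' <= M by rewrite -lee_fin -e; exact/seminormP.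
apply: (@le_trans _ _ (`|C| * M')); last by rewrite ler_wpM2l.
by rewrite ler_wpM2r ?ler_norm// (seminorm_le_ge0 (@bracketR_ge1 R) HM').
Qed.

Lemma schwartz_bounded1 w : SRd R d w -> schwartz_bounded bR (@bracketRd R d) [set w].
Proof.
move=> Sw; apply/schwartz_boundedP; split; first by move=> f ->.
by move=> N; have [C HC] := schwartz_snorm N Sw; exists C => f ->.
Qed.

Lemma truncation_limit U (c : R) zeta psi w : tempered_distribution U -> 0 < c ->
  cutoff c zeta -> SR R psi -> SRd R d w -> exists C : R, forall n,
  normc (U psi w - U (fun t => cut c zeta n t * psi t) w) <= C / n.+1%:R.
Proof.
move=> tU c0 cz Spsi Sw; have br1 := @bracketR_ge1 R.
have [C [N [C0 HC]]] := tempered_distribution_bound tU (schwartz_bounded1 Sw).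
have [K HK] := cut_approx N c0 cz Spsi.
exists (C * K) => n; pose f t := (1 + -1 * cut c zeta n t) * psi t.
have Sf : SR R f.
  apply/(schwartzP _ br1); split.
    apply: smoothM (schwartz_smooth Spsi).
    by apply: smoothD; [exact: smooth_cst|apply/smoothZ/cut_smooth; case: cz].
  by move=> k; have [L HL] := cut_approx k c0 cz Spsi; exists (L / n.+1%:R); exact: HL.
have [_ linU _] := tU; have {}linU := linU w Sw.
have -> : (fun t => cut c zeta n t * psi t) = fun t => -1 * f t + psi t.
  by apply/funext => t; rewrite /f; ring.
rewrite (linU (-1) _ _ Sf Spsi) mulN1r opprD opprK addrCA subrr addr0 -mulrA.
exact: HC.
Qed.

(** The truncated function is a test function, on which U is given by u; there e_lambda e_(s -
    lambda) = e_s, and the exponent disappears. *)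
Lemma truncation_value u U (lambda c c' : R) s zeta zeta' n w : 0 < c -> cutoff c zeta ->
  0 < c' -> cutoff c' zeta' -> tempered_extension (mul_efun lambda u) U -> SRd R d w ->
  U (fun t => cut c zeta n t * (efun (s - lambda%:C) t * zeta' t)) w =
  u (fun t => cut c zeta n t * (efun s t * zeta' t)) w.
Proof.
move=> c0 cz c'0 cz' [_ eU] Sw.
have [sz' z0 _] := cz'.
have D : DR R (fun t => cut c zeta n t * (efun (s - lambda%:C) t * zeta' t)).
  apply: (@cut_test_function _ c c' zeta (fun t => efun (s - lambda%:C) t * zeta' t) n c0 cz).
    exact: (smoothM (efun_smooth _) sz').
  by move=> t /z0 ->; rewrite mulr0.
rewrite (eU _ _ D Sw) /mul_efun; congr (u _ w); apply/funext => t.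
have -> : efun s t = efun lambda%:C t * efun (s - lambda%:C) t.
  by rewrite -efunD addrC subrK.
by ring.
Qed.

(** The same truncation is applied to both sides. The truncated functions agree from -min(c1, c2)/2
    on, so u gives them the same value, and the two transforms differ by O(1/n). *)
Lemma laplace_unique u s lambda1 lambda2 (c1 c2 : R) zeta1 zeta2 U1 U2 w :
  Defs.distribution u -> dsupport u `<=` `[0, +oo[ ->
  lambda1 < complex.Re s -> lambda2 < complex.Re s ->
  0 < c1 -> cutoff c1 zeta1 -> 0 < c2 -> cutoff c2 zeta2 ->
  tempered_extension (mul_efun lambda1 u) U1 ->
  tempered_extension (mul_efun lambda2 u) U2 -> SRd R d w ->
  U1 (fun t => efun (s - lambda1%:C) t * zeta1 t) w =
  U2 (fun t => efun (s - lambda2%:C) t * zeta2 t) w.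
Proof.
move=> du su l1 l2 c10 cz1 c20 cz2 e1 e2 Sw.
have Re_gt0 l : l < complex.Re s -> 0 < complex.Re (s - l%:C).
  by move=> ls; rewrite ReD -[complex.Re (- _)]/(- l) subr_gt0.
have S1 := efun_cutoff_schwartz (Re_gt0 _ l1) c10 cz1.
have S2 := efun_cutoff_schwartz (Re_gt0 _ l2) c20 cz2.
have [K1 HK1] := truncation_limit e1.1 c10 cz1 S1 Sw.
have [K2 HK2] := truncation_limit e2.1 c10 cz1 S2 Sw.
set x := U1 _ w; set y := U2 _ w.
have xy n : normc (x - y) <= (K1 + K2) / n.+1%:R.
  have E : U1 (fun t => cut c1 zeta1 n t * (efun (s - lambda1%:C) t * zeta1 t)) w =
      U2 (fun t => cut c1 zeta1 n t * (efun (s - lambda2%:C) t * zeta2 t)) w.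
    rewrite (truncation_value s n c10 cz1 c10 cz1 e1 Sw).
    rewrite (truncation_value s n c10 cz1 c20 cz2 e2 Sw).
    have [sz1 z10 z11] := cz1; have [sz2 z20 z21] := cz2.
    apply: (distribution_eq du su c10 cz1 Sw (delta := Num.min (c1 / 2) (c2 / 2))).
    - apply: (@cut_test_function _ c1 c1 zeta1 (fun t => efun s t * zeta1 t) n c10 cz1).
        exact: (smoothM (efun_smooth _) sz1).
      by move=> t /z10 ->; rewrite mulr0.
    - apply: (@cut_test_function _ c1 c2 zeta1 (fun t => efun s t * zeta2 t) n c10 cz1).
        exact: (smoothM (efun_smooth _) sz2).
      by move=> t /z20 ->; rewrite mulr0.
    - by rewrite lt_min !divr_gt0.
    - move=> t ht; rewrite z11 ?z21//.
        by rewrite (le_trans _ ht)// lerN2 ge_min lexx orbT.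
      by rewrite (le_trans _ ht)// lerN2 ge_min lexx.
  have -> : x - y = (x - U1 (fun t => cut c1 zeta1 n t * (efun (s - lambda1%:C) t * zeta1 t)) w)
    - (y - U2 (fun t => cut c1 zeta1 n t * (efun (s - lambda2%:C) t * zeta2 t)) w).
    by rewrite E; ring.
  by rewrite (le_trans (le_normcD _ _))// normcN mulrDl lerD.
apply/eqP; rewrite -subr_eq0; apply/eqP/eq0_normc/eqP.
rewrite eq_le normc_ge0 andbT leNgt; apply/negP => pos.
pose n := Num.Def.archi_bound (`|K1 + K2| / normc (x - y)).
have := xy n; rewrite ler_pdivlMr// => H.
have := archi_boundP (divr_ge0 (normr_ge0 (K1 + K2)) (ltW pos)).
rewrite -/n ltr_pdivrMr// => H'.
have n1 : n%:R <= n.+1%:R :> R by rewrite ler_nat.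
have := ler_wpM2r (ltW pos) n1; have := ler_norm (K1 + K2); lra.
Qed.

(** Multiplying by e_(lambda - lambda0) zeta, bounded with all its derivatives, preserves
    temperedness, and zeta only alters negative times. This provides exponents strictly above the
    abscissa, as [laplace] demands. *)
Lemma temperate_exponent_up u (lambda0 lambda c : R) zeta : Defs.distribution u ->
  dsupport u `<=` `[0, +oo[ -> 0 < c -> cutoff c zeta -> lambda0 < lambda ->
  temperate_exponent u lambda0 -> temperate_exponent u lambda.
Proof.
move=> du su c0 cz ll [U [tU eU]]; have br1 := @bracketR_ge1 R.
have [sz z0 z1] := cz.
pose g t := efun (lambda - lambda0)%:C t * zeta t.
have Re0 : 0 < complex.Re (lambda - lambda0)%:C by rewrite /= subr_gt0.
have sg : smooth b1 g by exact: (smoothM (efun_smooth _) sz).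
have gB N : exists F : R, forall s t, (size s <= N)%N ->
    normc (partials b1 s g t) <= F * bracketR t ^+ 0.
  have [F HF] := efun_cutoff_bound 0 N Re0 c0 cz; exists F => s t sN.
  by have := HF s t sN; rewrite !expr0 mul1r mulr1.
have gM N : exists F : R, 0 <= F /\ forall psi M, smooth b1 psi -> snR N N M psi ->
    snR N N (F * M) (fun t => g t * psi t).
  have [F HF] := gB N; exists (2 ^+ N * F); split.
    have := le_trans (normc_ge0 _) (HF [::] 0 isT); rewrite expr0 mulr1 => F0.
    by rewrite mulr_ge0 ?exprn_ge0.
  move=> psi M sp pM; rewrite -mulrA.
  by apply: (seminorm_leM br1 sg sp HF); rewrite addn0.
have gS psi : SR R psi -> SR R (fun t => g t * psi t).
  move=> Sp; have sp := schwartz_smooth Sp.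
  apply/(schwartzP _ br1); split; first exact: (smoothM sg sp).
  move=> N; have [F [F0 HF]] := gM N; have /(schwartzP _ br1)[_ /(_ N)[M HM]] := Sp.
  by exists (F * M); exact: HF.
exists (fun psi => U (fun t => g t * psi t)); split.
  have [t1 t2 t3] := tU; split.
  - by move=> psi Sp; apply/t1/gS.
  - move=> w Sw k f h Sf Sh.
    rewrite -(t2 w Sw k _ _ (gS _ Sf) (gS _ Sh)); congr (U _ w).
    by apply/funext => t; ring.
  - move=> B hB; have [C [N [C0 HC]]] := tempered_distribution_bound tU hB.
    have [F [F0 HF]] := gM N; exists (C * F), N => psi w Sp Bw.
    have [M HM e] := seminorm_fin br1 (Sp.2 N).
    rewrite e -EFinM lee_fin -mulrA.
    exact: (HC _ _ _ (gS _ Sp) Bw (HF _ _ (schwartz_smooth Sp) HM)).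
move=> psi w Dpsi Sw; rewrite (eU _ _ (test_functionM sg Dpsi) Sw) /mul_efun.
apply: (distribution_eq du su c0 cz Sw (delta := c / 2)).
- exact: (test_functionM (efun_smooth _) (test_functionM sg Dpsi)).
- exact: (test_functionM (efun_smooth _) Dpsi).
- exact: divr_gt0.
- move=> t ht; rewrite /g z1// mulr1 mulrA -efunD; congr (efun _ t * _).
  by rewrite -rmorphD/= addrC subrK.
Qed.

End LaplaceTheory.

(** * The operator acting on distributions in time *)

Section Operator.
Context {R : realType} {d : nat}.
Local Notation Rd := 'rV[R]_d.
Local Notation bR := (@dirRd R d).
Implicit Types (u U : (R -> R[i]) -> (Rd -> R[i]) -> R[i]).
Variables (M : nat) (a : Rd -> Rd -> R[i]).
Hypothesis ha : amplitude M a.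

Lemma tempered_Op_dual T : tempered bR (@bracketRd R d) T ->
  tempered bR (@bracketRd R d) (Op_dual a T).
Proof.
have br1 := @bracketRd_ge1 R d.
move=> /(temperedP _ br1)[linT [C [N [C0 HC]]]]; apply/(temperedP _ br1); split.
  move=> c f g Sf Sg; rewrite /Op_dual (transpose_linear c ha Sf Sg).
  exact: (linT c _ _ (transpose_schwartz ha Sf) (transpose_schwartz ha Sg)).
have [K [n [K0 HK]]] := transpose_bound N ha.
exists (C * K), n; split; first exact: mulr_ge0.
move=> f L Sf fL; rewrite -mulrA.
exact: (HC _ _ (transpose_schwartz ha Sf) (HK _ _ Sf fL)).
Qed.

Lemma schwartz_bounded_transpose B : schwartz_bounded bR (@bracketRd R d) B ->
  schwartz_bounded bR (@bracketRd R d) [set transpose (Op a) w | w in B].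
Proof.
move=> /schwartz_boundedP[BS BN]; apply/schwartz_boundedP; split.
  by move=> _ [w Bw <-]; exact: (transpose_schwartz ha (BS _ Bw)).
move=> N; have [K [n [K0 HK]]] := transpose_bound N ha.
have [L HL] := BN n; exists (K * L) => _ [w Bw <-].
exact: (HK _ _ (BS _ Bw) (HL _ Bw)).
Qed.

Lemma distribution_Op_dist u : Defs.distribution u -> Defs.distribution (Op_dist a u).
Proof.
move=> [u1 u2 u3]; split.
- by move=> psi Dpsi; exact: (tempered_Op_dual (u1 _ Dpsi)).
- by move=> w Sw; exact: (u2 _ (transpose_schwartz ha Sw)).
move=> K B cK hB; have [C [N HC]] := u3 K _ cK (schwartz_bounded_transpose hB).
by exists C, N => psi w Dpsi psiK Bw; apply: HC => //; exists w.
Qed.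

Lemma dsupport_Op_dist u : dsupport (Op_dist a u) `<=` dsupport u.
Proof.
apply: subsetC => t [A [oA At vA]]; exists A; split=> // psi w Dpsi psiA Sw.
exact: (vA _ _ Dpsi psiA (transpose_schwartz ha Sw)).
Qed.

Lemma tempered_extension_Op_dist lambda u U :
  tempered_extension (mul_efun lambda u) U ->
  tempered_extension (mul_efun lambda (Op_dist a u)) (Op_dist a U).
Proof.
move=> [[U1 U2 U3] eU]; split; last first.
  by move=> psi w Dpsi Sw; exact: (eU _ _ Dpsi (transpose_schwartz ha Sw)).
split.
- by move=> psi Spsi; exact: (tempered_Op_dual (U1 _ Spsi)).
- by move=> w Sw; exact: (U2 _ (transpose_schwartz ha Sw)).
move=> B hB; have [C [N HC]] := U3 _ (schwartz_bounded_transpose hB).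
by exists C, N => psi w Spsi Bw; apply: HC => //; exists w.
Qed.

Lemma temperate_exponent_Op_dist u :
  temperate_exponent u `<=` temperate_exponent (Op_dist a u).
Proof.
by move=> lambda [U eU]; exists (Op_dist a U); exact: tempered_extension_Op_dist.
Qed.

Lemma transformable_Op_dist u : transformable u -> transformable (Op_dist a u).
Proof.
move=> [du su [lambda hl]]; split.
- exact: distribution_Op_dist.
- exact: (subset_trans (dsupport_Op_dist (u := u)) su).
- by exists lambda; exact: temperate_exponent_Op_dist.
Qed.

Lemma abscissa_Op_dist u : (abscissa (Op_dist a u) <= abscissa u)%E.
Proof.
rewrite /abscissa; apply: ereal_inf_le_tmp => _ [lambda hl <-].
by exists lambda => //; exact: temperate_exponent_Op_dist.
Qed.

Lemma laplace_Op_dist u s w : transformable u -> (abscissa u < (complex.Re s)%:E)%E ->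
  SRd R d w -> laplace (Op_dist a u) s w = Op_dual a (laplace u s) w.
Proof.
move=> tu us Sw; have [du su _] := tu.
have [dau sau _] := transformable_Op_dist tu.
rewrite /laplace; set P := [set T | _]; set Q := [set T | _].
(* Without a cutoff both sides are the default value 0; a single cutoff, once
   rescaled, provides all the cutoffs and truncations needed. *)
have [[c [zeta [c0 cz]]]|noz] := pselect (exists (c : R) zeta, 0 < c /\ cutoff c zeta); last first.
  have noP T : ~ P T.
    by move=> [l [c [zeta [U [_ [c0 cz] _ _]]]]]; apply: noz; exists c, zeta.
  have noQ T : ~ Q T.
    by move=> [l [c [zeta [U [_ [c0 cz] _ _]]]]]; apply: noz; exists c, zeta.
  by rewrite (xgetPN _ noP) /Op_dual (xgetPN _ noQ).
have [_ [l0 hl0 <-]] := ereal_inf_lt us; rewrite lte_fin => l0s.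
(* The exponent l0 may be the abscissa itself; the midpoint lies strictly between the abscissa and
   Re s. *)
pose l := (l0 + complex.Re s) / 2.
have l0l : l0 < l by rewrite /l; lra.
have ls : l < complex.Re s by rewrite /l; lra.
have [U eU] := temperate_exponent_up du su c0 cz l0l hl0.
have Q0 : exists T, Q T.
  exists (U (fun t => efun (s - l%:C) t * zeta t)), l, c, zeta, U; split=> //; split=> //.
  by apply: (@le_lt_trans _ _ l0%:E); [apply: ereal_inf_lbound; exists l0|rewrite lte_fin].
have [l1 [c1 [zeta1 [U1 [[al1 l1s] [c10 cz1] eU1 eQ]]]]] := xgetPex (fun=> 0) Q0.
have eaU1 := tempered_extension_Op_dist eU1.
have P0 : exists T, P T.
  exists (Op_dist a U1 (fun t => efun (s - l1%:C) t * zeta1 t)), l1, c1, zeta1, (Op_dist a U1).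
  by split=> //; split=> //; exact: le_lt_trans (abscissa_Op_dist u) al1.
have [l2 [c2 [zeta2 [U2 [[al2 l2s] [c20 cz2] eU2 ->]]]]] := xgetPex (fun=> 0) P0.
(* The data chosen for u, carried over by [Op_dist], are admissible for Op(a)u, as are those chosen
   on the left-hand side; uniqueness compares the two. *)
rewrite /Op_dual eQ.
exact: (laplace_unique dau sau l2s l1s c20 cz2 c10 cz1 eU2 eaU1 Sw).
Qed.

End Operator.

Theorem theorem4p16 (R : realType) (d : nat) (m mu : R)
    (a : 'rV[R]_d -> 'rV[R]_d -> R[i])
    (u : (R -> R[i]) -> ('rV[R]_d -> R[i]) -> R[i])
    (hu : transformable u)
    (ha : Hormander_symbol mu a \/ SG_symbol m mu a) :
  [/\ transformable (Op_dist a u),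
      (abscissa (Op_dist a u) <= abscissa u)%E &
      forall s : R[i], (abscissa u < (complex.Re s)%:E)%E ->
      forall w, SRd R d w ->
        laplace (Op_dist a u) s w = Op_dual a (laplace u s) w].
Proof.
have [M hM] := amplitude_symbol ha; split.
- exact: (transformable_Op_dist hM).
- exact: (abscissa_Op_dist hM).
- by move=> s us w Sw; exact: (laplace_Op_dist hM).
Qed.
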